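(* Let $d\ge2$ be even, $\kappa\in\mathbb R\setminus\{0\}$, and $\tau_1^+,\ldots,\tau_d^+,\tau_1^-,\ldots,\tau_d^->0$. Let $$P=\operatorname{conv}\left\{\frac{e_1}{\tau_1^+},\ldots,\frac{e_d}{\tau_d^+},-\frac{e_1}{\tau_1^-},\ldots,-\frac{e_d}{\tau_d^-}\right\}\subseteq\mathbb R^d,$$ where $e_1,\ldots,e_d$ is the standard basis, and assume that $P\subseteq\bar{\mathbb B}^d(\kappa)$. Then $$\operatorname{Vol}_{d,\kappa}(P)=\frac{\omega_{d+1}}{\kappa^{d/2}}\Bigg[\frac12+\frac{\mathrm i}{2\pi}\int_0^\infty\frac{e^{-\kappa y^2/2}}{y}\Bigg(\prod_{j=1}^d\Big(e^{-(\tau_j^+)^2y^2/2}\Phi(\mathrm i\tau_j^+y)+e^{-(\tau_j^-)^2y^2/2}\Phi(\mathrm i\tau_j^-y)\Big)$$ $$-\prod_{j=1}^d\Big(e^{-(\tau_j^+)^2y^2/2}\Phi(-\mathrm i\tau_j^+y)+e^{-(\tau_j^-)^2y^2/2}\Phi(-\mathrm i\tau_j^-y)\Big)\Bigg)dy\Bigg],$$ where $\omega_{d+1}=\frac{2\pi^{(d+1)/2}}{\Gamma((d+1)/2)}$.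
   Context: $\mathbb B^d(\kappa):=\mathbb R^d$ if $\kappa\ge0$ and $\mathbb B^d(\kappa):=\{x\in\mathbb R^d:\|x\|<1/\sqrt{-\kappa}\}$ if $\kappa<0$ (Klein model of the space of constant curvature $\kappa$); $\bar{\mathbb B}^d(\kappa)$ is its Euclidean closure. The Riemannian volume of a Borel set $B\subseteq\bar{\mathbb B}^d(\kappa)$ is $$\operatorname{Vol}_{d,\kappa}(B)=\int_{B\cap\mathbb B^d(\kappa)}\frac{dy_1\cdots dy_d}{(1+\kappa\|y\|^2)^{(d+1)/2}}\in[0,+\infty].$$ $\Phi$ is the entire function $\Phi(z)=\frac12+\frac1{\sqrt{2\pi}}\int_0^z e^{-t^2/2}\,dt$, $z\in\mathbb C$, and $\mathrm i=\sqrt{-1}$. *)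

(* Defs.v *)
From HB Require Import structures.
From mathcomp Require Import all_boot all_order all_algebra.
From mathcomp Require Import all_classical all_reals all_analysis.
From mathcomp.real_closed Require Import complex.

Set Implicit Arguments.
Unset Strict Implicit.
Unset Printing Implicit Defensive.

Import Order.TTheory GRing.Theory Num.Theory.
Import numFieldNormedType.Exports.

Local Open Scope classical_set_scope.
Local Open Scope complex_scope.
Local Open Scope ring_scope.

Section lebesgue_tuple.
Context {R : realType}.
Local Notation mR := (measurableTypeR R).

Definition tuple_cons n (p : mR * n.-tuple mR) : n.+1.-tuple mR :=
  [tuple of p.1 :: p.2].

Lemma measurable_tuple_cons n : measurable_fun [set: _] (@tuple_cons n).
Proof.
by apply: measurable_cons; [exact: measurable_fst|exact: measurable_snd].
Qed.

(* Lebesgue measure on R^n, on the library's product sigma-algebra of n-tuples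
   (the Borel sets of R^n): the n-fold product of lebesgue_measure, each
   product being transported along (x, t) |-> x :: t.  The long name is the
   library's measure structure on [pushforward m f] for a measurable f. *)
Fixpoint lebesgue_tuple n : {measure set (n.-tuple mR) -> \bar R} :=
  match n with
  | 0 => dirac [tuple]
  | m.+1 => measure_function_pushforward__canonical__measure_function_Measure
              (@lebesgue_measure R \x^ lebesgue_tuple m)%E
              (@measurable_tuple_cons m)
  end.

End lebesgue_tuple.

Section klein_model.
Context {R : realType}.
Implicit Types (d : nat) (kappa : R).

(* The library's norm on 'rV[R]_d is the sup norm; its topology is the
   Euclidean one, so [closure] below is the Euclidean closure. *)
Definition enorm d (x : 'rV[R]_d) : R := Num.sqrt (\sum_i x 0 i ^+ 2).

Definition klein d kappa : set 'rV[R]_d :=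
  if 0 <= kappa then setT else [set x | enorm x < 1 / Num.sqrt (- kappa)].
Arguments klein : clear implicits.

Definition klein_closed d kappa : set 'rV[R]_d := closure (klein d kappa).
Arguments klein_closed : clear implicits.

Definition row_of_tuple d (t : d.-tuple (measurableTypeR R)) : 'rV[R]_d :=
  \row_i tnth t i.

Definition Vol d kappa (B : set 'rV[R]_d) : \bar R :=
  (\int[@lebesgue_tuple R d]_(t in row_of_tuple (d := d) @^-1` (B `&` klein d kappa))
     (1 / ((1 + kappa * enorm (row_of_tuple t) ^+ 2) `^ (d.+1%:R / 2)))%:E)%E.

Definition conv d (A : set 'rV[R]_d) : set 'rV[R]_d :=
  smallest (fun B => @convex_set R 'rV[R]_d B) A.

Definition crosspolytope d (taup taum : 'I_d -> R) : set 'rV[R]_d :=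
  conv ([set (taup j)^-1 *: delta_mx 0 j | j in [set: 'I_d]] `|`
        [set - ((taum j)^-1 *: delta_mx 0 j) | j in [set: 'I_d]]).

Definition Gamma (s : R) : R :=
  \int[@lebesgue_measure R]_(t in `]0, +oo[) (t `^ (s - 1) * expR (- t)).

(* omega n = surface area of the unit sphere of R^n *)
Definition omega (n : nat) : R := 2 * pi `^ (n%:R / 2) / Gamma (n%:R / 2).

End klein_model.
Arguments klein {R}.
Arguments klein_closed {R}.

Section complex_analysis.
Context {R : realType}.
Implicit Types (D : set R) (f : R -> R[i]) (z : R[i]).

Definition Cexp z : R[i] :=
  (expR (complex.Re z))%:C * (cos (complex.Im z) +i* sin (complex.Im z)).

Definition Cintegrable D f : Prop :=
  (@lebesgue_measure R).-integrable D (fun y => (complex.Re (f y))%:E) /\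
  (@lebesgue_measure R).-integrable D (fun y => (complex.Im (f y))%:E).

Definition Cintegral D f : R[i] :=
  (\int[@lebesgue_measure R]_(y in D) complex.Re (f y)) +i*
  (\int[@lebesgue_measure R]_(y in D) complex.Im (f y)).

(* The contour integral of g from 0 to z, taken along the straight segment
   s |-> s z; for entire g it does not depend on the path. *)
Definition Cprimitive (g : R[i] -> R[i]) z : R[i] :=
  Cintegral `[0, 1] (fun s => g (s%:C * z) * z).

Definition Phi z : R[i] :=
  1 / 2 + (1 / Num.sqrt (2 * pi))%:C * Cprimitive (fun t => Cexp (- (t ^+ 2 / 2))) z.

End complex_analysis.

(* The integrand of the volume formula; only its values for y > 0 matter. *)
Definition vol_integrand (R : realType) d (kappa : R) (taup taum : 'I_d -> R)
    (y : R) : R[i] :=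
  (expR (- (kappa * y ^+ 2 / 2)) / y)%:C *
  (\prod_(j < d)
      ((expR (- (taup j ^+ 2 * y ^+ 2 / 2)))%:C * Phi ('i%C * (taup j * y)%:C) +
       (expR (- (taum j ^+ 2 * y ^+ 2 / 2)))%:C * Phi ('i%C * (taum j * y)%:C)) -
   \prod_(j < d)
      ((expR (- (taup j ^+ 2 * y ^+ 2 / 2)))%:C * Phi (- 'i%C * (taup j * y)%:C) +
       (expR (- (taum j ^+ 2 * y ^+ 2 / 2)))%:C * Phi (- 'i%C * (taum j * y)%:C))).

(* Main.v *)
From HB Require Import structures.
Require Import Defs.
From mathcomp Require Import all_boot all_order all_algebra.
From mathcomp Require Import all_classical all_reals all_analysis.
From mathcomp.real_closed Require Import complex.
From mathcomp Require Import measurable_realfun ring lra.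
Import Order.TTheory GRing.Theory Num.Theory.
Import numFieldNormedType.Exports.

(** Let h(x) be the sum over j of max(tau_j^+ x_j, - tau_j^- x_j). The polytope
    P is the set h <= 1 ([crosspolytopeE]), and h is a sum of functions of one
    coordinate each.

    The density of the volume is a Gaussian integral in one more variable:
    (1 + kappa |y|^2)^(-(d+1)/2) is, up to the constant [gauss_moment d], the
    integral of r^d exp(-r^2 (1 + kappa |y|^2)/2) over r > 0. Exchanging the
    integrals and dilating by z = r y shows that the volume of P is, up to
    this constant, the Laplace integral
      L(kappa) = int exp(-kappa |z|^2/2) Q(h(z)) dz  over R^d,
    where Q(s) is the integral of exp(-r^2/2) over r >= s ([radial_laplace],
    [volume_laplace]).

    For kappa > 0, a sine integral represents Q(s) ([gauss_tail_fourier]), and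
    Fubini leads to the integrals of exp(i u h) against the Gaussian weight.
    These are products of one-dimensional Fourier integrals, each of which is a
    sum of two values of sqrt(2 pi) exp(-y^2/2) Phi(i y)
    ([gauss_gauge_fourier], [gauss_tuple_tail]). This gives
      kappa^(d/2) L(kappa) = c0 - c1 J(kappa),
      J(kappa) = int_0^oo exp(-kappa u^2/2) K(u) du,
    where K(u) is the imaginary part of the product, divided by u
    ([laplace_gt0]). The integrand of the theorem is 2 i exp(-kappa u^2/2) K(u)
    because Phi(- i y) is the conjugate of Phi(i y) ([vol_integrandE]).

    For kappa < 0, put k = - kappa. The inclusion of P in the closed ball says
    that (tau_j^+)^2 >= k and (tau_j^-)^2 >= k ([crosspolytope_klein]). The real
    part of each factor of the product is then at most exp(-k u^2/2); as d is
    even, each term of the imaginary part of the product contains such a real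
    part, so K(u) = O(exp(-k u^2/2) / (1 + u^2)) ([Im_kernel_bound]). Hence J
    is defined on [-k, oo[, while L is finite on ]-k, oo[ because h^2 >= k |z|^2.
    In the variable t = 1 - kappa both are integrals of exp(t s) against a
    fixed function, with s >= 0, hence sums of power series on [0, 1 + k)
    ([laplace_power_series]). The identity above holds for 0 < t < 1, so it
    holds on ]-k, 0[ by the identity theorem ([power_series_on_eq0],
    [laplace_continuation]), and at -k by passing to the limit
    ([laplace_endpoint]). *)

Set Implicit Arguments.
Unset Strict Implicit.
Unset Printing Implicit Defensive.
Local Open Scope classical_set_scope.
Local Open Scope complex_scope.
Local Open Scope ring_scope.

(** * Real integrals and power series in a parameter *)

Section real_dominated.
Context d (T : measurableType d) (R : realType) (mu : {measure set T -> \bar R}).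

Lemma Rdominated_cvg (D : set T) (f_ : nat -> T -> R) (f g : T -> R) :
  measurable D -> (forall n, measurable_fun D (f_ n)) ->
  (forall x, D x -> f_ ^~ x @ \oo --> f x) ->
  mu.-integrable D (EFin \o g) ->
  (forall n x, D x -> `|f_ n x| <= g x) ->
  mu.-integrable D (EFin \o f) /\
  (fun n => \int[mu]_(x in D) f_ n x) @ \oo --> \int[mu]_(x in D) f x.
Proof.
move=> mD mf_ f_f ig f_g.
have mf : measurable_fun D f by exact: (measurable_fun_cvg mf_ f_f).
have [//|||||If _ H] := @dominated_convergence _ _ _ mu D mD
  (fun n => EFin \o f_ n) (EFin \o f) (EFin \o g).
- by move=> n; apply/measurable_EFinP; exact: mf_.
- exact/measurable_EFinP.
- by apply: aeW => x Dx; apply: cvg_EFin; [exact: nearW|exact: f_f].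
- exact: ig.
- by apply: aeW => x n Dx; rewrite lee_fin f_g.
split=> //; apply: fine_cvg; rewrite fineK//.
exact: integrable_fin_num.
Qed.

Lemma le_Rintegrable (D : set T) (f g : T -> R) :
  measurable D -> measurable_fun D f -> (forall x, D x -> `|f x| <= g x) ->
  mu.-integrable D (EFin \o g) -> mu.-integrable D (EFin \o f).
Proof.
move=> mD mf fg ig; apply: (le_integrable mD _ _ ig).
  exact/measurable_EFinP.
by move=> x Dx; rewrite lee_fin/= (le_trans (fg x Dx))// ler_norm.
Qed.

Lemma integrable_mull (D : set T) (c : R) (f : T -> R) : measurable D ->
  mu.-integrable D (EFin \o f) -> mu.-integrable D (fun x => (c * f x)%:E).
Proof. by move=> mD; exact: integrableZl. Qed.

Lemma integrable_addr (D : set T) (f g : T -> R) : measurable D ->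
  mu.-integrable D (EFin \o f) -> mu.-integrable D (EFin \o g) ->
  mu.-integrable D (fun x => (f x + g x)%:E).
Proof. by move=> mD; exact: integrableD. Qed.

Lemma integrable_subr (D : set T) (f g : T -> R) : measurable D ->
  mu.-integrable D (EFin \o f) -> mu.-integrable D (EFin \o g) ->
  mu.-integrable D (fun x => (f x - g x)%:E).
Proof. by move=> mD; exact: integrableB. Qed.

End real_dominated.

Section power_series.
Context {R : realType}.
Implicit Types (T e c : R) (F G : R -> R).

(** The functions of interest are Laplace transforms with a one-sided
    parameter, so convergence is only recorded to the right of 0; this is
    enough for an identity theorem. *)
Definition power_series_on T F := exists a : nat -> R,
  forall t : R, 0 <= t < T -> series (fun n => a n * t ^+ n) @ \oo --> F t.

Lemma power_series_on_ext T F G : (forall t : R, 0 <= t < T -> F t = G t) ->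
  power_series_on T F -> power_series_on T G.
Proof. by move=> FG [a aF]; exists a => t tT; rewrite -FG//; exact: aF. Qed.

Lemma power_series_onD T F G : power_series_on T F -> power_series_on T G ->
  power_series_on T (fun t => F t + G t).
Proof.
move=> [a aF] [b bG]; exists (fun n => a n + b n) => t tT.
rewrite [X in X @ _ --> _](_ : _ = (series (fun n => a n * t ^+ n) \+
    series (fun n => b n * t ^+ n))).
  by apply: cvgD; [exact: aF|exact: bG].
apply/funext => N; rewrite /series/= -big_split/=.
by apply: eq_bigr => i _; rewrite mulrDl.
Qed.

Lemma power_series_onZ T F c : power_series_on T F ->
  power_series_on T (fun t => c * F t).
Proof.
move=> [a aF]; exists (fun n => c * a n) => t tT.
rewrite [X in X @ _ --> _](_ : _ = (fun N => c * series (fun n => a n * t ^+ n) N)).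
  by apply: cvgMr; exact: aF.
apply/funext => N; rewrite /series/= mulr_sumr.
by apply: eq_bigr => i _; rewrite mulrA.
Qed.

Lemma power_series_on_mulX T F : power_series_on T F ->
  power_series_on T (fun t => t * F t).
Proof.
move=> [a aF]; exists (fun n => if n is m.+1 then a m else 0) => t tT.
rewrite -cvg_shiftS/=.
rewrite [X in X @ _ --> _](_ : _ = (fun N => t * series (fun n => a n * t ^+ n) N)).
  by apply: cvgMr; exact: aF.
apply/funext => N; rewrite /series/= big_nat_recl//= mul0r add0r mulr_sumr.
by apply: eq_bigr => i _; rewrite exprS mulrCA.
Qed.

Lemma power_series_on_cst T c : power_series_on T (fun=> c).
Proof.
exists (fun n => if n is m.+1 then 0 else c) => t tT.
rewrite -cvg_shiftS/=.
rewrite [X in X @ _ --> _](_ : _ = (fun N => c)); first exact: cvg_cst.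
apply/funext => N; rewrite /series/= big_nat_recl//= expr0 mulr1 big1 ?addr0// => i _.
by rewrite mul0r.
Qed.

Lemma power_series_on_linX T F n : power_series_on T F ->
  power_series_on T (fun t => (1 - t) ^+ n * F t).
Proof.
move=> PF; elim: n => [|n IH].
  by apply: power_series_on_ext PF => t _; rewrite expr0 mul1r.
apply: (power_series_on_ext _
  (power_series_onD IH (power_series_onZ (-1) (power_series_on_mulX IH)))).
by move=> t _ /=; rewrite exprS; ring.
Qed.

(** The coefficients vanish one after the other: once a_0, ..., a_(n-1) do,
    the tail of the series beyond rank n is O(t^(n+1)), so that F t = 0 for
    small t leaves a_n = O(t). *)
Lemma power_series_on_eq0 T F e : power_series_on T F -> 0 < e ->
  (forall t : R, 0 < t < e -> F t = 0) -> forall t : R, 0 <= t < T -> F t = 0.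
Proof.
move=> [a aF] e0 F0 t0 /andP[t00 t0T].
have T0 : 0 < T by exact: le_lt_trans t0T.
suff a0 n : a n = 0.
  have := aF t0; rewrite t00 t0T => /(_ isT).
  rewrite [X in X @ _ --> _](_ : _ = (fun N => 0)).
    by move/cvg_lim => <-//; rewrite lim_cst.
  by apply/funext => N; rewrite /series/= big1// => i _; rewrite a0 mul0r.
have [r [r0 rT]] : exists r : R, 0 < r /\ r < T by exists (T / 2); lra.
(* the terms of the convergent series at the radius r < T are bounded *)
have [M Mr] : exists M : R, forall n, `|a n * r ^+ n| <= M.
  have /aF raF : 0 <= r < T by rewrite rT ltW.
  have cr : cvgn (series (fun n => a n * r ^+ n)) by apply/cvg_ex; eexists; exact: raF.
  have := cvg_series_cvg_0 cr => c0.
  have /cvg_seq_bounded : cvgn (fun n => a n * r ^+ n) by apply/cvg_ex; eexists; exact: c0.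
  move=> [M [_ /(_ (M + 1))]]; rewrite ltrDl ltr01 => /(_ isT) H.
  by exists (M + 1) => k; exact: H.
have M0 : 0 <= M by rewrite (le_trans _ (Mr 0%N)).
have ar k : `|a k| <= M / r ^+ k.
  by rewrite ler_pdivlMr ?exprn_gt0// -[X in _ * X]ger0_norm ?exprn_ge0 ?(ltW r0)// -normrM.
elim/ltn_ind: n => n IH.
apply/eqP; rewrite -normr_le0; apply/ler_addgt0Pr => eps eps0; rewrite add0r.
pose C := 2 * M / r ^+ n.+1.
have C0 : 0 <= C by rewrite /C divr_ge0 ?exprn_ge0 ?(ltW r0) ?mulr_ge0.
pose t := Num.min (Num.min (e / 2) (r / 2)) (eps / (C + 1)).
have C10 : 0 < C + 1 by rewrite ltr_wpDl.
have t_gt0 : 0 < t by rewrite /t !lt_min !divr_gt0.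
have te : t < e by rewrite /t gt_min gt_min; apply/orP; left; apply/orP; left; lra.
have tr : t <= r / 2 by rewrite /t ge_min ge_min lexx orbT.
have teps : t <= eps / (C + 1) by rewrite /t ge_min lexx orbT.
have tT : 0 <= t < T by rewrite (ltW t_gt0)/=; lra.
have := aF t tT; rewrite F0 ?t_gt0//.
rewrite -(cvg_shiftn n.+1) => /= aF0.
(* as t / r <= 1/2, the tail is dominated by a geometric series of ratio 1/2 *)
have tail N : `|series (fun k => a k * t ^+ k) (N + n.+1)%N - a n * t ^+ n| <=
    C * t ^+ n.+1.
  have -> : series (fun k => a k * t ^+ k) (N + n.+1)%N - a n * t ^+ n =
            \sum_(n.+1 <= i < N + n.+1) a i * t ^+ i.
    rewrite /series/= (@big_cat_nat _ _ _ n.+1)//= ?leq_addl// big_nat_recr//=.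
    rewrite big_nat_cond big1 ?add0r; first by ring.
    by move=> i /andP[/andP[_ /IH ->]]; rewrite mul0r.
  rewrite (le_trans (ler_norm_sum _ _ _))//.
  have -> : C * t ^+ n.+1 = 2 * (M * (t / r) ^+ n.+1).
    by rewrite exprMn exprVn /C -!mulrA; congr (_ * (_ * _)); rewrite mulrC.
  suff H : \sum_(n.+1 <= i < N + n.+1) `|a i * t ^+ i| <=
      (2 - 2 * (1 / 2) ^+ N) * (M * (t / r) ^+ n.+1).
    apply: (le_trans H); rewrite ler_wpM2r//.
      by rewrite mulr_ge0// exprn_ge0// divr_ge0// ltW.
    by rewrite gerBl mulr_ge0// exprn_ge0.
  have tr1 : t / r <= 1 / 2 by rewrite ler_pdivrMr//; lra.
  have tr0 : 0 <= t / r by rewrite divr_ge0// ltW.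
  elim: N => [|N IHN].
    by rewrite add0n big_geq// expr0 mulr1 subrr mul0r.
  rewrite addSn big_nat_recr/= ?leq_addl//.
  have : `|a (N + n.+1)%N * t ^+ (N + n.+1)| <= (1 / 2) ^+ N * (M * (t / r) ^+ n.+1).
    rewrite normrM [`|t ^+ _|]ger0_norm ?exprn_ge0 ?(ltW t_gt0)//.
    apply: (@le_trans _ _ (M / r ^+ (N + n.+1) * t ^+ (N + n.+1))).
      by rewrite ler_wpM2r// exprn_ge0// ltW.
    rewrite (_ : M / _ * _ = (t / r) ^+ N * (M * (t / r) ^+ n.+1)).
      apply: ler_wpM2r; first by rewrite mulr_ge0// exprn_ge0.
      by rewrite lerXn2r// nnegrE; lra.
    by rewrite [RHS]mulrCA -exprD exprMn exprVn -mulrA (mulrC (r ^- _)).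
  by move: IHN; rewrite [(1 / 2) ^+ N.+1]exprS; lra.
have : `|a n * t ^+ n| <= C * t ^+ n.+1.
  rewrite -normrN -[- _]sub0r.
  apply: (@cvgr_to_le _ \oo _ _ (fun N : nat =>
    `|series (fun k => a k * t ^+ k) (N + n.+1)%N - a n * t ^+ n|)).
    by apply: cvg_norm; apply: cvgB; [exact: aF0|exact: cvg_cst].
  by apply: nearW => N; exact: tail.
rewrite normrM [`|t ^+ _|]ger0_norm ?exprn_ge0 ?(ltW t_gt0)// exprS mulrA.
rewrite ler_pM2r ?exprn_gt0// => /le_trans; apply.
apply: (@le_trans _ _ ((C + 1) * t)); first by rewrite ler_wpM2r ?(ltW t_gt0)// lerDl.
by rewrite mulrC -ler_pdivlMr.
Qed.

End power_series.

Section laplace_power_series.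
Context d (T : measurableType d) (R : realType) (mu : {measure set T -> \bar R}).
Variables (D : set T) (mD : measurable D) (s g : T -> R).
Hypotheses (ms : measurable_fun D s) (mg : measurable_fun D g).
Hypothesis s0 : forall x, D x -> 0 <= s x.

Let expE_ge N (x : R) : 0 <= x -> \sum_(0 <= i < N) x ^+ i / i`!%:R <= expR x.
Proof.
move=> x0; have := is_cvg_series_exp_coeff x; move/nondecreasing_cvgn_le.
move=> /(_ _ N); apply => m n mn.
rewrite /series/= (big_cat_nat (leq0n m) mn)/= lerDl sumr_ge0// => i _.
by rewrite divr_ge0// exprn_ge0.
Qed.

(** Expand exp(t s) in powers of t. Since s is nonnegative, the partial sums
    are dominated by exp(t s) itself, so the expansion is valid as far as the
    integral converges absolutely. *)
Lemma laplace_power_series (t1 : R) :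
  (forall t : R, 0 <= t < t1 -> mu.-integrable D (fun x => (expR (t * s x) * g x)%:E)) ->
  power_series_on t1 (fun t => \int[mu]_(x in D) (expR (t * s x) * g x)).
Proof.
move=> intg.
have [t10|t10] := leP t1 0; first by exists (fun=> 0) => t; lra.
exists (fun n => \int[mu]_(x in D) (s x ^+ n / n`!%:R * g x)) => t tt1.
(* (r s)^n / n! <= exp(r s) bounds every moment by one Laplace integral *)
have isn n : mu.-integrable D (EFin \o (fun x => s x ^+ n / n`!%:R * g x)).
  have [r [r0 rt1]] : exists r : R, 0 < r /\ 0 <= r < t1 by exists (t1 / 2); lra.
  have /= := integrableZl mD (r ^- n) (integrable_norm (intg _ rt1)).
  apply: le_Rintegrable => //=.
    apply: measurable_funM => //; apply: measurable_funM => //.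
    exact: measurable_funX.
  move=> x Dx; rewrite !normrM (ger0_norm (expR_ge0 _)) mulrA ler_wpM2r//.
  rewrite -normrM ger0_norm; last by rewrite divr_ge0 ?exprn_ge0 ?s0.
  rewrite ler_pdivlMl ?exprn_gt0// mulrA -exprMn.
  have rs : 0 <= r * s x by rewrite mulr_ge0 ?s0// ltW.
  apply: le_trans (expE_ge n.+1 rs).
  rewrite big_nat_recr//= lerDr sumr_ge0// => i _.
  by rewrite divr_ge0// exprn_ge0.
have partial N : mu.-integrable D (EFin \o (fun x =>
      (\sum_(0 <= i < N) (t * s x) ^+ i / i`!%:R) * g x)) /\
    \int[mu]_(x in D) ((\sum_(0 <= i < N) (t * s x) ^+ i / i`!%:R) * g x) =
    series (fun n => \int[mu]_(x in D) (s x ^+ n / n`!%:R * g x) * t ^+ n) N.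
  elim: N => [|N [IH1 IH2]].
    split; first by under eq_fun do rewrite /= big_nil mul0r; exact: integrable0.
    rewrite /series/= big_nil; under eq_Rintegral do rewrite big_nil mul0r.
    by rewrite Rintegral_cst// mul0r.
  have E : (fun x => (\sum_(0 <= i < N.+1) (t * s x) ^+ i / i`!%:R) * g x) =
    (fun x => (\sum_(0 <= i < N) (t * s x) ^+ i / i`!%:R) * g x +
       t ^+ N * (s x ^+ N / N`!%:R * g x)).
    by apply/funext => x; rewrite big_nat_recr//= exprMn; ring.
  have I2 := integrableZl mD (t ^+ N) (isn N).
  rewrite E; split.
    have := integrableD mD IH1 I2; exact: eq_integrable.
  rewrite RintegralD// IH2 RintegralZl// /series/= big_nat_recr//=.
  by rewrite [X in _ + X]mulrC.
rewrite [X in X @ _ --> _](_ : _ = (fun N => \int[mu]_(x in D)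
    ((\sum_(0 <= i < N) (t * s x) ^+ i / i`!%:R) * g x))); last first.
  by apply/funext => N; rewrite (partial N).2.
apply: (Rdominated_cvg mD _ _ (integrable_norm (intg t tt1)) _).2.
- by move=> n; have [/measurable_int/measurable_EFinP] := partial n.
- move=> x Dx; apply: cvgMl; exact: is_cvg_series_exp_coeff.
- move=> n x Dx /=; rewrite !normrM ler_wpM2r//.
  have ts : 0 <= t * s x by rewrite mulr_ge0 ?s0//; lra.
  rewrite !ger0_norm ?expR_ge0//; first exact: expE_ge.
  by rewrite sumr_ge0// => i _; rewrite divr_ge0// exprn_ge0.
Qed.

End laplace_power_series.

(** * Lebesgue measure on tuples *)

Section lebesgue_scale.
Context {R : realType}.
Local Notation mR := (measurableTypeR R).
Local Notation leb := (@lebesgue_measure R).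
Local Open Scope ereal_scope.

Lemma measurable_scale (c : R) : measurable_fun [set: mR] (fun x : mR => (c * x)%R : mR).
Proof. exact: mulrl_measurable. Qed.

(** Both sides are measures in A that agree on the intervals ]a, b]. *)
Lemma lebesgue_measure_scale (c : R) (A : set R) : (0 < c)%R -> measurable A ->
  leb A = c%:E * leb ((fun x => c * x)%R @^-1` A).
Proof.
move=> c0 mA.
pose m : {measure set mR -> \bar R} := mscale (NngNum (ltW c0))
  (measure_function_pushforward__canonical__measure_function_Measure leb (measurable_scale c)).
have mE B : m B = c%:E * leb ((fun x => c * x)%R @^-1` B) by [].
rewrite -mE (@lebesgue_measure_unique R m)// => _ [[a b]] _ <-.
rewrite mE.
rewrite (_ : _ @^-1` _ = `](a / c)%R, (b / c)%R]%classic); last first.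
  by apply/seteqP; split => x /=; rewrite !in_itv/= ltr_pdivrMr// ler_pdivlMr// mulrC.
rewrite !lebesgue_measure_itv/= !lte_fin ltr_pM2r ?invr_gt0//.
case: ifPn => _; last by rewrite mule0.
by rewrite !EFinN -!EFinB -EFinM -mulrBl mulrCA divff ?mulr1// gt_eqF.
Qed.

Lemma ge0_integral_scale (c : R) (f : R -> \bar R) : (0 < c)%R ->
  measurable_fun [set: R] f -> (forall x, 0 <= f x) ->
  \int[leb]_x f x = c%:E * \int[leb]_x f (c * x)%R.
Proof.
move=> c0 mf f0.
pose m : {measure set mR -> \bar R} := mscale (NngNum (ltW c0))
  (measure_function_pushforward__canonical__measure_function_Measure leb (measurable_scale c)).
rewrite (@eq_measure_integral _ _ _ _ m)//; last first.
  by move=> A mA _; rewrite [LHS](@lebesgue_measure_scale c).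
rewrite ge0_integral_mscale//= ge0_integral_pushforward//.
exact: measurable_scale.
Qed.

End lebesgue_scale.

Section lebesgue_tuple_theory.
Context {R : realType}.
Local Notation mR := (measurableTypeR R).
Local Notation leb := (@lebesgue_measure R).
Local Open Scope ereal_scope.

(** A constant of its own for the measure, so that sigma-finiteness can be
    declared as an instance of it and the theorems on product measures
    apply. *)
Definition tuple_leb n : set (n.-tuple mR) -> \bar R := @lebesgue_tuple R n.

HB.instance Definition _ n := Measure.on (@tuple_leb n).

Definition tuple_uncons n (t : n.+1.-tuple mR) : mR * n.-tuple mR :=
  (thead t, [tuple of behead t]).

Lemma tuple_consK n : cancel (@tuple_cons R n) (@tuple_uncons n).
Proof. by move=> [x t]; congr pair; apply/val_inj. Qed.

Lemma measurable_tuple_uncons n : measurable_fun [set: _] (@tuple_uncons n).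
Proof.
apply/measurable_fun_pair => /=; last exact: measurable_behead.
exact: (@measurable_tnth _ mR n.+1 ord0).
Qed.

Lemma tuple_leb_sigma_finite n : sigma_finite setT (@tuple_leb n).
Proof.
elim: n => [|n /sigma_finiteP[F [FT ndF Foo]]].
  exists (fun=> setT) => [|_]; first by rewrite bigcup_const.
  by split=> //; rewrite /tuple_leb/= diracE mem_set// ltry.
have /sigma_finiteP[G [GT ndG Goo]] := sigma_finiteT leb.
exists (fun k => @tuple_uncons n @^-1` (G k `*` F k)) => [|k].
  apply/esym; rewrite -subTset => t _.
  have : [set: R] (thead t) by [].
  have : [set: n.-tuple mR] [tuple of behead t] by [].
  rewrite FT GT => -[i _ Fi] [j _ Gj]; exists (maxn i j) => //; split => /=.
    by move: (ndG j (maxn i j)); rewrite leq_maxr => /(_ isT)/subsetPset; exact.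
  by move: (ndF i (maxn i j)); rewrite leq_maxl => /(_ isT)/subsetPset; exact.
have [[mF Fk] [mG Gk]] := (Foo k, Goo k).
have mGF : measurable (G k `*` F k) by exact: measurableX.
split.
  by rewrite -[X in measurable X]setTI; exact: measurable_tuple_uncons.
rewrite /tuple_leb/= /pushforward -comp_preimage.
rewrite (_ : @tuple_uncons n \o @tuple_cons R n = id) ?preimage_id; last first.
  by apply/funext => x /=; rewrite tuple_consK.
by rewrite product_measure2E// lte_mul_pinfty// ge0_fin_numE.
Qed.

HB.instance Definition _ n := @Measure_isSigmaFinite.Build _ _ _ (@tuple_leb n)
  (@tuple_leb_sigma_finite n).

(** Tonelli on the product of the line with the shorter tuples: the products
    [\x] and [\x^], taken in either order, coincide by uniqueness. *)
Lemma ge0_integral_tuple_cons n (f : n.+1.-tuple mR -> \bar R) :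
  measurable_fun [set: _] f -> (forall t, 0 <= f t) ->
  \int[lebesgue_tuple n.+1]_t f t =
  \int[lebesgue_tuple n]_t \int[leb]_x f (tuple_cons (x, t)).
Proof.
move=> mf f0; rewrite ge0_integral_pushforward//; last exact: measurable_tuple_cons.
rewrite preimage_setT.
have mfc : measurable_fun setT (f \o @tuple_cons R n).
  by apply: measurableT_comp => //; exact: measurable_tuple_cons.
rewrite -[RHS](@fubini_tonelli2 _ _ _ _ _ leb (@tuple_leb n) (f \o @tuple_cons R n))//; last first.
  by move=> z; exact: f0.
apply/esym/eq_measure_integral => //= A mA _.
by apply: product_measure_unique => // B C mB mC/=; rewrite product_measure2E.
Qed.

Lemma integral_tuple_cons n (f : n.+1.-tuple mR -> \bar R) :
  measurable_fun [set: _] f ->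
  (leb \x (@tuple_leb n)).-integrable setT (f \o @tuple_cons R n) ->
  (lebesgue_tuple n.+1).-integrable setT f /\
  \int[lebesgue_tuple n.+1]_t f t =
  \int[leb \x (@tuple_leb n)]_z f (tuple_cons z).
Proof.
move=> mf intf.
have E A : measurable A -> A `<=` setT -> (leb \x (@tuple_leb n)) A =
    (leb \x^ (@tuple_leb n)) A.
  move=> mA _.
  by apply: product_measure_unique => // B C mB mC/=; rewrite product_measure2E.
have intf2 : (leb \x^ (@tuple_leb n)).-integrable setT (f \o @tuple_cons R n).
  move/integrableP : intf => [mfc fco]; apply/integrableP; split => //.
  by rewrite -(eq_measure_integral _ E).
split.
  by apply: integrable_pushforward => //; exact: measurable_tuple_cons.
rewrite integral_pushforward//; last exact: measurable_tuple_cons.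
by rewrite preimage_setT; exact/esym/eq_measure_integral.
Qed.

Definition tuple_scale n (c : R) (t : n.-tuple mR) : n.-tuple mR :=
  [tuple of [seq (c * x)%R | x <- t]].

Lemma measurable_tuple_scale n c : measurable_fun setT (@tuple_scale n c).
Proof.
apply/measurable_fun_tnthP => i.
rewrite (_ : _ \o _ = (fun x : mR => (c * x)%R : mR) \o (@tnth n mR ^~ i)).
  by apply: measurableT_comp; [exact: measurable_scale|exact: measurable_tnth].
by apply/funext => t /=; rewrite tnth_map.
Qed.

Lemma ge0_integral_tuple_scale n (c : R) (f : n.-tuple mR -> \bar R) : (0 < c)%R ->
  measurable_fun [set: _] f -> (forall t, 0 <= f t) ->
  \int[lebesgue_tuple n]_t f t =
  (c ^+ n)%:E * \int[lebesgue_tuple n]_t f (tuple_scale c t).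
Proof.
move=> c0; elim: n f => [|n IH] f mf f0.
  rewrite /= !integral_dirac// ?expr0 ?diracT ?mul1e.
    by congr f; apply/val_inj.
  by apply: measurableT_comp => //; exact: measurable_tuple_scale.
rewrite !ge0_integral_tuple_cons//; last first.
  by apply: measurableT_comp => //; exact: measurable_tuple_scale.
have mfc : measurable_fun setT (f \o @tuple_cons R n).
  by apply: measurableT_comp => //; exact: measurable_tuple_cons.
under eq_integral => t _.
  rewrite (@ge0_integral_scale _ c) => //; last first.
    exact: (measurableT_comp mfc (pair2_measurable t)).
  over.
have mG : measurable_fun setT (fun t : n.-tuple mR => \int[leb]_x f (tuple_cons (c * x, t)%R)).
  apply: (@measurable_fun_fubini_tonelli_G _ _ mR (n.-tuple mR) R leb
    (fun z => f (tuple_cons (c * z.1, z.2)%R))) => //.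
  apply: (measurableT_comp mfc) => /=.
  apply/measurable_fun_pair => /=; last exact: measurable_snd.
  by apply: measurableT_comp; [exact: measurable_scale|exact: measurable_fst].
rewrite [LHS]ge0_integralZl//; last 2 first.
  by move=> t _; exact: integral_ge0.
  by rewrite lee_fin ltW.
rewrite [X in _ * X = _]IH//; last by move=> t; exact: integral_ge0.
rewrite muleA -EFinM -exprS; congr (_ * _).
apply: eq_integral => t _; apply: eq_integral => x _; congr f.
exact/val_inj.
Qed.

End lebesgue_tuple_theory.

Section product_integral.
Local Open Scope ereal_scope.

Lemma integral_prod_mul d1 d2 (T1 : measurableType d1) (T2 : measurableType d2)
    (R : realType) (m1 : {sigma_finite_measure set T1 -> \bar R})
    (m2 : {sigma_finite_measure set T2 -> \bar R}) (p : T1 -> R) (q : T2 -> R) :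
  m1.-integrable setT (EFin \o p) -> m2.-integrable setT (EFin \o q) ->
  (m1 \x m2).-integrable setT (fun z => (p z.1 * q z.2)%:E) /\
  (\int[m1 \x m2]_z (p z.1 * q z.2) = \int[m1]_x p x * \int[m2]_y q y)%R.
Proof.
move=> ip iq.
have mp : measurable_fun setT p by have /measurable_int/measurable_EFinP := ip.
have mq : measurable_fun setT q by have /measurable_int/measurable_EFinP := iq.
have mpq : measurable_fun setT (fun z : T1 * T2 => (p z.1 * q z.2)%:E).
  apply/measurable_EFinP; apply: measurable_funM.
    by apply: measurableT_comp => //; exact: measurable_fst.
  by apply: measurableT_comp => //; exact: measurable_snd.
have ipq : (m1 \x m2).-integrable setT (fun z => (p z.1 * q z.2)%:E).
  apply/integrable12ltyP => //=.
  under eq_integral => x _.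
    under eq_integral => y _ do rewrite normrM EFinM.
    rewrite ge0_integralZl//; last by do 2 apply: measurableT_comp => //.
    over.
  rewrite ge0_integralZr//=; last 2 first.
    by do 2 apply: measurableT_comp => //.
    by apply: integral_ge0.
  have /integrableP[_ p_oo] := ip; have /integrableP[_ q_oo] := iq.
  rewrite lte_mul_pinfty// ?integral_ge0// ge0_fin_numE// ?integral_ge0//.
split=> //; rewrite /Rintegral -integral12_prod_meas1// /fubini_F /=.
under eq_integral => x _.
  under eq_integral => y _ do rewrite EFinM.
  rewrite integralZl//; over.
rewrite -(fineK (integrable_fin_num _ iq))//= integralZr// fineM//.
exact: integrable_fin_num.
Qed.

End product_integral.

Section tuple_product_integral.
Context {R : realType}.
Local Notation mR := (measurableTypeR R).
Local Notation leb := (@lebesgue_measure R).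

(** The multiplicativity behind the product formula for Fourier transforms.
    Real and imaginary parts go through the induction together, as neither of
    them is a product by itself. *)
Lemma integral_tuple_prod n (u v : 'I_n -> R -> R) :
  (forall j, leb.-integrable setT (EFin \o u j)) ->
  (forall j, leb.-integrable setT (EFin \o v j)) ->
  let P (t : n.-tuple mR) : R[i] :=
    \prod_(j < n) (u j (tnth t j) +i* v j (tnth t j)) in
  [/\ (lebesgue_tuple n).-integrable setT (fun t => (complex.Re (P t))%:E),
      (lebesgue_tuple n).-integrable setT (fun t => (complex.Im (P t))%:E) &
      (\int[lebesgue_tuple n]_t complex.Re (P t)) +i*
      (\int[lebesgue_tuple n]_t complex.Im (P t)) =
      \prod_(j < n) ((\int[leb]_x u j x) +i* (\int[leb]_x v j x))].
Proof.
elim: n u v => [|n IH] u v iu iv P.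
  have PE : P = fun=> 1 by apply/funext => t; rewrite /P big_ord0.
  have fT : (lebesgue_tuple 0 [set: 0.-tuple mR] < +oo)%E.
    by rewrite /= diracT ltry.
  rewrite big_ord0 PE/=; split.
  - exact: finite_measure_integrable_cst.
  - exact: finite_measure_integrable_cst.
  - have E (r : R) : \int[lebesgue_tuple 0]_(t in [set: 0.-tuple mR]) r = r.
      by rewrite Rintegral_cst// [lebesgue_tuple 0 _]diracT mulr1.
    by transitivity ((1 : R) +i* 0) => //; congr (_ +i* _); exact: E.
pose Q (t : n.-tuple mR) : R[i] :=
  \prod_(j < n) (u (lift ord0 j) (tnth t j) +i* v (lift ord0 j) (tnth t j)).
have := IH (fun j => u (lift ord0 j)) (fun j => v (lift ord0 j))
  (fun j => iu _) (fun j => iv _).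
rewrite -/Q => -[iQr iQi QE].
have PQ z : P (tuple_cons z) = (u ord0 z.1 +i* v ord0 z.1) * Q z.2.
  rewrite /P big_ord_recl/=; congr (_ * _).
  by apply: eq_bigr => i _; rewrite /tuple_cons tnthS.
have PE t : P t = P (tuple_cons (tuple_uncons t)).
  by congr P; rewrite /tuple_cons /= {1}[t]tuple_eta; apply/val_inj.
have mP : measurable_fun setT (fun t => complex.Re (P t)) /\
          measurable_fun setT (fun t => complex.Im (P t)).
  have mf (w : R -> R) : leb.-integrable setT (EFin \o w) ->
      measurable_fun setT (fun t : n.+1.-tuple mR => w (tuple_uncons t).1).
    move=> /measurable_int/measurable_EFinP mw.
    apply: (measurableT_comp mw).
    by apply: (measurableT_comp measurable_fst); exact: measurable_tuple_uncons.
  have mq (w : n.-tuple mR -> R) : (lebesgue_tuple n).-integrable setT (EFin \o w) ->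
      measurable_fun setT (fun t : n.+1.-tuple mR => w (tuple_uncons t).2).
    move=> /measurable_int/measurable_EFinP mw.
    apply: (measurableT_comp mw).
    by apply: (measurableT_comp measurable_snd); exact: measurable_tuple_uncons.
  have := (mf _ (iu ord0), mf _ (iv ord0), mq _ iQr, mq _ iQi).
  move=> [[[m1 m2] m3] m4].
  split; under eq_fun do rewrite PE PQ.
    have := measurable_funB (measurable_funM m1 m3) (measurable_funM m2 m4).
    apply: eq_measurable_fun => t _ /=.
    by case: (Q _).
  have := measurable_funD (measurable_funM m1 m4) (measurable_funM m2 m3).
  apply: eq_measurable_fun => t _ /=.
  by case: (Q _).
have [ur_i ur] := @integral_prod_mul _ _ _ _ _ leb (@tuple_leb R n) _ _ (iu ord0) iQr.
have [ui_i ui] := @integral_prod_mul _ _ _ _ _ leb (@tuple_leb R n) _ _ (iu ord0) iQi.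
have [vr_i vr] := @integral_prod_mul _ _ _ _ _ leb (@tuple_leb R n) _ _ (iv ord0) iQr.
have [vi_i vi] := @integral_prod_mul _ _ _ _ _ leb (@tuple_leb R n) _ _ (iv ord0) iQi.
have RE z : complex.Re (P (tuple_cons z)) =
    u ord0 z.1 * complex.Re (Q z.2) - v ord0 z.1 * complex.Im (Q z.2).
  by rewrite PQ; case: (Q _).
have IE z : complex.Im (P (tuple_cons z)) =
    u ord0 z.1 * complex.Im (Q z.2) + v ord0 z.1 * complex.Re (Q z.2).
  by rewrite PQ; case: (Q _).
have [/measurable_EFinP mP1 /measurable_EFinP mP2] := mP.
have [|I1 E1] := integral_tuple_cons mP1.
  apply: eq_integrable (integrableB measurableT ur_i vi_i) => //.
  by move=> z _ /=; rewrite RE.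
have [|I2 E2] := integral_tuple_cons mP2.
  apply: eq_integrable (integrableD measurableT ui_i vr_i) => //.
  by move=> z _ /=; rewrite IE.
split => //.
have -> : \int[lebesgue_tuple n.+1]_t complex.Re (P t) = \int[(leb \x @tuple_leb R n)%E]_z
    (u ord0 z.1 * complex.Re (Q z.2) - v ord0 z.1 * complex.Im (Q z.2)).
  by congr fine; rewrite E1; apply: eq_integral => z _; rewrite -RE.
have -> : \int[lebesgue_tuple n.+1]_t complex.Im (P t) = \int[(leb \x @tuple_leb R n)%E]_z
    (u ord0 z.1 * complex.Im (Q z.2) + v ord0 z.1 * complex.Re (Q z.2)).
  by congr fine; rewrite E2; apply: eq_integral => z _; rewrite -IE.
rewrite big_ord_recl -QE RintegralB// RintegralD// ur ui vr vi.
by [].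
Qed.

End tuple_product_integral.

(** * Integration on the half-line and the Gaussian function *)

Section derivative_lambda.
Context {R : realType}.
Implicit Types (f g : R -> R) (x : R).

(** Rules of differentiation for functions given by lambda-abstractions, with
    the derivative as an explicit value. *)
Lemma is_derive_mul f g x (a b : R) : is_derive x (1:R) f a -> is_derive x (1:R) g b ->
  is_derive x (1:R) (fun x => f x * g x) (a * g x + f x * b).
Proof.
move=> fa gb; have := is_deriveM fa gb => /is_derive_eq; apply.
by rewrite addrC mulrC /GRing.scale/=.
Qed.

Lemma is_derive_comp f g x (a b : R) : is_derive (g x) (1:R) f a -> is_derive x (1:R) g b ->
  is_derive x (1:R) (fun x => f (g x)) (a * b).
Proof. by move=> fa gb; exact: is_derive1_comp. Qed.

Lemma is_derive_scale f x (a c : R) : is_derive x (1:R) f a ->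
  is_derive x (1:R) (fun x => c * f x) (c * a).
Proof. by move=> fa; have := is_deriveZ c fa. Qed.

Lemma is_derive_mulid (c x : R) : is_derive x (1:R) (fun x : R => c * x) c.
Proof.
have := is_derive_scale c (is_derive_id x (1 : R)).
by move/is_derive_eq; apply; rewrite mulr1.
Qed.

Lemma is_derive_mulidr (c x : R) : is_derive x (1:R) (fun x : R => x * c) c.
Proof.
have := is_derive_mulid c x; set u := (X in is_derive _ _ X).
by rewrite (_ : u = (fun x => x * c))//; apply/funext => y; rewrite /u mulrC.
Qed.

Lemma is_derive_halfsqr (x : R) : is_derive x (1:R) (fun x : R => x ^+ 2 / 2) x.
Proof.
have h := is_derive_mul (is_derive_id x (1 : R)) (is_derive_mulidr 2^-1 x).
rewrite (_ : (fun x : R => x ^+ 2 / 2) = (fun x : R => x * (x * 2^-1))).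
  by apply: (is_derive_eq h); rewrite mul1r -mulrDr -div1r -splitr mulr1.
by apply/funext => y; rewrite expr2 mulrA.
Qed.

Lemma is_derive_continuous f (df : R -> R) : (forall x, is_derive x (1:R) f (df x)) ->
  continuous f.
Proof.
move=> fdf x; apply: differentiable_continuous; apply/derivable1_diffP.
by have [] := fdf x.
Qed.

End derivative_lambda.

Section fundamental_theorem.
Context {R : realType}.
Local Notation leb := (@lebesgue_measure R).
Variables (F f : R -> R).
Hypotheses (dF : forall x, is_derive x (1:R) F (f x)) (cf : continuous f).

Lemma Rintegral_is_derive (a b : R) : a < b ->
  leb.-integrable `[a, b] (EFin \o f) /\
  \int[leb]_(x in `[a, b]) f x = F b - F a.
Proof.
move=> ab.
have cf' : {within `[a, b], continuous f} by apply: continuous_subspaceT.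
split; first by apply: continuous_compact_integrable => //; exact: segment_compact.
have cF := is_derive_continuous dF.
rewrite /Rintegral (@continuous_FTC2 _ f F) => [//|//|//||].
  split; [|by apply: cvg_at_right_filter; exact: cF
          |by apply: cvg_at_left_filter; exact: cF].
  by move=> x _; have [] := dF x.
by move=> x _; rewrite derive1E; have [_] := dF x.
Qed.

(** The segments [0, n] exhaust the half-line. As f is integrable, the limit
    of F along the integers suffices. *)
Lemma Rintegral_is_derivey (l : R) :
  leb.-integrable `]0, +oo[ (EFin \o f) -> F n%:R @[n --> \oo] --> l ->
  \int[leb]_(x in `]0, +oo[) f x = l - F 0.
Proof.
move=> intf Fl.
have mf : measurable_fun setT f by exact: continuous_measurable_fun.
have H : (fun n => \int[leb]_(x in `]0, +oo[) (f \_ `[0, n%:R]) x) @ \oo -->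
    \int[leb]_(x in `]0, +oo[) f x.
  apply: (Rdominated_cvg _ _ _ (integrable_norm intf) _).2 => //.
  - move=> n; apply: measurable_funTS.
    by apply/(measurable_restrictT f) => //; exact: measurable_funTS.
  - move=> x; rewrite /= in_itv/= andbT => x0.
    apply: cvg_near_cst; near=> n.
    rewrite patchE mem_set//= in_itv/= (ltW x0)/=.
    by near: n; exact: nbhs_infty_ger.
  - move=> n x _; rewrite patchE; case: ifPn => //.
    by move=> _; rewrite [X in `|X|](_ : _ = 0)// normr0 normr_ge0.
apply: (cvg_unique _ H) => //.
rewrite -(cvg_shiftS (fun n => F n%:R)) in Fl.
rewrite /= -cvg_shiftS.
rewrite [X in X @ _ --> _](_ : _ = (fun n => F n.+1%:R - F 0)).
  by apply: cvgB => //; exact: cvg_cst.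
apply/funext => n /=.
have [I1 <-] := @Rintegral_is_derive 0 n.+1%:R (ltr0Sn _ _).
rewrite -Rintegral_itv_obnd_cbnd//; last first.
  by apply: integrableS I1 => //; move=> z /=; rewrite !in_itv/= => /andP[/ltW -> ->].
rewrite -Rintegral_mkcondr; congr (Rintegral _ _ _).
apply/seteqP; split=> x /=; rewrite !in_itv/= andbT.
  by move=> [-> /andP[]].
by move=> /andP[x0 ->]; rewrite x0 ltW.
Unshelve. all: by end_near. Qed.

End fundamental_theorem.

Section derivative_under_integral.
Context d {Y : measurableType d} {R : realType} {mu : {measure set Y -> \bar R}}.

Lemma is_derive_under_integral (B : set Y) (f df : R -> Y -> R) (G : Y -> R) :
  measurable B -> (forall x, mu.-integrable B (EFin \o f x)) ->
  (forall x y, B y -> is_derive x (1:R) (f ^~ y) (df x y)) ->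
  (forall y, 0 <= G y) -> mu.-integrable B (EFin \o G) ->
  (forall x y, B y -> `|df x y| <= G y) ->
  forall a : R, is_derive a (1 : R) (fun x => \int[mu]_(y in B) f x y)
    (\int[mu]_(y in B) df a y).
Proof.
move=> mB intf dfE G0 intG Gub a.
have Ia : `](a - 1), (a + 1)[%classic a by rewrite /= in_itv/=; apply/andP; split; lra.
have E x y : B y -> partial1of2 f x y = df x y.
  by move=> By; rewrite partial1of2E; have [_] := dfE x y By.
have H1 := derivable_under_integral mB Ia (fun x _ => intf x).
have H2 := differentiation_under_integral mB Ia (fun x _ => intf x).
have dd x y : `](a - 1), (a + 1)[%classic x -> B y -> derivable (f ^~ y) x 1.
  by move=> _ By; have [] := dfE x y By.
have Gb x y : `](a - 1), (a + 1)[%classic x -> B y -> `|partial1of2 f x y| <= G y.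
  by move=> _ By; rewrite E//; exact: Gub.
split; first exact: (H1 dd G).
rewrite -derive1E (H2 dd G)//; apply: eq_Rintegral => y; rewrite inE => By.
exact: E.
Qed.

End derivative_under_integral.

Section scale_halfline.
Context {R : realType}.
Local Notation mR := (measurableTypeR R).
Local Notation leb := (@lebesgue_measure R).
Local Notation pos := (`]0, +oo[%classic : set R).

Lemma lt_pmul_pinfty (c : R) (x : \bar R) : 0 < c -> (c%:E * x < +oo)%E ->
  (x < +oo)%E.
Proof.
by move=> c0; rewrite !ltey; apply: contraNN => /eqP ->; rewrite gt0_muley ?lte_fin.
Qed.

Lemma mem_pos_scale (c x : R) : 0 < c -> (c * x \in pos) = (x \in pos).
Proof. by move=> c0; apply/idP/idP; rewrite !inE/= !in_itv/= !andbT pmulr_rgt0. Qed.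

Lemma ge0_integral_scale_pos (c : R) (f : R -> \bar R) : 0 < c ->
  measurable_fun pos f -> (forall x, 0 < x -> (0 <= f x)%E) ->
  (\int[leb]_(x in pos) f x = c%:E * \int[leb]_(x in pos) f (c * x)%R)%E.
Proof.
move=> c0 mf f0.
rewrite integral_mkcond (@ge0_integral_scale _ c)//; last 2 first.
  by apply/(measurable_restrictT f).
  move=> x; rewrite patchE; case: ifPn => // /set_mem/=.
  by rewrite in_itv/= andbT => /f0.
rewrite [in RHS]integral_mkcond; congr (_ * _)%E; apply: eq_integral => x _.
by rewrite !patchE mem_pos_scale.
Qed.

Lemma measurable_scale_pos d (T : measurableType d) (c : R) (f : R -> T) : 0 < c ->
  measurable_fun pos f -> measurable_fun pos (fun x => f (c * x)).
Proof.
move=> c0 mf.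
apply: (@measurable_comp _ _ _ _ _ _ pos) => //.
by move=> _ [x /= + <-]; rewrite !in_itv/= !andbT => x0; rewrite mulr_gt0.
Qed.

Lemma Rintegral_scale_pos (c : R) (f : R -> R) : 0 < c ->
  leb.-integrable pos (EFin \o f) ->
  \int[leb]_(x in pos) f x = c * \int[leb]_(x in pos) f (c * x).
Proof.
move=> c0 intf.
have /measurable_int/measurable_EFinP mf := intf.
have mfc := measurable_scale_pos c0 mf.
have /integrableP[_ fo] := intf.
have abs_fin : (\int[leb]_(x in pos) `|(f (c * x))%:E| < +oo)%E.
  move: fo; rewrite (@ge0_integral_scale_pos c)//; last first.
    exact/measurable_EFinP/measurableT_comp.
  exact: lt_pmul_pinfty.
have intfc : leb.-integrable pos (fun x => (f (c * x))%:E).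
  by apply/integrableP; split => //; exact/measurable_EFinP.
have mEf : measurable_fun pos (EFin \o f) by exact/measurable_EFinP.
rewrite /Rintegral -[X in _ = X * _]/(fine c%:E) -fineM//; last exact: (integrable_fin_num _ intfc).
congr fine.
rewrite integralE [in RHS]integralE.
rewrite (@ge0_integral_scale_pos c (EFin \o f)^\+%E)//; last exact: measurable_funepos.
rewrite (@ge0_integral_scale_pos c (EFin \o f)^\-%E)//; last exact: measurable_funeneg.
rewrite [RHS]muleBr//.
  by congr (_ * _ - _ * _)%E; apply: eq_integral => x _; rewrite ?funeposE ?funenegE.
by apply: fin_num_adde_defr; apply: integrable_fin_num => //; exact: integrable_funepos.
Qed.

End scale_halfline.

Section gaussian.
Context {R : realType}.
Local Notation leb := (@lebesgue_measure R).
Local Notation pos := (`]0, +oo[%classic : set R).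
Implicit Types x y : R.

Definition gauss x : R := expR (- (x ^+ 2 / 2)).

Definition sqrt2pi : R := Num.sqrt (2 * pi).

Lemma gauss_gt0 x : 0 < gauss x. Proof. exact: expR_gt0. Qed.

Lemma gauss_ge0 x : 0 <= gauss x. Proof. exact: expR_ge0. Qed.

Lemma gauss0 : gauss 0 = 1.
Proof. by rewrite /gauss expr0n/= mul0r oppr0 expR0. Qed.

Lemma gaussN x : gauss (- x) = gauss x. Proof. by rewrite /gauss sqrrN. Qed.

Lemma sqrt2pi_gt0 : 0 < sqrt2pi.
Proof. by rewrite sqrtr_gt0 mulr_gt0// pi_gt0. Qed.

Lemma sqr_sqrt2pi : sqrt2pi ^+ 2 = 2 * pi.
Proof. by rewrite sqr_sqrtr// mulr_ge0// pi_ge0. Qed.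

Lemma is_derive_gauss x : is_derive x (1 : R) gauss (- (x * gauss x)).
Proof.
have h := @is_derive_comp _ expR (fun y : R => - (y ^+ 2 / 2)) x _ _
  (is_derive_expR _) (is_deriveN (is_derive_halfsqr x)).
by apply: (is_derive_eq h); rewrite mulrN mulrC.
Qed.

Lemma continuous_gauss : continuous gauss.
Proof. exact: (is_derive_continuous is_derive_gauss). Qed.

Lemma measurable_gauss D : measurable_fun D gauss.
Proof. by apply: measurable_funTS; exact: continuous_measurable_fun continuous_gauss. Qed.

Lemma integrable_expR_sqr (a : R) D : 0 < a -> measurable D ->
  leb.-integrable D (fun x => (expR (- (a * x ^+ 2)))%:E).
Proof.
move=> a0 mD; apply: (@integrableS _ _ _ _ setT) => //.
have mE : measurable_fun setT (fun x : R => expR (- (a * x ^+ 2))).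
  apply: measurableT_comp => //; apply: measurableT_comp => //.
  by apply: measurable_funM => //; exact: measurable_funX.
apply/integrableP; split; first exact/measurable_EFinP.
have := @integralT_gauss R.
rewrite (@ge0_integral_scale _ (Num.sqrt a)) ?sqrtr_gt0//; last 2 first.
  by apply/measurable_EFinP; exact: measurable_gauss_fun.
  by move=> x; rewrite lee_fin expR_ge0.
move=> E; apply: (@lt_pmul_pinfty _ (Num.sqrt a)); first by rewrite sqrtr_gt0.
rewrite (_ : integral _ _ _ = (\int[leb]_x (gauss_fun (Num.sqrt a * x))%:E)%E).
  by rewrite E ltry.
apply: eq_integral => x _ /=; rewrite ger0_norm ?expR_ge0//.
by rewrite /gauss_fun exprMn sqr_sqrtr ?(ltW a0).
Qed.

Lemma integral_gauss_pos : (\int[leb]_(x in pos) (gauss x)%:E)%E = (sqrt2pi / 2)%:E.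
Proof.
have s2 : (0 : R) < Num.sqrt 2 by rewrite sqrtr_gt0.
rewrite (@ge0_integral_scale_pos _ (Num.sqrt 2))//; last 2 first.
  by apply/measurable_EFinP; exact: measurable_gauss.
  by move=> x _; rewrite lee_fin gauss_ge0.
under eq_integral => x _.
  rewrite /gauss exprMn sqr_sqrtr// mulrAC divff// mul1r; over.
rewrite integral_itv_obnd_cbnd; last first.
  by apply/measurable_EFinP; apply: measurable_funTS; exact: measurable_gauss_fun.
rewrite integral0y_gauss -EFinM mulrA -sqrtrM//.
Qed.

Lemma integrable_gauss D : measurable D -> leb.-integrable D (EFin \o gauss).
Proof.
move=> mD; have := @integrable_expR_sqr 2^-1 D ltac:(by rewrite invr_gt0) mD.
by apply: eq_integrable => // x _; rewrite /gauss/= mulrC.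
Qed.

Lemma integrable_abs_gauss D : measurable D ->
  leb.-integrable D (fun x => (`|x| * gauss x)%:E).
Proof.
move=> mD; have /= := @integrable_expR_sqr 4^-1 D ltac:(by rewrite invr_gt0) mD.
apply: le_Rintegrable => //.
  apply: measurable_funM; last exact: measurable_gauss.
  by apply: measurable_funTS; exact: normr_measurable.
move=> x _; rewrite ger0_norm ?mulr_ge0 ?gauss_ge0//.
(* |x| <= 1 + x^2/4 <= exp(x^2/4) *)
have -> : expR (- (4^-1 * x ^+ 2)) = expR (x ^+ 2 / 4) * gauss x.
  by rewrite /gauss -expRD; congr expR; field.
rewrite ler_wpM2r ?gauss_ge0//; apply: le_trans (expR_ge1Dx _).
have := sqr_ge0 (`|x| / 2 - 1); rewrite -(real_normK (num_real x)).
by set u := `|x|; move: u => u; nra.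
Qed.

Lemma cvg_gauss : gauss (n%:R) @[n --> \oo] --> (0 : R).
Proof.
apply/cvgrPdist_le => /= e e0.
near=> n.
rewrite sub0r normrN ger0_norm ?gauss_ge0// /gauss expRN invf_ple ?posrE ?expR_gt0//.
apply: le_trans (expR_ge1Dx _).
have n0 : 2 / e + 1 <= n%:R by near: n; exact: nbhs_infty_ger.
have := @ler0n R n; set N := n%:R in n0 * => N0.
have e1 : 0 < e^-1 by rewrite invr_gt0.
by set E := e^-1 in e1 n0 *; nra.
Unshelve. all: by end_near. Qed.

End gaussian.
Arguments sqrt2pi {R}.

(** * Gaussian Fourier integrals and the function Phi *)

Section gaussian_fourier.
Context {R : realType}.
Local Notation leb := (@lebesgue_measure R).
Local Notation pos := (`]0, +oo[%classic : set R).
Implicit Types x y t w : R.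

Lemma normr_sin_le x : `|sin x| <= `|x|.
Proof.
wlog x0 : x / 0 <= x.
  move=> H; have [/H//|x0] := leP 0 x.
  by rewrite -normrN -sinN -[leRHS]normrN; apply: H; rewrite oppr_ge0 ltW.
have [c _] := @MVT_segment R sin cos 0 x x0 (fun y _ => is_derive_sin y)
  (continuous_subspaceT (@continuous_sin R)).
rewrite sin0 !subr0 => ->; rewrite normrM ler_piMl//; exact: cos_max.
Qed.

Lemma is_derive_cos_mul x y : is_derive x (1 : R) (fun x => cos (x * y)) (- sin (x * y) * y).
Proof. exact: (is_derive_comp (is_derive_cos _) (is_derive_mulidr y x)). Qed.

Lemma is_derive_sin_mul x y : is_derive x (1 : R) (fun x => sin (x * y)) (cos (x * y) * y).
Proof. exact: (is_derive_comp (is_derive_sin _) (is_derive_mulidr y x)). Qed.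

Lemma measurable_cos_mul x D : measurable_fun D (fun y : R => cos (x * y)).
Proof.
apply: measurable_funTS; apply: measurableT_comp; last exact: mulrl_measurable.
exact: continuous_measurable_fun (@continuous_cos R).
Qed.

Lemma measurable_sin_mul x D : measurable_fun D (fun y : R => sin (x * y)).
Proof.
apply: measurable_funTS; apply: measurableT_comp; last exact: mulrl_measurable.
exact: continuous_measurable_fun (@continuous_sin R).
Qed.

Lemma integrable_mul_le1 (D : set R) (f g : R -> R) : measurable D ->
  measurable_fun D f -> (forall y, D y -> `|f y| <= 1) ->
  leb.-integrable D (EFin \o g) ->
  leb.-integrable D (fun y => (g y * f y)%:E).
Proof.
move=> mD mf f1 ig.
have /measurable_int/measurable_EFinP mg := ig.
apply: le_Rintegrable (integrable_norm ig) => //; first exact: measurable_funM.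
by move=> x Dx; rewrite normrM ler_piMr// f1.
Qed.

Lemma integrable_gauss_cos x D : measurable D ->
  leb.-integrable D (fun y => (gauss y * cos (x * y))%:E).
Proof.
move=> mD; apply: integrable_mul_le1 => //; first exact: measurable_cos_mul.
  by move=> y _; exact: cos_max.
exact: integrable_gauss.
Qed.

Lemma integrable_gauss_sin x D : measurable D ->
  leb.-integrable D (fun y => (gauss y * sin (x * y))%:E).
Proof.
move=> mD; apply: integrable_mul_le1 => //; first exact: measurable_sin_mul.
  by move=> y _; exact: sin_max.
exact: integrable_gauss.
Qed.

Let integrable_mul_gauss_pos (f : R -> R) :
  measurable_fun pos f -> (forall y, `|f y| <= 1) ->
  leb.-integrable pos (fun y => (y * gauss y * f y)%:E).
Proof.
move=> mf f1; apply: integrable_mul_le1 => //.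
apply: le_Rintegrable (integrable_abs_gauss _) => //.
  by apply: measurable_funM => //; exact: measurable_gauss.
by move=> y _; rewrite normrM (ger0_norm (gauss_ge0 y)).
Qed.

Definition gauss_cos x := \int[leb]_(y in pos) (gauss y * cos (x * y)).

Definition gauss_sin x := \int[leb]_(y in pos) (gauss y * sin (x * y)).

Lemma is_derive_gauss_cos x : is_derive x (1 : R) gauss_cos
  (\int[leb]_(y in pos) (- (y * gauss y * sin (x * y)))).
Proof.
apply: (@is_derive_under_integral _ _ _ leb pos (fun x y => gauss y * cos (x * y))
  (fun x y => - (y * gauss y * sin (x * y))) (fun y => `|y| * gauss y)) => //.
- by move=> z; exact: integrable_gauss_cos.
- move=> z y _; apply: (is_derive_eq (is_derive_scale _ (is_derive_cos_mul z y))).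
  ring.
- by move=> y; rewrite mulr_ge0// gauss_ge0.
- exact: integrable_abs_gauss.
- move=> z y _; rewrite normrN !normrM (ger0_norm (gauss_ge0 y)).
  by rewrite ler_piMr ?sin_max// mulr_ge0// gauss_ge0.
Qed.

Lemma is_derive_gauss_sin x : is_derive x (1 : R) gauss_sin
  (\int[leb]_(y in pos) (y * gauss y * cos (x * y))).
Proof.
apply: (@is_derive_under_integral _ _ _ leb pos (fun x y => gauss y * sin (x * y))
  (fun x y => y * gauss y * cos (x * y)) (fun y => `|y| * gauss y)) => //.
- by move=> z; exact: integrable_gauss_sin.
- move=> z y _; apply: (is_derive_eq (is_derive_scale _ (is_derive_sin_mul z y))).
  ring.
- by move=> y; rewrite mulr_ge0// gauss_ge0.
- exact: integrable_abs_gauss.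
- move=> z y _; rewrite !normrM (ger0_norm (gauss_ge0 y)).
  by rewrite ler_piMr ?cos_max// mulr_ge0// gauss_ge0.
Qed.

Let is_derive_cos_mulr x y : is_derive y (1 : R) (fun y => cos (x * y)) (- sin (x * y) * x).
Proof. exact: (is_derive_comp (is_derive_cos _) (is_derive_mulid x y)). Qed.

Let is_derive_sin_mulr x y : is_derive y (1 : R) (fun y => sin (x * y)) (cos (x * y) * x).
Proof. exact: (is_derive_comp (is_derive_sin _) (is_derive_mulid x y)). Qed.

Let continuous_cos_mulr x : continuous (fun y => cos (x * y)).
Proof. exact: is_derive_continuous (is_derive_cos_mulr x). Qed.

Let continuous_sin_mulr x : continuous (fun y => sin (x * y)).
Proof. exact: is_derive_continuous (is_derive_sin_mulr x). Qed.

Let cvg_gauss_mul (f : R -> R) : (forall y, `|f y| <= 1) ->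
  (gauss n%:R * f n%:R) @[n --> \oo] --> (0 : R).
Proof.
move=> f1; apply/norm_cvg0P.
apply: (@squeeze_cvgr _ _ _ _ (fun=> 0) (fun n => gauss (n%:R : R))).
- apply: nearW => n; rewrite normr_ge0/= normrM (ger0_norm (gauss_ge0 _)).
  by rewrite ler_piMr// gauss_ge0.
- exact: cvg_cst.
- exact: cvg_gauss.
Qed.

(** Integration by parts: the derivative in y of - gauss y * cos (x * y)
    has integral 1. *)
Lemma gauss_cos_by_parts x :
  \int[leb]_(y in pos) (y * gauss y * cos (x * y)) = 1 - x * gauss_sin x.
Proof.
pose F y := - (gauss y * cos (x * y)).
pose f y := y * gauss y * cos (x * y) + x * (gauss y * sin (x * y)).
have dF y : is_derive y (1 : R) F (f y).
  have := is_deriveN (is_derive_mul (is_derive_gauss y) (is_derive_cos_mulr x y)).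
  by move=> /is_derive_eq; apply; rewrite /f; ring.
have cf : continuous f.
  move=> y; apply: cvgD; apply: cvgM; try exact: continuous_cos_mulr.
  - by apply: cvgM => //; exact: continuous_gauss.
  - exact: cvg_cst.
  - by apply: cvgM; [exact: continuous_gauss|exact: continuous_sin_mulr].
have i1 : leb.-integrable pos (fun y => (y * gauss y * cos (x * y))%:E).
  by apply: integrable_mul_gauss_pos => [|y]; [exact: measurable_cos_mul|exact: cos_max].
have i2 : leb.-integrable pos (fun y => (x * (gauss y * sin (x * y)))%:E).
  by apply: integrable_mull => //; exact: integrable_gauss_sin.
have intf : leb.-integrable pos (EFin \o f).
  by apply: integrable_addr.
have Fl : F n%:R @[n --> \oo] --> (0 : R).
  rewrite -oppr0; apply: cvgN; apply: (cvg_gauss_mul (f := fun y => cos (x * y))).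
  by move=> y; exact: cos_max.
have := Rintegral_is_derivey dF cf intf Fl.
rewrite /f RintegralD// RintegralZl//; last exact: integrable_gauss_sin.
rewrite /F mulr0 gauss0 cos0 mulr1 opprK add0r -/(gauss_sin x) => <-.
by rewrite addrK.
Qed.

Lemma gauss_sin_by_parts x :
  \int[leb]_(y in pos) (y * gauss y * sin (x * y)) = x * gauss_cos x.
Proof.
pose F y := - (gauss y * sin (x * y)).
pose f y := y * gauss y * sin (x * y) - x * (gauss y * cos (x * y)).
have dF y : is_derive y (1 : R) F (f y).
  have := is_deriveN (is_derive_mul (is_derive_gauss y) (is_derive_sin_mulr x y)).
  by move=> /is_derive_eq; apply; rewrite /f; ring.
have cf : continuous f.
  move=> y; apply: cvgB; apply: cvgM; try exact: continuous_sin_mulr.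
  - by apply: cvgM => //; exact: continuous_gauss.
  - exact: cvg_cst.
  - by apply: cvgM; [exact: continuous_gauss|exact: continuous_cos_mulr].
have i1 : leb.-integrable pos (fun y => (y * gauss y * sin (x * y))%:E).
  by apply: integrable_mul_gauss_pos => [|y]; [exact: measurable_sin_mul|exact: sin_max].
have i2 : leb.-integrable pos (fun y => (x * (gauss y * cos (x * y)))%:E).
  by apply: integrable_mull => //; exact: integrable_gauss_cos.
have intf : leb.-integrable pos (EFin \o f).
  by apply: integrable_subr.
have Fl : F n%:R @[n --> \oo] --> (0 : R).
  rewrite -oppr0; apply: cvgN; apply: (cvg_gauss_mul (f := fun y => sin (x * y))).
  by move=> y; exact: sin_max.
have := Rintegral_is_derivey dF cf intf Fl.
rewrite /f RintegralB// RintegralZl//; last exact: integrable_gauss_cos.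
rewrite /F mulr0 gauss0 sin0 mulr0 opprK addr0 -/(gauss_cos x) => /eqP.
by rewrite subr_eq0 => /eqP.
Qed.

Let is_derive_invgauss x : is_derive x (1 : R) (fun x => expR (x ^+ 2 / 2))
  (expR (x ^+ 2 / 2) * x).
Proof. exact: (is_derive_comp (is_derive_expR _) (is_derive_halfsqr x)). Qed.

Let invgaussK x : expR (x ^+ 2 / 2) * gauss x = 1.
Proof. by rewrite /gauss -expRD subrr expR0. Qed.

(** By differentiation under the integral and integration by parts the
    function C = [gauss_cos] satisfies C' = - x C, so exp(x^2/2) C(x) is
    constant. *)
Lemma gauss_cosE x : gauss_cos x = sqrt2pi / 2 * gauss x.
Proof.
have H (z : R) : is_derive z (1 : R) (fun x => expR (x ^+ 2 / 2) * gauss_cos x) 0.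
  have := is_derive_mul (is_derive_invgauss z) (is_derive_gauss_cos z).
  move=> /is_derive_eq; apply.
  under eq_Rintegral do rewrite -mulN1r.
  rewrite RintegralZl ?gauss_sin_by_parts//; first by ring.
  by apply: integrable_mul_gauss_pos => [|y]; [exact: measurable_sin_mul|exact: sin_max].
have := is_derive_0_is_cst x 0 H.
rewrite /= expr0n/= mul0r expR0 mul1r.
have -> : gauss_cos 0 = sqrt2pi / 2.
  rewrite /gauss_cos; under eq_Rintegral do rewrite mul0r cos0 mulr1.
  by rewrite /Rintegral integral_gauss_pos.
move=> <-; rewrite mulrAC invgaussK mul1r//.
Qed.

(** Up to scaling, this is the Dawson function, exp(-x^2/2) times the
    integral of exp(t^2/2) from 0 to x. The substitution t = s x gives the
    integral the form of a segment integral, as in [Phi], and makes it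
    meaningful for either sign of x. *)
Definition dawson x := gauss x * \int[leb]_(s in `[0, 1]) (x * expR ((s * x) ^+ 2 / 2)).

(** Here S = [gauss_sin] satisfies S' = 1 - x S, so that exp(x^2/2) S(x) is
    the primitive of exp(x^2/2) that vanishes at 0. *)
Lemma gauss_sinE x : gauss_sin x = dawson x.
Proof.
pose phi x := expR (x ^+ 2 / 2) * gauss_sin x.
have dphi z : is_derive z (1 : R) phi (expR (z ^+ 2 / 2)).
  have := is_derive_mul (is_derive_invgauss z) (is_derive_gauss_sin z).
  by move=> /is_derive_eq; apply; rewrite gauss_cos_by_parts; ring.
have dphis s : is_derive s (1 : R) (fun s => phi (s * x)) (x * expR ((s * x) ^+ 2 / 2)).
  have := @is_derive_comp _ phi (fun s : R => s * x) s _ _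
    (dphi (s * x)) (is_derive_mulidr x s).
  by move=> /is_derive_eq; apply; rewrite mulrC.
have cont : continuous (fun s : R => x * expR ((s * x) ^+ 2 / 2)).
  have ce : continuous (fun s : R => expR ((s * x) ^+ 2 / 2)).
    apply: (is_derive_continuous (df := fun s => expR ((s * x) ^+ 2 / 2) * (s * x) * x)).
    move=> z; exact: (@is_derive_comp _ (fun y : R => expR (y ^+ 2 / 2))
      (fun s : R => s * x) z _ _ (is_derive_invgauss (z * x)) (is_derive_mulidr x z)).
  by move=> s; apply: cvgM; [exact: cvg_cst|exact: ce].
have [_] := Rintegral_is_derive dphis cont (@ltr01 R).
rewrite mul1r mul0r /dawson => ->.
rewrite /phi [gauss_sin 0](_ : _ = 0).
  by rewrite mulr0 subr0 mulrA [gauss x * _]mulrC invgaussK mul1r.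
rewrite /gauss_sin; under eq_Rintegral do rewrite mul0r sin0 mulr0.
by rewrite Rintegral_cst// mul0r.
Qed.

(** The Fourier sine representation of the error function: for w = 1 the
    derivative of the left-hand side in t is [gauss_cos t], a multiple of
    gauss t; the scale w is absorbed by the substitution u -> w u. *)
Lemma gauss_sinc w t : 0 < w -> 0 < t ->
  leb.-integrable pos (fun u => (gauss (w * u) * (sin (t * u) / u))%:E) /\
  \int[leb]_(u in pos) (gauss (w * u) * (sin (t * u) / u)) =
    sqrt2pi / 2 * \int[leb]_(x in `[0, t / w]) gauss x.
Proof.
move=> w0 t0.
have msinc s : measurable_fun pos (fun u : R => sin (s * u) / u).
  apply: measurable_funM; first exact: measurable_sin_mul.
  apply: open_continuous_measurable_fun => //.
  move=> u; rewrite inE/= in_itv/= andbT => u0.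
  by apply: inv_continuous; rewrite gt_eqF.
have sinc_le s u : pos u -> `|sin (s * u) / u| <= `|s|.
  rewrite /= in_itv/= andbT => u0.
  rewrite normrM normfV ler_pdivrMr ?normr_gt0 ?gt_eqF// -normrM.
  exact: normr_sin_le.
have int1 s : leb.-integrable pos (fun u => (gauss u * (sin (s * u) / u))%:E).
  apply: (@le_Rintegrable _ _ _ leb pos _ (fun u => `|s| * gauss u)) => //;
    last by apply: integrable_mull => //; exact: integrable_gauss.
    by apply: measurable_funM; [exact: measurable_gauss|exact: msinc].
  move=> u pu; rewrite /= normrM (ger0_norm (gauss_ge0 _)) mulrC.
  by rewrite ler_wpM2r ?gauss_ge0// sinc_le.
pose N s := \int[leb]_(u in pos) (gauss u * (sin (s * u) / u)).
have dN s : is_derive s (1 : R) N (sqrt2pi / 2 * gauss s).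
  rewrite -gauss_cosE.
  apply: (@is_derive_under_integral _ _ _ leb pos
    (fun s u => gauss u * (sin (s * u) / u))
    (fun s u => gauss u * cos (s * u)) gauss) => //.
  - move=> z u /=; rewrite in_itv/= andbT => u0.
    have := is_derive_scale (gauss u / u) (is_derive_sin_mul z u).
    rewrite (_ : (fun x => gauss u * (sin (x * u) / u)) =
                 (fun x => gauss u / u * sin (x * u))); last first.
      by apply/funext => q; rewrite mulrA mulrAC.
    by move/is_derive_eq; apply; field; rewrite gt_eqF.
  - by move=> u; exact: gauss_ge0.
  - exact: integrable_gauss.
  - move=> z u _; rewrite normrM (ger0_norm (gauss_ge0 u)).
    by rewrite ler_piMr ?gauss_ge0// cos_max.
have NE s : 0 < s -> N s = sqrt2pi / 2 * \int[leb]_(x in `[0, s]) gauss x.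
  move=> s0.
  have [|_] := Rintegral_is_derive dN _ s0.
    by move=> z; apply: cvgM; [exact: cvg_cst|exact: continuous_gauss].
  rewrite RintegralZl//; last exact: integrable_gauss.
  move=> ->; rewrite [N 0](_ : _ = 0) ?subr0// /N.
  under eq_Rintegral do rewrite mul0r sin0 mul0r mulr0.
  by rewrite Rintegral_cst// mul0r.
rewrite -NE ?divr_gt0//.
have scaleE u : u \in pos -> gauss (w * u) * (sin (t / w * (w * u)) / (w * u)) =
    w^-1 * (gauss (w * u) * (sin (t * u) / u)).
  rewrite inE/= in_itv/= andbT => u0.
  have -> : t / w * (w * u) = t * u by field; rewrite gt_eqF.
  by field; rewrite !gt_eqF.
have iw : leb.-integrable pos (fun u => (gauss (w * u) * (sin (t * u) / u))%:E).
  apply: (@le_Rintegrable _ _ _ leb pos _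
    (fun u => t * expR (- (w ^+ 2 / 2 * u ^+ 2)))) => //.
  - apply: measurable_funM; last exact: msinc.
    apply: measurable_funTS; apply: measurableT_comp; first exact: measurable_gauss.
    exact: mulrl_measurable.
  - move=> u pu; rewrite normrM (ger0_norm (gauss_ge0 _)) mulrC.
    rewrite [X in _ <= _ * X](_ : _ = gauss (w * u)); last first.
      by rewrite /gauss exprMn mulrAC.
    rewrite ler_wpM2r ?gauss_ge0//.
    by rewrite (le_trans (sinc_le _ _ pu))// gtr0_norm.
  - apply: integrable_mull => //; apply: integrable_expR_sqr => //.
    by rewrite divr_gt0// exprn_gt0.
split=> //; rewrite /N [RHS](Rintegral_scale_pos w0); last exact: int1.
under [in RHS]eq_Rintegral => u pu do rewrite (scaleE u pu).
by rewrite RintegralZl// mulrA divff ?gt_eqF// mul1r.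
Qed.

Lemma integrable_gauss_sinc w t : 0 < w -> 0 <= t ->
  leb.-integrable pos (fun u => (gauss (w * u) * (sin (t * u) / u))%:E).
Proof.
move=> w0; rewrite le_eqVlt => /predU1P[<-|t0]; last exact: (gauss_sinc w0 t0).1.
rewrite (_ : (fun u => _) = fun=> 0%E); first exact: integrable0.
by apply/funext => u; rewrite mul0r sin0 mul0r mulr0.
Qed.

Definition gauss_tail h : R := \int[leb]_(x in `[h, +oo[) gauss x.

Lemma gauss_tailE h : 0 <= h ->
  gauss_tail h = sqrt2pi / 2 - \int[leb]_(x in `[0, h]) gauss x.
Proof.
move=> h0.
have i0 : leb.-integrable (`[0, +oo[ : set R) (EFin \o gauss) by exact: integrable_gauss.
have -> : sqrt2pi / 2 = \int[leb]_(x in `[0, +oo[) gauss x.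
  rewrite -Rintegral_itv_obnd_cbnd; last exact: integrable_gauss.
  by rewrite /Rintegral integral_gauss_pos.
rewrite (@Rintegral_itvB _ _ _ _ h)//.
rewrite Rintegral_itv_obnd_cbnd//; exact: integrable_gauss.
Qed.

(** The tail now depends on t only through sin(t u), the imaginary part of
    exp(i t u), which is multiplicative when t is a sum. *)
Lemma gauss_tail_fourier w t : 0 < w -> 0 <= t ->
  gauss_tail (t / w) = sqrt2pi / 2 - 2 / sqrt2pi *
    \int[leb]_(u in pos) (gauss (w * u) * (sin (t * u) / u)).
Proof.
move=> w0; rewrite le_eqVlt => /predU1P[<-|t0].
  rewrite mul0r gauss_tailE// set_itv1 Rintegral_set1.
  under eq_Rintegral do rewrite mul0r sin0 mul0r mulr0.
  by rewrite Rintegral_cst// mul0r mulr0.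
rewrite (gauss_sinc w0 t0).2 gauss_tailE; last by rewrite divr_ge0// ltW.
by rewrite mulrA; congr (_ - _); field; rewrite gt_eqF// sqrt2pi_gt0.
Qed.

Lemma dawsonN x : dawson (- x) = - dawson x.
Proof.
rewrite -!gauss_sinE /gauss_sin.
under eq_Rintegral do rewrite mulNr sinN mulrN -mulN1r.
by rewrite RintegralZl ?mulN1r//; exact: integrable_gauss_sin.
Qed.

Lemma dawson_ge0 x : 0 <= x -> 0 <= dawson x.
Proof.
move=> x0; rewrite /dawson mulr_ge0 ?gauss_ge0// Rintegral_ge0// => s _.
by rewrite mulr_ge0// expR_ge0.
Qed.

Let continuous_expR_sqr x : continuous (fun s : R => expR ((s * x) ^+ 2 / 2)).
Proof.
apply: (is_derive_continuous (df := fun s => expR ((s * x) ^+ 2 / 2) * (s * x) * x)).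
move=> z; exact: (@is_derive_comp _ (fun y : R => expR (y ^+ 2 / 2))
  (fun s : R => s * x) z _ _ (is_derive_invgauss (z * x)) (is_derive_mulidr x z)).
Qed.

Let integrable_expR_sqr_itv x :
  leb.-integrable `[0, 1] (fun s => (x * expR ((s * x) ^+ 2 / 2))%:E).
Proof.
apply: integrable_mull => //; apply: continuous_compact_integrable.
  exact: segment_compact.
by apply: continuous_subspaceT; exact: continuous_expR_sqr.
Qed.

(** Bounding the quadratic exponent (s x)^2 by its chord s x^2 leaves an
    exponential with an elementary primitive. *)
Lemma dawson_le_inv x : 0 < x -> dawson x <= 2 / x.
Proof.
move=> x0.
pose F s : R := 2 / x * expR (s * (x ^+ 2 / 2)).
have dF s : is_derive s (1 : R) F (x * expR (s * (x ^+ 2 / 2))).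
  have := is_derive_scale (2 / x) (@is_derive_comp _ expR (fun s : R => s * (x ^+ 2 / 2)) s _ _
    (is_derive_expR _) (is_derive_mulidr _ s)).
  by move=> /is_derive_eq; apply; field; rewrite gt_eqF.
have ce : continuous (fun s : R => x * expR (s * (x ^+ 2 / 2))).
  move=> s; apply: cvgM; first exact: cvg_cst.
  apply: continuous_comp; last exact: continuous_expR.
  exact: (is_derive_continuous (is_derive_mulidr (x ^+ 2 / 2))).
have [i2 E] := Rintegral_is_derive dF ce (@ltr01 R).
have : \int[leb]_(s in `[0, 1]) (x * expR ((s * x) ^+ 2 / 2)) <= F 1 - F 0.
  rewrite -E; apply: le_Rintegral => //; first exact: integrable_expR_sqr_itv.
  move=> s /=; rewrite in_itv/= => /andP[s0 s1].
  rewrite ler_wpM2l ?(ltW x0)// ler_expR exprMn -mulrA ler_wpM2r//.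
    by rewrite divr_ge0// sqr_ge0.
  by rewrite expr2 ler_piMr.
rewrite /F mul0r mul1r expR0 mulr1 /dawson => H.
apply: (le_trans (ler_wpM2l (gauss_ge0 x) H)).
rewrite mulrBr mulrCA [gauss x * expR _]mulrC invgaussK mulr1 gerBl.
by rewrite mulr_ge0 ?gauss_ge0// divr_ge0// ltW.
Qed.

Lemma dawson_le x : 0 <= x -> dawson x <= x.
Proof.
move=> x0; rewrite /dawson.
have : \int[leb]_(s in `[0, 1]) (x * expR ((s * x) ^+ 2 / 2)) <=
       \int[leb]_(s in `[0, 1]) (x * expR (x ^+ 2 / 2)).
  apply: le_Rintegral => //; first exact: integrable_expR_sqr_itv.
    apply: continuous_compact_integrable; first exact: segment_compact.
    by apply: continuous_subspaceT => z; exact: cvg_cst.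
  move=> s /=; rewrite in_itv/= => /andP[s0 s1].
  rewrite ler_wpM2l// ler_expR exprMn -mulrA ler_piMl//.
    by rewrite divr_ge0// sqr_ge0.
  by rewrite expr_le1.
rewrite Rintegral_cst//.
have -> : fine (leb (`[0, 1]%classic : set R)) = 1.
  by rewrite lebesgue_measure_itv/= lte_fin ltr01 -EFinB subr0.
rewrite mulr1 => H; apply: (le_trans (ler_wpM2l (gauss_ge0 x) H)).
by rewrite mulrCA [gauss x * expR _]mulrC invgaussK mulr1.
Qed.

Lemma measurable_dawson D : measurable_fun D dawson.
Proof.
apply: measurable_funTS; rewrite (_ : dawson = gauss_sin); last first.
  by apply/funext => x; rewrite gauss_sinE.
exact: continuous_measurable_fun (is_derive_continuous is_derive_gauss_sin).
Qed.

(** The value of exp(-y^2/2) Phi(i y): along the imaginary axis the segment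
    integral in [Phi] is purely imaginary and equals i exp(y^2/2) times
    [dawson y]. *)
Definition gauss_Phi y : R[i] := (gauss y / 2) +i* (dawson y / sqrt2pi).

Lemma gauss_PhiE y : (expR (- (y ^+ 2 / 2)))%:C * Phi ('i%C * y%:C) = gauss_Phi y.
Proof.
have E s : Cexp (- ((s%:C * ('i%C * y%:C)) ^+ 2 / 2)) = (expR ((s * y) ^+ 2 / 2))%:C.
  have -> : - ((s%:C * ('i%C * y%:C)) ^+ 2 / 2) = ((s * y) ^+ 2 / 2)%:C :> R[i].
    rewrite !exprMn sqr_i mulN1r mulrN mulNr opprK.
    by rewrite [RHS]rmorphM [X in _ = X * _]rmorphM !rmorphXn fmorphV rmorph_nat.
  by rewrite /Cexp/= sin0 cos0; apply/eqP; rewrite eq_complex/= !mulr0 !mul0r mulr1 subr0 addr0 !eqxx.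
have P : Cprimitive (fun z => Cexp (- (z ^+ 2 / 2))) ('i%C * y%:C) =
    0 +i* (\int[leb]_(s in `[0, 1]) (y * expR ((s * y) ^+ 2 / 2))).
  rewrite /Cprimitive /Cintegral; congr (_ +i* _).
    under eq_Rintegral do rewrite E/= !mul0r !mul1r !subr0 mulr0.
    by rewrite Rintegral_cst// mul0r.
  by under eq_Rintegral do rewrite E/= !mul0r !mul1r add0r addr0 mulrC.
rewrite /Phi P /gauss_Phi /dawson -/(gauss y).
have -> : 1 / 2 = (1 / 2)%:C :> R[i] by rewrite rmorphM fmorphV rmorph1 rmorph_nat.
apply/eqP; rewrite eq_complex/= !mul0r !mulr0 !subr0 !add0r !addr0 -/sqrt2pi.
by apply/andP; split; apply/eqP; ring.
Qed.

Lemma gauss_PhiN y : gauss_Phi (- y) = (gauss_Phi y)^*%C.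
Proof. by rewrite /gauss_Phi dawsonN gaussN mulNr. Qed.

End gaussian_fourier.

Section line_integral.
Context {R : realType}.
Local Notation leb := (@lebesgue_measure R).
Local Notation mR := (measurableTypeR R).
Local Notation pos := (`]0, +oo[%classic : set R).

Lemma Rintegral_line_split (f : R -> R) : leb.-integrable setT (EFin \o f) ->
  leb.-integrable setT (fun x => (f (- x))%:E) ->
  \int[leb]_x f x = \int[leb]_(x in pos) f x + \int[leb]_(x in pos) f (- x).
Proof.
move=> intf intfN.
have -> : [set: R] = `]-oo, 0] `|` `]0, +oo[.
  by apply/seteqP; split=> x // _; rewrite /= !in_itv/= andbT; case: (leP x 0); [left|right].
have sub D : measurable (D : set R) -> leb.-integrable D (EFin \o f) /\
    leb.-integrable D (fun x => (f (- x))%:E).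
  by move=> mD; split; [exact: (integrableS _ _ _ intf)|exact: (integrableS _ _ _ intfN)].
rewrite Rintegral_setU//; last 2 first.
  by apply: (sub _ _).1; apply: measurableU.
  rewrite disj_set2E; apply/eqP/seteqP; split => // x /=.
  by rewrite !in_itv/= andbT leNgt => -[/negP].
rewrite addrC; congr (_ + _).
rewrite [RHS]Rintegral_itv_obnd_cbnd; last by apply: (sub _ _).2.
rewrite (_ : `[0, +oo[%classic = (-%R : mR -> mR) @^-1` `]-oo, 0%R]); last first.
  by apply/seteqP; split=> x /=; rewrite !in_itv/= andbT oppr_le0.
have /measurable_int mf := intf.
have mN : measurable_fun [set: mR] (-%R : mR -> mR) by exact: oppr_measurable.
congr fine; rewrite -[RHS](@integral_pushforward _ _ _ _ _ _ mN leb _ (EFin \o f))//.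
  by apply: eq_measure_integral => A mA _; exact/esym/lebesgue_measureN.
apply: (sub _ _).2; rewrite (_ : _ @^-1` _ = `[0, +oo[%classic)//.
by apply/seteqP; split=> x /=; rewrite !in_itv/= andbT oppr_le0.
Qed.

(** The support function of the segment [-tm, tp]; the gauge of the
    crosspolytope is the sum of such functions of the coordinates. *)
Definition gauge (tp tm x : R) : R := Num.max (tp * x) (- (tm * x)).

Lemma gauge_pos tp tm x : 0 < tp -> 0 < tm -> 0 <= x -> gauge tp tm x = tp * x.
Proof.
move=> tp0 tm0 x0; apply/max_idPl; rewrite (@le_trans _ _ 0)//.
  by rewrite oppr_le0 mulr_ge0// ltW.
by rewrite mulr_ge0// ltW.
Qed.

Lemma gauge_neg tp tm x : 0 < tp -> 0 < tm -> 0 <= x -> gauge tp tm (- x) = tm * x.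
Proof.
move=> tp0 tm0 x0; rewrite /gauge mulrN mulrN opprK; apply/max_idPr.
by rewrite (@le_trans _ _ 0)// ?oppr_le0 mulr_ge0// ltW.
Qed.

Lemma gauge_ge0 tp tm x : 0 < tp -> 0 < tm -> 0 <= gauge tp tm x.
Proof.
move=> tp0 tm0; have [x0|x0] := leP 0 x.
  by rewrite gauge_pos// mulr_ge0// ltW.
by rewrite -[x]opprK gauge_neg ?oppr_ge0 ?(ltW x0)// mulr_ge0 ?oppr_ge0// ltW.
Qed.

Lemma measurable_gauge tp tm : measurable_fun setT (gauge tp tm).
Proof.
apply: measurable_maxr; first exact: mulrl_measurable.
by apply: measurableT_comp => //; exact: mulrl_measurable.
Qed.

(** The gauge is linear on each half-line, so each half contributes a
    Gaussian Fourier integral, at frequency tp y or tm y. *)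
Lemma gauss_gauge_fourier tp tm y : 0 < tp -> 0 < tm ->
  [/\ leb.-integrable setT (fun x => (gauss x * cos (y * gauge tp tm x))%:E),
      leb.-integrable setT (fun x => (gauss x * sin (y * gauge tp tm x))%:E) &
      (\int[leb]_x (gauss x * cos (y * gauge tp tm x))) +i*
      (\int[leb]_x (gauss x * sin (y * gauge tp tm x))) =
      sqrt2pi%:C * (gauss_Phi (tp * y) + gauss_Phi (tm * y))].
Proof.
move=> tp0 tm0.
have mk (phi : R -> R) : continuous phi -> (forall x, `|phi x| <= 1) ->
    leb.-integrable setT (fun x => (gauss x * phi (y * gauge tp tm x))%:E) /\
    \int[leb]_x (gauss x * phi (y * gauge tp tm x)) =
    \int[leb]_(x in pos) (gauss x * phi (tp * y * x)) +
    \int[leb]_(x in pos) (gauss x * phi (tm * y * x)).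
  move=> cphi phi1.
  have mphi (g : R -> R) : measurable_fun setT g ->
      measurable_fun setT (fun x => phi (y * g x)).
    move=> mg; apply: measurableT_comp; first exact: continuous_measurable_fun.
    by apply: measurable_funM.
  have i1 : leb.-integrable setT (fun x => (gauss x * phi (y * gauge tp tm x))%:E).
    apply: integrable_mul_le1 => //; last exact: integrable_gauss.
    by apply: mphi; exact: measurable_gauge.
  split=> //; rewrite Rintegral_line_split//; last first.
    under eq_fun do rewrite gaussN.
    apply: integrable_mul_le1 => //; last exact: integrable_gauss.
    apply: (mphi (fun x => gauge tp tm (- x))).
    by apply: measurableT_comp; [exact: measurable_gauge|exact: oppr_measurable].
  congr (_ + _); apply: eq_Rintegral => x; rewrite inE/= in_itv/= andbT => /ltW x0.
    by rewrite gauge_pos// mulrA [y * _]mulrC.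
  by rewrite gaussN gauge_neg// mulrA [y * _]mulrC.
have [c1 c2] := mk cos (@continuous_cos R) (@cos_max R).
have [s1 s2] := mk sin (@continuous_sin R) (@sin_max R).
split => //.
rewrite c2 s2 -!/(gauss_cos _) -!/(gauss_sin _) !gauss_cosE !gauss_sinE /gauss_Phi.
have nz : (0 : R) < sqrt2pi := sqrt2pi_gt0.
apply/eqP; rewrite eq_complex/= !mul0r subr0 addr0; apply/andP; split; apply/eqP.
  by ring.
by field; rewrite gt_eqF.
Qed.

End line_integral.

(** * The gauge of the crosspolytope *)

Section crosspolytope_gauge.
Context {R : realType}.

Lemma convex_set_comb (M : lmodType R) (B : set M) (x y : M) (a : R) :
  @convex_set R M B -> 0 <= a -> a <= 1 -> B x -> B y -> B (a *: x + (1 - a) *: y).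
Proof.
move=> cB a0 a1 Bx By.
by have := cB x y (Itv01 a0 a1); rewrite !inE; apply.
Qed.

(** The point 0 of B takes up the weight missing to 1. *)
Lemma convex_set_sum (M : lmodType R) (B : set M) n (l : 'I_n -> R) (v : 'I_n -> M) :
  @convex_set R M B -> B 0 -> (forall j, 0 <= l j) -> (forall j, B (v j)) ->
  \sum_j l j <= 1 -> B (\sum_j l j *: v j).
Proof.
move=> cB B0; elim: n l v => [|n IH] l v l0 Bv; first by rewrite !big_ord0.
rewrite !big_ord_recl => l1.
set S := \sum_(i < n) l (lift ord0 i) in l1.
have S0 : 0 <= S by rewrite sumr_ge0.
have a0 := l0 ord0.
have [a1|a1] := eqVneq (l ord0) 1.
  have /eqP : S = 0 by lra.
  rewrite psumr_eq0// => /allP S00.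
  rewrite big1 ?addr0 ?a1 ?scale1r// => i _.
  by have := S00 i; rewrite mem_index_enum => /(_ isT)/implyP/(_ isT)/eqP ->; rewrite scale0r.
have r0 : 0 < 1 - l ord0 by rewrite subr_gt0 lt_neqAle a1/=; lra.
have -> : \sum_(i < n) l (lift ord0 i) *: v (lift ord0 i) =
   (1 - l ord0) *: \sum_(i < n) (l (lift ord0 i) / (1 - l ord0)) *: v (lift ord0 i).
  rewrite scaler_sumr; apply: eq_bigr => i _.
  by rewrite scalerA mulrC divfK// gt_eqF.
apply: convex_set_comb => //; first by lra.
apply: IH => [j|j|]; [by rewrite divr_ge0// ltW|exact: Bv|].
by rewrite -mulr_suml -/S ler_pdivrMr//; lra.
Qed.

Lemma gauge_convex (tp tm a x y : R) : 0 <= a -> a <= 1 ->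
  gauge tp tm (a * x + (1 - a) * y) <= a * gauge tp tm x + (1 - a) * gauge tp tm y.
Proof.
move=> a0 a1; have b0 : 0 <= 1 - a by lra.
have [g1 g2] : tp * x <= gauge tp tm x /\ - (tm * x) <= gauge tp tm x.
  by rewrite /gauge !le_max !lexx orbT.
have [g3 g4] : tp * y <= gauge tp tm y /\ - (tm * y) <= gauge tp tm y.
  by rewrite /gauge !le_max !lexx orbT.
rewrite [leLHS]/gauge ge_max; apply/andP; split; nra.
Qed.

Variables (d : nat) (tp tm : 'I_d -> R).
Hypotheses (d0 : (0 < d)%N) (tp0 : forall j, 0 < tp j) (tm0 : forall j, 0 < tm j).

Definition gauge_sum (x : 'I_d -> R) : R := \sum_j gauge (tp j) (tm j) (x j).

Lemma gauge_sum_ge0 x : 0 <= gauge_sum x.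
Proof. by apply: sumr_ge0 => j _; exact: gauge_ge0. Qed.

Lemma gauge0 a b : gauge a b (0 : R) = 0.
Proof. by rewrite /gauge !mulr0 oppr0 maxxx. Qed.

Lemma gauge_sum_delta (j : 'I_d) (a : R) :
  gauge_sum (fun i => (a *: delta_mx 0 j : 'rV_d) 0 i) = gauge (tp j) (tm j) a.
Proof.
rewrite /gauge_sum (bigD1 j)//= !mxE !eqxx mulr1 big1 ?addr0// => i ij.
by rewrite !mxE eqxx (negbTE ij)/= mulr0 gauge0.
Qed.

(** The set on the right is convex and contains the vertices. Conversely, x is
    the combination of the vertices lying on the same sides as its
    coordinates, with the values of the gauges as weights. *)
Lemma crosspolytopeE : crosspolytope tp tm =
  [set x : 'rV[R]_d | gauge_sum (x 0) <= 1].
Proof.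
apply/seteqP; split => [|x /= gx].
  apply: smallest_sub.
    move=> x y l; rewrite !inE/= => gx gy.
    have l0 : 0 <= l%:num by [].
    have l1 : l%:num <= 1 by [].
    apply: (@le_trans _ _ (l%:num * gauge_sum (x 0) + (1 - l%:num) * gauge_sum (y 0))).
      rewrite /gauge_sum !mulr_sumr -big_split/=; apply: ler_sum => j _.
      by rewrite !mxE; exact: gauge_convex.
    by nra.
  move=> _ /= [|] [j _ <-] /=.
    by rewrite gauge_sum_delta gauge_pos ?invr_ge0 ?(ltW (tp0 j))// divff// gt_eqF.
  by rewrite -scaleNr gauge_sum_delta gauge_neg ?invr_ge0 ?(ltW (tm0 j))// divff// gt_eqF.
move=> B [cB gB].
have Bp j : B ((tp j)^-1 *: delta_mx 0 j) by apply: gB; left; exists j.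
have Bm j : B (- ((tm j)^-1 *: delta_mx 0 j)) by apply: gB; right; exists j.
have B0 : B 0.
  (* 0 lies between the two vertices on a coordinate axis *)
  pose j := Ordinal d0.
  have := tp0 j; have := tm0 j; move: (tp j) (tm j) (Bp j) (Bm j) => a b Ba Bb b0 a0.
  have ab : 0 < a + b by rewrite addr_gt0.
  have -> : 0 = (a / (a + b)) *: (a^-1 *: delta_mx 0 j) +
                (1 - a / (a + b)) *: (- (b^-1 *: delta_mx 0 j)) :> 'rV[R]_d.
    rewrite scalerN !scalerA -scalerBl.
    rewrite [X in X *: _](_ : _ = 0) ?scale0r//.
    by field; rewrite !gt_eqF.
  apply: convex_set_comb => //; first by rewrite divr_ge0// ltW.
  by rewrite ler_pdivrMr// mul1r lerDl ltW.
have -> : x = \sum_j gauge (tp j) (tm j) (x 0 j) *: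
    (if 0 <= x 0 j then (tp j)^-1 *: delta_mx 0 j else - ((tm j)^-1 *: delta_mx 0 j)).
  rewrite {1}[x]row_sum_delta; apply: eq_bigr => j _.
  case: ifPn => [xj|]; first by rewrite gauge_pos// scalerA mulrAC divff ?mul1r// gt_eqF.
  rewrite -ltNge => xj; rewrite -[in gauge _ _ _](opprK (x 0 j)).
  rewrite gauge_neg ?oppr_ge0 ?(ltW xj)// -scaleNr scalerA.
  by congr (_ *: _); field; rewrite gt_eqF.
apply: convex_set_sum => // j; first exact: gauge_ge0.
by case: ifPn.
Qed.

Lemma klein_closed_enorm kappa (x : 'rV[R]_d) : kappa < 0 ->
  klein_closed d kappa x -> enorm x ^+ 2 * - kappa <= 1.
Proof.
move=> k0; rewrite /klein_closed/= /klein leNgt k0/=.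
set r := Num.sqrt (- kappa).
have r0 : 0 < r by rewrite sqrtr_gt0 oppr_gt0.
have sqE (y : 'rV[R]_d) : enorm y ^+ 2 = \sum_i y 0 i ^+ 2.
  by rewrite sqr_sqrtr// sumr_ge0// => i _; exact: sqr_ge0.
have cs : continuous (fun y : 'rV[R]_d => \sum_i y 0 i ^+ 2).
  apply: continuous_big => [|i _ y]; first exact: add_continuous.
  apply: (@continuous_comp _ _ _ (fun y : 'rV[R]_d => y 0 i) (fun t : R => t ^+ 2)).
    exact: coord_continuous.
  exact: exprn_continuous.
have cl : closed [set y : 'rV[R]_d | \sum_i y 0 i ^+ 2 <= (- kappa)^-1].
  rewrite (_ : [set y | _] = (fun y : 'rV[R]_d => \sum_i y 0 i ^+ 2) @^-1`
     [set t | t <= (- kappa)^-1])//.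
  by apply: closed_comp; [move=> ? _; exact: cs|exact: closed_le].
have sub : [set y : 'rV[R]_d | enorm y < 1 / r] `<=`
    [set y : 'rV[R]_d | \sum_i y 0 i ^+ 2 <= (- kappa)^-1].
  move=> y /= yr; rewrite -sqE.
  have -> : (- kappa)^-1 = (1 / r) ^+ 2.
    by rewrite div1r exprVn sqr_sqrtr// oppr_ge0 ltW.
  by rewrite lerXn2r// ?nnegrE ?sqrtr_ge0 ?divr_ge0 ?(ltW r0)// ltW.
move=> /(closure_subset sub); rewrite -(closure_id _).1// => /= H.
by rewrite sqE -ler_pdivlMr ?oppr_gt0// div1r.
Qed.

Lemma enorm_delta (j : 'I_d) (a : R) : enorm (a *: delta_mx 0 j : 'rV[R]_d) ^+ 2 = a ^+ 2.
Proof.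
rewrite sqr_sqrtr; last by rewrite sumr_ge0// => i _; exact: sqr_ge0.
rewrite (bigD1 j)//= !mxE !eqxx mulr1 big1 ?addr0// => i ij.
by rewrite !mxE eqxx (negbTE ij)/= mulr0 expr0n.
Qed.

(** The vertices lie in the closed ball. For negative kappa these inequalities
    are what makes the integral in the volume formula converge. *)
Lemma crosspolytope_klein kappa : kappa < 0 ->
  crosspolytope tp tm `<=` klein_closed d kappa ->
  forall j, - kappa <= tp j ^+ 2 /\ - kappa <= tm j ^+ 2.
Proof.
move=> k0 sub j; rewrite crosspolytopeE in sub.
have key t a : 0 < t -> a ^+ 2 = t^-1 ^+ 2 ->
    gauge_sum ((a *: delta_mx 0 j : 'rV_d) 0) <= 1 -> - kappa <= t ^+ 2.
  move=> t0 at2 ga; have /(klein_closed_enorm k0) := sub _ ga.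
  rewrite enorm_delta at2 exprVn mulrC ler_pdivrMr ?exprn_gt0// mul1r//.
split.
  apply: (key _ (tp j)^-1) => //.
  by rewrite gauge_sum_delta gauge_pos ?invr_ge0 ?(ltW (tp0 j))// divff// gt_eqF.
apply: (key _ (- (tm j)^-1)) => //; first by rewrite sqrrN.
by rewrite gauge_sum_delta gauge_neg ?invr_ge0 ?(ltW (tm0 j))// divff// gt_eqF.
Qed.

End crosspolytope_gauge.

(** * Gaussian integrals on tuples *)

Section tuple_functions.
Context {R : realType}.
Local Notation mR := (measurableTypeR R).
Variable d : nat.

Definition sqnorm (t : d.-tuple mR) : R := \sum_j tnth t j ^+ 2.

Lemma sqnorm_ge0 t : 0 <= sqnorm t.
Proof. by apply: sumr_ge0 => j _; exact: sqr_ge0. Qed.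

Lemma measurable_tnth_comp (phi : R -> R) (j : 'I_d) : measurable_fun setT phi ->
  measurable_fun setT (fun t : d.-tuple mR => phi (tnth t j)).
Proof.
move=> mphi; apply: (@measurableT_comp _ _ _ _ _ _ (phi : mR -> mR)) => //.
exact: (@measurable_tnth _ mR d j).
Qed.

Lemma measurable_sqnorm : measurable_fun setT sqnorm.
Proof.
apply: measurable_sum => j; apply: (measurable_tnth_comp (phi := fun x => x ^+ 2)).
exact: exprn_measurable.
Qed.

Lemma sqnorm_scale (c : R) t : sqnorm (tuple_scale c t) = c ^+ 2 * sqnorm t.
Proof.
by rewrite /sqnorm mulr_sumr; apply: eq_bigr => j _; rewrite tnth_map exprMn.
Qed.

Lemma enorm_row_of_tuple (t : d.-tuple mR) : enorm (row_of_tuple t) ^+ 2 = sqnorm t.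
Proof.
rewrite sqr_sqrtr; last by apply: sumr_ge0 => i _; exact: sqr_ge0.
by apply: eq_bigr => j _; rewrite mxE.
Qed.

Variables tp tm : 'I_d -> R.
Hypotheses (tp0 : forall j, 0 < tp j) (tm0 : forall j, 0 < tm j).

Definition tuple_gauge (t : d.-tuple mR) : R := gauge_sum tp tm (tnth t).

Lemma tuple_gauge_ge0 t : 0 <= tuple_gauge t.
Proof. exact: gauge_sum_ge0. Qed.

Lemma measurable_tuple_gauge : measurable_fun setT tuple_gauge.
Proof.
apply: measurable_sum => j.
apply: (measurable_tnth_comp (phi := gauge (tp j) (tm j))).
exact: measurable_gauge.
Qed.

Lemma gauge_scale a b (c x : R) : 0 <= c -> gauge a b (c * x) = c * gauge a b x.
Proof. by move=> c0; rewrite /gauge maxr_pMr// mulrN !(mulrCA _ c). Qed.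

Lemma tuple_gauge_scale (c : R) t : 0 <= c ->
  tuple_gauge (tuple_scale c t) = c * tuple_gauge t.
Proof.
move=> c0; rewrite /tuple_gauge /gauge_sum mulr_sumr; apply: eq_bigr => j _.
by rewrite tnth_map gauge_scale.
Qed.

End tuple_functions.

Section gaussian_tuple.
Context {R : realType}.
Local Notation mR := (measurableTypeR R).
Local Notation leb := (@lebesgue_measure R).
Local Notation pos := (`]0, +oo[%classic : set R).
Variable d : nat.
Local Notation mu := (@lebesgue_tuple R d).

Definition polar (r a : R) : R[i] := (r * cos a) +i* (r * sin a).

Lemma Im_scale (c : R) (z : R[i]) : complex.Im (c%:C * z) = c * complex.Im z.
Proof. by case: z => a b /=; rewrite mul0r addr0. Qed.

Lemma polarM r a s b : polar r a * polar s b = polar (r * s) (a + b).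
Proof.
apply/eqP; rewrite eq_complex/= cosD sinD; apply/andP; split; apply/eqP; ring.
Qed.

Lemma prod_polar (I : Type) (s : seq I) (r a : I -> R) :
  \prod_(i <- s) polar (r i) (a i) = polar (\prod_(i <- s) r i) (\sum_(i <- s) a i).
Proof.
elim: s => [|i s IH]; first by rewrite !big_nil /polar cos0 sin0 mulr1 mulr0.
by rewrite !big_cons IH polarM.
Qed.

Definition gauss_tuple (t : d.-tuple mR) : R := \prod_j gauss (tnth t j).

Lemma gauss_tupleE t : gauss_tuple t = expR (- (sqnorm t / 2)).
Proof.
rewrite /gauss_tuple /sqnorm mulr_suml -sumrN.
by rewrite expR_sum; apply: eq_bigr.
Qed.

Lemma gauss_tuple_ge0 t : 0 <= gauss_tuple t.
Proof. by rewrite gauss_tupleE expR_ge0. Qed.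

Lemma integrable_tuple_prod (u : 'I_d -> R -> R) :
  (forall j, leb.-integrable setT (EFin \o u j)) ->
  mu.-integrable setT (fun t => (\prod_j u j (tnth t j))%:E).
Proof.
move=> iu; have [] := integral_tuple_prod iu (fun j => integrable0 leb setT).
move=> /= + _ _; apply: eq_integrable => // t _.
have -> : \prod_(j < d) (u j (tnth t j) +i* 0) = (\prod_(j < d) u j (tnth t j))%:C.
  by rewrite rmorph_prod.
by [].
Qed.

Variables tp tm : 'I_d -> R.
Hypotheses (tp0 : forall j, 0 < tp j) (tm0 : forall j, 0 < tm j).
Local Notation h := (tuple_gauge tp tm).

Definition gauss_Phi_prod (u : R) : R[i] :=
  \prod_j (gauss_Phi (tp j * u) + gauss_Phi (tm j * u)).

(** Since h is a sum of functions of one coordinate each, the function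
    exp(-|t|^2/2 + i u h(t)) is a product over the coordinates. *)
Lemma gauss_tuple_fourier u :
  [/\ mu.-integrable setT (fun t => (gauss_tuple t * cos (u * h t))%:E),
      mu.-integrable setT (fun t => (gauss_tuple t * sin (u * h t))%:E) &
      (\int[mu]_t (gauss_tuple t * cos (u * h t))) +i*
      (\int[mu]_t (gauss_tuple t * sin (u * h t))) =
      (sqrt2pi ^+ d)%:C * gauss_Phi_prod u].
Proof.
pose U j x := gauss x * cos (u * gauge (tp j) (tm j) x).
pose V j x := gauss x * sin (u * gauge (tp j) (tm j) x).
have F j := gauss_gauge_fourier u (tp0 j) (tm0 j).
have iU j : leb.-integrable setT (EFin \o U j) by have [] := F j.
have iV j : leb.-integrable setT (EFin \o V j) by have [] := F j.
have PE (t : d.-tuple mR) : \prod_(j < d) (U j (tnth t j) +i* V j (tnth t j)) =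
    polar (gauss_tuple t) (u * h t).
  by rewrite mulr_sumr -prod_polar.
have [/= I1 I2 I3] := integral_tuple_prod iU iV; split.
- by apply: eq_integrable I1 => // t _ /=; rewrite PE.
- by apply: eq_integrable I2 => // t _ /=; rewrite PE.
under eq_Rintegral => t _ do rewrite -[_ * _]/(complex.Re (polar _ (u * h t))) -PE.
rewrite (_ : \int[mu]_t (gauss_tuple t * sin (u * h t)) = \int[mu]_t
    complex.Im (\prod_(j < d) (U j (tnth t j) +i* V j (tnth t j)))); last first.
  by apply: eq_Rintegral => t _; rewrite PE.
rewrite I3 /gauss_Phi_prod.
transitivity (\prod_(j < d) (sqrt2pi%:C * (gauss_Phi (tp j * u) + gauss_Phi (tm j * u)))).
  by apply: eq_bigr => j _; have [_ _] := F j.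
by rewrite big_split/= prodr_const card_ord rmorphXn.
Qed.

Lemma integrable_gauss_tuple : mu.-integrable setT (EFin \o gauss_tuple).
Proof.
by apply: (@integrable_tuple_prod (fun=> gauss)) => j; exact: integrable_gauss.
Qed.

Lemma Rintegral_gauss_tuple : \int[mu]_t gauss_tuple t = sqrt2pi ^+ d.
Proof.
have [_ _] := gauss_tuple_fourier 0.
under eq_Rintegral do rewrite mul0r cos0 mulr1.
move=> /(congr1 (@complex.Re R)) /= ->.
rewrite [gauss_Phi_prod 0](_ : _ = 1) ?mulr1//.
rewrite /gauss_Phi_prod big1// => j _.
rewrite !mulr0 /gauss_Phi gauss0.
have -> : dawson 0 = 0 :> R by rewrite -gauss_sinE /gauss_sin;
  under eq_Rintegral do rewrite mul0r sin0 mulr0; rewrite Rintegral_cst// mul0r.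
rewrite mul0r; apply/eqP; rewrite eq_complex/= addr0 eqxx andbT.
by apply/eqP; field.
Qed.

(** The domination for Fubini's theorem, through |sin (h u) / u| <= h. *)
Lemma integrable_gauss_gauge : mu.-integrable setT
  (fun t => (gauss_tuple t * h t)%:E).
Proof.
have ij j : mu.-integrable setT
    (fun t => (gauss_tuple t * gauge (tp j) (tm j) (tnth t j))%:E).
  have := @integrable_tuple_prod
    (fun i x => if i == j then gauss x * gauge (tp j) (tm j) x else gauss x).
  move=> H; have {}H : mu.-integrable setT _ := H _.
  apply: eq_integrable (H _) => // [t _|i].
    rewrite /gauss_tuple (bigD1 j)//= eqxx [in RHS](bigD1 j)//=.
    congr (_%:E); rewrite [RHS]mulrAC; congr (_ * _); apply: eq_bigr => i ij.
    by rewrite (negbTE ij).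
  case: (i == j); last exact: integrable_gauss.
  apply: (@le_Rintegrable _ _ _ leb setT _
    (fun x => (tp j + tm j) * (`|x| * gauss x))) => //;
    last by apply: integrable_mull => //; exact: integrable_abs_gauss.
  - by apply: measurable_funM; [exact: measurable_gauss|exact: measurable_gauge].
  - move=> x _; rewrite normrM (ger0_norm (gauss_ge0 _)) mulrC mulrA.
    rewrite ler_wpM2r ?gauss_ge0// ger0_norm ?gauge_ge0//.
    have := tp0 j; have := tm0 j => b0 a0.
    by rewrite /gauge ge_max; case: (ger0P x) => x0; apply/andP; split; nra.
have := @integrable_sum _ _ _ mu setT measurableT _ (index_enum 'I_d) xpredT _ (fun j _ => ij j).
apply: eq_integrable => // t _.
by rewrite sumEFin mulr_sumr.
Qed.

(** The integrand of the volume formula is 2 i exp(-kappa u^2/2) times this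
    function. *)
Definition Im_kernel (u : R) : R := complex.Im (gauss_Phi_prod u) / u.

(* the integrand of Fubini's theorem, extended by 0 to u <= 0 *)
Local Notation sinc w := (fun z : d.-tuple mR * mR =>
  \1_pos z.2 * (gauss_tuple z.1 * (gauss (w * z.2) * (sin (h z.1 * z.2) / z.2)))).

Let mEh : measurable_fun setT gauss_tuple.
Proof. by have /measurable_int/measurable_EFinP := integrable_gauss_tuple. Qed.

Let mh := measurable_tuple_gauge tp tm.

Lemma measurable_invr : measurable_fun setT (fun x : R => x^-1).
Proof.
rewrite -(setUv [set (0 : R)]); apply/measurable_funU => //; first exact: measurableC.
split.
  by move=> mD Y mY; apply/measurable_fun_set1.
apply: open_continuous_measurable_fun; last by move=> x; rewrite inE/= => /eqP x0; exact: inv_continuous.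
by apply/closed_openC/accessible_closed_set1/hausdorff_accessible; exact: Rhausdorff.
Qed.

Let measurable_sinc w : measurable_fun setT (sinc w).
Proof.
apply: measurable_funM.
  by apply: (measurableT_comp _ measurable_snd); exact: measurable_indic.
apply: measurable_funM.
  exact: (measurableT_comp mEh measurable_fst).
apply: measurable_funM.
  apply: (measurableT_comp (@measurable_gauss R setT)).
  by apply: measurable_funM => //; exact: measurable_snd.
apply: measurable_funM; last exact: (measurableT_comp measurable_invr measurable_snd).
apply: measurableT_comp; first exact: continuous_measurable_fun (@continuous_sin R).
apply: measurable_funM; last exact: measurable_snd.
exact: (measurableT_comp mh measurable_fst).
Qed.

Let integrable_sinc w : 0 < w -> (@tuple_leb R d \x leb)%E.-integrable setT (EFin \o sinc w).
Proof.
move=> w0.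
have ig : leb.-integrable setT (EFin \o (fun u : R => gauss (w * u))).
  have := @integrable_expR_sqr R (w ^+ 2 / 2) setT ltac:(by rewrite divr_gt0// exprn_gt0) measurableT.
  by apply: eq_integrable => // u _ /=; rewrite /gauss exprMn mulrAC.
have [I _] := @integral_prod_mul _ _ _ _ R (@tuple_leb R d) leb _ _ integrable_gauss_gauge ig.
apply: (@le_Rintegrable _ _ _ (@tuple_leb R d \x leb)%E setT _
  (fun z => gauss_tuple z.1 * h z.1 * gauss (w * z.2))) => //.
move=> z _; rewrite indicE; have [zp|zp] := boolP (z.2 \in _); last first.
  by rewrite mul0r normr0 !mulr_ge0 ?gauss_tuple_ge0 ?gauss_ge0 ?tuple_gauge_ge0.
rewrite mul1r !normrM (ger0_norm (gauss_tuple_ge0 _)) (ger0_norm (gauss_ge0 _)).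
rewrite -!mulrA ler_wpM2l ?gauss_tuple_ge0// mulrC ler_wpM2r ?gauss_ge0//.
have z0 : 0 < z.2 by move: zp; rewrite inE/= in_itv/= andbT.
rewrite normfV ler_pdivrMr ?normr_gt0 ?gt_eqF//.
rewrite (le_trans (normr_sin_le _))// normrM ler_wpM2r//.
by rewrite ger0_norm// tuple_gauge_ge0.
Qed.

(** Fubini turns the representation of the Gaussian tail by a sine integral
    into the one-dimensional integral of the product of Fourier transforms. *)
Lemma gauss_tuple_tail w : 0 < w ->
  leb.-integrable pos (fun u => (gauss (w * u) * Im_kernel u)%:E) ->
  mu.-integrable setT (fun t => (gauss_tuple t * gauss_tail (h t / w))%:E) /\
  \int[mu]_t (gauss_tuple t * gauss_tail (h t / w)) =
  sqrt2pi ^+ d * (sqrt2pi / 2 - 2 / sqrt2pi *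
    \int[leb]_(u in pos) (gauss (w * u) * Im_kernel u)).
Proof.
move=> w0 iK.
have IF := integrable_sinc w0.
pose J t : R := \int[leb]_(u in pos) (gauss (w * u) * (sin (h t * u) / u)).
have iJ t := integrable_gauss_sinc w0 (tuple_gauge_ge0 tp0 tm0 t).
have inner1 t : (\int[leb]_u (sinc w (t, u))%:E = (gauss_tuple t * J t)%:E)%E.
  rewrite EFinM /J /Rintegral fineK; last exact: integrable_fin_num (iJ t).
  rewrite -integralZl// integral_mkcond; apply: eq_integral => u _ /=.
  rewrite patchE indicE; case: ifPn => _; first by rewrite mul1r EFinM.
  by rewrite mul0r.
have inner2 u : (\int[mu]_t (sinc w (t, u))%:E =
    ((fun u => gauss (w * u) * (sqrt2pi ^+ d * Im_kernel u)) \_ pos u)%:E)%E.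
  have [_ iS E] := gauss_tuple_fourier u.
  move/(congr1 (@complex.Im R)) : E; rewrite Im_scale/= => E.
  rewrite patchE; case: ifPn => upos; last first.
    rewrite [RHS](_ : _ = 0%E)// integral0_eq// => t _ /=.
    by rewrite indicE (negbTE upos) mul0r.
  have -> : gauss (w * u) * (sqrt2pi ^+ d * Im_kernel u) =
     gauss (w * u) / u * \int[mu]_t (gauss_tuple t * sin (u * h t)).
    by rewrite E /Im_kernel; ring.
  rewrite EFinM /Rintegral fineK; last exact: integrable_fin_num iS.
  rewrite -integralZl//; apply: eq_integral => t _ /=.
  by rewrite indicE upos mul1r -EFinM; congr (_%:E); rewrite [h t * u]mulrC; ring.
have iEJ : mu.-integrable setT (fun t => (gauss_tuple t * J t)%:E).
  have := integrable_fubini_F IF; apply: eq_integrable => // t _.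
  exact: inner1.
have FE : \int[mu]_t (gauss_tuple t * J t) =
    sqrt2pi ^+ d * \int[leb]_(u in pos) (gauss (w * u) * Im_kernel u).
  have FE := Fubini IF.
  rewrite -RintegralZl// [RHS]Rintegral_mkcond /Rintegral; congr fine.
  rewrite (_ : integral mu _ _ = \int[mu]_t \int[leb]_u (sinc w (t, u))%:E)%E.
    apply: (etrans FE); apply: eq_integral => u _; rewrite [LHS]inner2 !patchE.
    by case: ifPn => // _; congr (_%:E); ring.
  by apply: eq_integral => t _; rewrite inner1.
have E t : gauss_tuple t * gauss_tail (h t / w) =
    sqrt2pi / 2 * gauss_tuple t - 2 / sqrt2pi * (gauss_tuple t * J t).
  rewrite gauss_tail_fourier ?tuple_gauge_ge0// -/(J t).
  ring.
have i1 : mu.-integrable setT (fun t => (sqrt2pi / 2 * gauss_tuple t)%:E).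
  by apply: integrable_mull => //; exact: integrable_gauss_tuple.
have i2 : mu.-integrable setT (fun t => (2 / sqrt2pi * (gauss_tuple t * J t))%:E).
  by apply: integrable_mull.
split.
  have := integrable_subr measurableT i1 i2; apply: eq_integrable => // t _ /=.
  by rewrite E.
under eq_Rintegral do rewrite E.
rewrite RintegralB// !RintegralZl//; last exact: integrable_gauss_tuple.
by rewrite FE Rintegral_gauss_tuple; ring.
Qed.

End gaussian_tuple.

(** * Gaussian moments and the Gamma function *)

Section gaussian_moment.
Context {R : realType}.
Local Notation mR := (measurableTypeR R).
Local Notation leb := (@lebesgue_measure R).
Local Notation pos := (`]0, +oo[%classic : set R).

(** Allows a change of variables to be made on segments inside the open
    half-line, away from a singularity of the integrand at 0. *)
Lemma cvg_integral_exhaust (a b : nat -> R) (f : R -> R) :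
  (forall n, 0 < a n) -> (forall m n, (m <= n)%N -> a n <= a m /\ b m <= b n) ->
  (forall x, 0 < x -> exists n, a n <= x <= b n) ->
  measurable_fun pos f -> (forall x, 0 < x -> 0 <= f x) ->
  (\int[leb]_(x in `[a n, b n]) (f x)%:E)%E @[n --> \oo] -->
  (\int[leb]_(x in pos) (f x)%:E)%E.
Proof.
move=> a0 ab ex mf f0.
have sub n : `[a n, b n]%classic `<=` pos.
  by move=> x /=; rewrite !in_itv/= andbT => /andP[+ _]; exact: lt_le_trans.
have -> : pos = \bigcup_n `[a n, b n]%classic.
  apply/seteqP; split => [x /=|x [n _ /sub]//].
  by rewrite in_itv/= andbT => /ex[n xn]; exists n => //=; rewrite in_itv.
apply: ge0_nondecreasing_set_cvg_integral => //.
- move=> m n mn; apply/subsetPset => x /=; rewrite !in_itv/= => /andP[ax xb].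
  have [am bm] := ab _ _ mn.
  by rewrite (le_trans am ax) (le_trans xb bm).
- move=> n; apply/measurable_EFinP; exact: measurable_funS mf.
- by move=> n x /sub /=; rewrite in_itv/= andbT lee_fin => /f0.
Qed.

Lemma integral_halfsqr_subst (G : R -> R) :
  (forall x, 0 < x -> {for x, continuous G}) -> (forall x, 0 < x -> 0 <= G x) ->
  (\int[leb]_(x in pos) (G x)%:E =
   \int[leb]_(x in pos) (G (x ^+ 2 / 2) * x)%:E)%E.
Proof.
move=> cG G0.
pose F (x : R) : R := x ^+ 2 / 2.
have dF (x : R) := is_derive_halfsqr x : is_derive x 1 F x.
have F' : F^`()%classic = id.
  by apply/funext => x; rewrite derive1E; have [_] := dF x.
have cF : continuous F := is_derive_continuous dF.
have F0 x : 0 < x -> 0 < F x by move=> x0; rewrite divr_gt0// exprn_gt0.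
have mFG : measurable_fun pos (fun x => G (F x) * x).
  apply: open_continuous_measurable_fun => // x; rewrite inE/= in_itv/= andbT => x0.
  apply: (@cvgM _ _ _ _ (G \o F) id); last exact: cvg_id.
  by apply: continuous_comp; [exact: cF|apply: cG; exact: F0].
have mG : measurable_fun pos G.
  apply: open_continuous_measurable_fun => // x; rewrite inE/= in_itv/= andbT => x0.
  exact: cG.
pose a n : R := n.+1%:R^-1; pose b n : R := n.+1%:R.
have a0 n : 0 < a n by rewrite invr_gt0.
have ab n : a n <= b n.
  by rewrite (@le_trans _ _ 1)// ?invf_le1 ?ler1n.
have mono m n : (m <= n)%N -> a n <= a m /\ b m <= b n.
  by move=> mn; rewrite lef_pV2 ?posrE// !ler_nat.
have FaFb m n : (m <= n)%N -> F (a n) <= F (a m) /\ F (b m) <= F (b n).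
  move=> /mono[am bm]; rewrite !ler_pM2r ?invr_gt0//.
  by rewrite !lerXn2r ?nnegrE ?(ltW (a0 _)) ?ler0n//.
have exf x : 0 < x -> exists n, a n <= x <= b n.
  move=> x0; have xi : 0 < x^-1 by rewrite invr_gt0.
  pose N := Num.bound (x + x^-1); exists N.
  have : x + x^-1 < N.+1%:R.
    by rewrite (@lt_le_trans _ _ N%:R) ?ler_nat// archi_boundP// addr_ge0// ltW.
  move=> H; apply/andP; split; last by rewrite /b; lra.
  by rewrite -[leRHS]invrK lef_pV2 ?posrE//; lra.
have exF x : 0 < x -> exists n, F (a n) <= x <= F (b n).
  move=> x0; have s0 : 0 < Num.sqrt (2 * x) by rewrite sqrtr_gt0 mulr_gt0.
  have [n /andP[na nb]] := exf _ s0; exists n.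
  have -> : x = F (Num.sqrt (2 * x)).
    by rewrite /F sqr_sqrtr ?mulr_ge0 ?(ltW x0)//; field.
  by rewrite !ler_pM2r ?invr_gt0// !lerXn2r ?nnegrE ?(ltW (a0 _)) ?ler0n ?(ltW s0).
have C1 := cvg_integral_exhaust (fun n => F0 _ (a0 n)) FaFb exF mG G0.
have C2 := cvg_integral_exhaust a0 mono exf mFG
  (fun x x0 => mulr_ge0 (G0 _ (F0 _ x0)) (ltW x0)).
apply: (cvg_unique _ C1) => //.
suff E : (fun n => \int[leb]_(x in `[F (a n), F (b n)]) (G x)%:E)%E =
  (fun n => \int[leb]_(x in `[a n, b n]) (G (F x) * x)%:E)%E by rewrite /= E.
apply/funext => n; rewrite (@integration_by_substitution_increasing _ F G (a n) (b n)) ?F'//.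
- move=> x y; rewrite !in_itv/= => /andP[ax _] /andP[ay _] xy.
  have x0 : 0 < x := lt_le_trans (a0 n) ax.
  by rewrite ltr_pM2r ?invr_gt0// ltrXn2r ?nnegrE ?(ltW x0)// ltW// (lt_trans x0).
- by move=> x _; exact: cvg_id.
- by apply/cvg_ex; exists (a n); apply: cvg_at_right_filter; exact: cvg_id.
- by apply/cvg_ex; exists (b n); apply: cvg_at_left_filter; exact: cvg_id.
- split.
  + by move=> x _; have [] := dF x.
  + by apply: cvg_at_right_filter; exact: cF.
  + by apply: cvg_at_left_filter; exact: cF.
- apply: continuous_in_subspaceT => x; rewrite inE/= in_itv/= => /andP[ax _].
  by apply: cG; rewrite (lt_le_trans _ ax)// F0.
Qed.

Definition gauss_moment (d : nat) : R := \int[leb]_(r in pos) (r ^+ d * gauss r).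

Lemma integrable_gauss_moment d : leb.-integrable pos (fun r => (r ^+ d * gauss r)%:E).
Proof.
pose C : R := (d.+1)`!%:R * expR 1.
apply: (@le_Rintegrable _ _ _ leb pos _ (fun r => C * expR (- (4^-1 * r ^+ 2)))) => //;
  last by apply: integrable_mull => //; apply: integrable_expR_sqr => //; rewrite invr_gt0.
  apply: measurable_funM; last exact: measurable_gauss.
  by apply: measurable_funTS; exact: exprn_measurable.
move=> r /=; rewrite in_itv/= andbT => r0.
rewrite ger0_norm ?mulr_ge0 ?gauss_ge0 ?exprn_ge0 ?(ltW r0)//.
have -> : expR (- (4^-1 * r ^+ 2)) = expR (r ^+ 2 / 4) * gauss r.
  by rewrite /gauss -expRD; congr expR; field.
rewrite mulrA ler_wpM2r ?gauss_ge0// /C -mulrA -expRD.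
have H : expR r <= expR (1 + r ^+ 2 / 4).
  by rewrite ler_expR; have := sqr_ge0 (r / 2 - 1); nra.
case: d {C} => [|d].
  rewrite expr0 mul1r (le_trans _ H)//.
  by rewrite (le_trans _ (expR_ge1Dx _))// lerDl ltW.
apply: (@le_trans _ _ ((d.+2)`!%:R * expR r)); last by rewrite ler_wpM2l.
apply: (@le_trans _ _ ((d.+1)`!%:R * expR r)).
  rewrite mulrC -ler_pdivrMr ?ltr0n ?fact_gt0//.
  by have := expR_ge1Dxn d (ltW r0); lra.
by rewrite ler_wpM2r ?expR_ge0// ler_nat [leqRHS]factS leq_pmull.
Qed.

(** The substitution t = r^2/2 in the Gamma integral. *)
Lemma gauss_moment_Gamma d : (0 < d)%N ->
  gauss_moment d = 2 `^ (d.+1%:R / 2 - 1) * Gamma (d.+1%:R / 2).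
Proof.
move=> d0; have [s sE] : exists s : R, s = d.+1%:R / 2 by eexists.
rewrite -sE.
pose G (t : R) := t `^ (s - 1) * expR (- t).
have E : (\int[leb]_(x in pos) (x ^+ d * gauss x)%:E =
    (2 `^ (s - 1))%:E * \int[leb]_(x in pos) (G x)%:E)%E.
  rewrite (@integral_halfsqr_subst G); last 2 first.
  - move=> x x0.
    have ce : {for x, continuous (fun t : R => expR ((s - 1) * ln t) * expR (- t))}.
      apply: cvgM.
        apply: (@continuous_comp _ _ _ (fun t : R => (s - 1) * ln t) expR).
          by apply: cvgM; [exact: cvg_cst|exact: continuous_ln].
        exact: continuous_expR.
      apply: (@continuous_comp _ _ _ -%R expR); last exact: continuous_expR.
      exact: opp_continuous.
    have E : \near x, expR ((s - 1) * ln x) * expR (- x) = G x.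
      near=> t; rewrite /G /powR gt_eqF//.
      by near: t; exact: lt_nbhsr.
    have Gx := nbhs_singleton E.
    suff : G y @[y --> x] --> G x by [].
    rewrite -Gx; exact: (cvg_trans (near_eq_cvg E) ce).
  - by move=> x _; rewrite mulr_ge0 ?powR_ge0 ?expR_ge0.
  rewrite -ge0_integralZl//; last 2 first.
  - apply/measurable_EFinP; apply: measurable_funM => //; apply: measurable_funM.
      apply: measurable_funTS.
      apply: (measurableT_comp (measurable_powR (s - 1))).
      by apply: measurable_funM => //; exact: exprn_measurable.
    exact: measurable_gauss.
  - by move=> x /=; rewrite in_itv/= andbT => x0; rewrite lee_fin !mulr_ge0 ?powR_ge0 ?expR_ge0// ltW.
  apply: eq_integral => x; rewrite inE/= in_itv/= andbT => x0.
  rewrite -EFinM; congr (_%:E); rewrite /G.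
  have -> : (x ^+ 2 / 2) `^ (s - 1) = x ^+ d.-1 / 2 `^ (s - 1).
    rewrite powRM ?sqr_ge0 ?invr_ge0//; congr (_ * _).
      rewrite -[x ^+ 2]powR_mulrn ?(ltW x0)// -powRrM.
      have -> : 2%:R * (s - 1) = d.-1%:R :> R.
        rewrite sE.
        have -> : d.+1%:R = d.-1%:R + 1 + 1 :> R by rewrite !natr1 prednK.
        by field.
      by rewrite powR_mulrn// ltW.
    by rewrite -[LHS]/(2^-1 `^ (s - 1)) -powR_inv1// -powRrM mulN1r powRN.
  rewrite -{1}(prednK d0) exprSr -/(gauss x).
  have : 2 `^ (s - 1) != 0 :> R by rewrite gt_eqF// powR_gt0.
  by rewrite /gauss; move: (2 `^ _) => c c0; field.
have K : (\int[leb]_(x in pos) (x ^+ d * gauss x)%:E \is a fin_num)%E.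
  by apply: integrable_fin_num => //; exact: integrable_gauss_moment.
rewrite /gauss_moment /Rintegral E fineM//.
have c0 : 0 < 2 `^ (s - 1) :> R by rewrite powR_gt0.
have G0 : (0 <= \int[leb]_(x in pos) (G x)%:E)%E.
  by apply: integral_ge0 => x _; rewrite lee_fin mulr_ge0 ?powR_ge0 ?expR_ge0.
rewrite ge0_fin_numE//; apply: (lt_pmul_pinfty c0).
by rewrite -E ltey_eq K.
Unshelve. all: by end_near. Qed.

Lemma gauss_moment_gt0 d : 0 < gauss_moment d.
Proof.
rewrite -lte_fin /gauss_moment /Rintegral fineK; last first.
  by apply: integrable_fin_num => //; exact: integrable_gauss_moment.
have m12 : leb (`[1, 2]%classic : set R) = 1%E.
  by rewrite lebesgue_measure_itv/= lte_fin ltr1n -EFinB; congr (_%:E); ring.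
apply: (@lt_le_trans _ _ (\int[leb]_(x in `[1%R, 2%R]) (gauss 2)%:E)%E).
  by rewrite integral_cst// [X in (_ * X)%E]m12 mule1 lte_fin gauss_gt0.
have mf D : measurable_fun D (EFin \o (fun r : R => r ^+ d * gauss r)).
  apply/measurable_EFinP; apply: measurable_funM; last exact: measurable_gauss.
  by apply: measurable_funTS; exact: exprn_measurable.
apply: (@le_trans _ _ (\int[leb]_(x in `[1%R, 2%R]) (x ^+ d * gauss x)%:E)%E).
  apply: ge0_le_integral => //.
  - by move=> x _; rewrite lee_fin gauss_ge0.
  - exact: mf.
  - move=> x /=; rewrite in_itv/= => /andP[x1 x2].
    rewrite lee_fin -[leLHS]mul1r ler_pM ?gauss_ge0 ?exprn_ege1//.
    rewrite ler_expR lerN2 ler_wpM2r// lerXn2r// nnegrE//.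
    exact: le_trans x1.
apply: ge0_subset_integral => //; first exact: mf.
  by move=> x /=; rewrite in_itv/= andbT => x0; rewrite lee_fin mulr_ge0 ?gauss_ge0// exprn_ge0// ltW.
by move=> x /=; rewrite !in_itv/= andbT => /andP[x1 _]; exact: lt_le_trans x1.
Qed.

End gaussian_moment.

(** * The volume as a Laplace integral *)

Section radial.
Context {R : realType}.
Local Notation mR := (measurableTypeR R).
Local Notation leb := (@lebesgue_measure R).
Local Notation pos := (`]0, +oo[%classic : set R).

Lemma measurable_le_set d (T : measurableType d) (f g : T -> R) :
  measurable_fun setT f -> measurable_fun setT g -> measurable [set x | f x <= g x].
Proof.
move=> mf mg; rewrite (_ : [set x | _] = setT `&` (g \- f) @^-1` `[0, +oo[%classic).
  by apply: measurable_funB => //; exact: measurable_itv.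
by apply/seteqP; split=> x /=; rewrite in_itv/= andbT subr_ge0 => // -[].
Qed.

(** Kept as an extended real number: for a <= 0 the integral is infinite,
    which is how the points outside the open ball are detected. *)
Definition radial d (a : R) : \bar R :=
  (\int[leb]_(r in pos) (r ^+ d * expR (- (r ^+ 2 / 2 * a)))%:E)%E.

Lemma measurable_radial_integrand d (a : R) D : measurable_fun D
  (fun r : R => (r ^+ d * expR (- (r ^+ 2 / 2 * a)))%:E).
Proof.
apply/measurable_EFinP; apply: measurable_funTS; apply: measurable_funM.
  exact: exprn_measurable.
apply: measurableT_comp => //; apply: measurableT_comp => //.
by apply: measurable_funM => //; apply: measurable_funM.
Qed.

Lemma radial_pos d a : 0 < a ->
  radial d a = (gauss_moment d * (1 / (a `^ (d.+1%:R / 2))))%:E.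
Proof.
move=> a0; have s0 : 0 < Num.sqrt a by rewrite sqrtr_gt0.
have mf : measurable_fun pos (fun r : R => (r ^+ d * gauss r)%:E).
  by have /measurable_int := @integrable_gauss_moment R d.
have E : (\int[leb]_(r in pos) (r ^+ d * gauss r)%:E =
    (Num.sqrt a ^+ d.+1)%:E * radial d a)%E.
  rewrite (ge0_integral_scale_pos s0 mf); last first.
    by move=> x x0; rewrite lee_fin mulr_ge0 ?gauss_ge0// exprn_ge0// ltW.
  rewrite exprS EFinM -muleA; congr (_ * _)%E.
  rewrite -ge0_integralZl//; last 2 first.
  - exact: measurable_radial_integrand.
  - by move=> x /=; rewrite in_itv/= andbT => x0; rewrite lee_fin mulr_ge0 ?expR_ge0// exprn_ge0// ltW.
  apply: eq_integral => x _; rewrite -EFinM mulrA -exprMn; congr (_ * _)%:E.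
  by rewrite /gauss exprMn sqr_sqrtr ?(ltW a0)//; congr expR; ring.
have p0 : 0 < Num.sqrt a ^+ d.+1 by rewrite exprn_gt0.
have -> : a `^ (d.+1%:R / 2) = Num.sqrt a ^+ d.+1.
  by rewrite mulrC powRrM powR12_sqrt ?(ltW a0)// powR_mulrn// ltW.
rewrite EFinM /gauss_moment /Rintegral fineK; last first.
  by apply: integrable_fin_num => //; exact: integrable_gauss_moment.
by rewrite E muleAC -EFinM div1r mulfV ?mul1e// gt_eqF.
Qed.

Lemma radial_ge0 d a : (0 <= radial d a)%E.
Proof.
apply: integral_ge0 => x /=; rewrite in_itv/= andbT => x0.
by rewrite lee_fin mulr_ge0 ?expR_ge0// exprn_ge0// ltW.
Qed.

Lemma radial_npos d a : a <= 0 -> radial d a = +oo%E.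
Proof.
move=> a0; apply/eqP; rewrite -leye_eq.
have L : (\int[leb]_(r in `[1%R, +oo[) 1%:E = +oo)%E.
  have mu1 : leb (`[1, +oo[%classic : set R) = +oo%E.
    by rewrite lebesgue_measure_itv/= ltry.
  by rewrite integral_cst// [X in (_ * X)%E]mu1 mul1e.
rewrite -L.
apply: (@le_trans _ _ (\int[leb]_(r in `[1%R, +oo[) (r ^+ d * expR (- (r ^+ 2 / 2 * a)))%:E)%E).
  apply: ge0_le_integral => //.
  - exact: measurable_radial_integrand.
  - move=> x /=; rewrite in_itv/= andbT => x1.
    rewrite lee_fin -[leLHS]mul1r ler_pM// ?exprn_ege1// -expR0 ler_expR.
    by rewrite -mulrN mulr_ge0 ?oppr_ge0// divr_ge0// sqr_ge0.
apply: ge0_subset_integral => //.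
- exact: measurable_radial_integrand.
- move=> x /=; rewrite in_itv/= andbT => x0.
  by rewrite lee_fin mulr_ge0 ?expR_ge0// exprn_ge0// ltW.
- by move=> x /=; rewrite !in_itv/= !andbT; exact: lt_le_trans.
Qed.

End radial.

Section volume_laplace.
Context {R : realType}.
Local Notation mR := (measurableTypeR R).
Local Notation leb := (@lebesgue_measure R).
Local Notation pos := (`]0, +oo[%classic : set R).
Variables (d : nat) (tp tm : 'I_d -> R).
Hypotheses (tp0 : forall j, 0 < tp j) (tm0 : forall j, 0 < tm j).
Local Notation mu := (@lebesgue_tuple R d).
Local Notation h := (tuple_gauge tp tm).

Definition laplace (kappa : R) : \bar R :=
  (\int[mu]_t (expR (- (kappa / 2 * sqnorm t)) * gauss_tail (h t))%:E)%E.

Let mh := measurable_tuple_gauge tp tm.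
Let mq := @measurable_sqnorm R d.

Let A := [set t : d.-tuple mR | h t <= 1].
Let mA : measurable A. Proof. exact: measurable_le_set. Qed.

(* the cone over A, whose slice at height r > 0 is the dilate r A *)
Let B := [set z : d.-tuple mR * mR | h z.1 <= z.2].
Let mB : measurable B.
Proof.
apply: measurable_le_set; last exact: measurable_snd.
exact: (measurableT_comp mh measurable_fst).
Qed.

Lemma integral_gauss_ge c : 0 <= c ->
  (\int[leb]_(r in pos) (\1_[set r : mR | c <= r] r * gauss r)%:E = (gauss_tail c)%:E)%E.
Proof.
move=> c0; rewrite /gauss_tail /Rintegral fineK; last first.
  by apply: integrable_fin_num => //; exact: integrable_gauss.
have [->|cn0] := eqVneq c 0.
  rewrite -integral_itv_obnd_cbnd; last by apply/measurable_EFinP; exact: measurable_gauss.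
  apply: eq_integral => r; rewrite inE/= in_itv/= andbT => r0.
  by rewrite indicE mem_set ?mul1r//= ltW.
have c_gt0 : 0 < c by rewrite lt_neqAle eq_sym cn0.
rewrite [LHS]integral_mkcond [RHS]integral_mkcond; apply: eq_integral => r _.
rewrite !patchE !indicE; case: ifPn => rp.
  have -> : (r \in [set r : mR | c <= r]) = (r \in `[c, +oo[%classic).
    by apply/idP/idP; rewrite !inE/= in_itv/= andbT.
  by case: ifPn => _; rewrite ?mul1r ?mul0r.
case: ifPn => // rc; exfalso; move/negP: rp; apply.
move: rc; rewrite !inE/= !in_itv/= !andbT; exact: lt_le_trans.
Qed.

(** Both sides are integrals over pairs (t, r): of
    r^d exp(-r^2 (1 + kappa |t|^2)/2) over t in A, and of
    exp(-r^2/2 - kappa |t|^2/2) over the cone on A. At a fixed r the dilation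
    t -> r t carries one into the other. *)
Lemma radial_laplace kappa :
  (\int[mu]_(t in A) radial d (1 + kappa * sqnorm t) = laplace kappa)%E.
Proof.
pose G1 z : R := \1_A z.1 * (\1_pos z.2 * (z.2 ^+ d * expR (- (z.2 ^+ 2 / 2 * (1 + kappa * sqnorm z.1))))).
pose G2 z : R := \1_B z * (\1_pos z.2 * (gauss z.2 * expR (- (kappa / 2 * sqnorm z.1)))).
have posi (r : R) : \1_pos r * r ^+ d >= 0.
  rewrite indicE; have [|_] := boolP (r \in pos); last by rewrite mul0r.
  by rewrite inE/= in_itv/= andbT => r0; rewrite mul1r exprn_ge0// ltW.
have mpos : measurable_fun setT (fun z : d.-tuple mR * mR => \1_pos z.2 : R).
  by apply: (measurableT_comp _ measurable_snd); exact: measurable_indic.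
have mq1 : measurable_fun setT (fun z : d.-tuple mR * mR => sqnorm z.1).
  exact: (measurableT_comp mq measurable_fst).
have m2 : measurable_fun setT (fun z : d.-tuple mR * mR => z.2 : R) by exact: measurable_snd.
have mG1 : measurable_fun setT (EFin \o G1).
  apply/measurable_EFinP; apply: measurable_funM.
    by apply: (measurableT_comp _ measurable_fst); exact: measurable_indic.
  apply: measurable_funM => //; apply: measurable_funM.
    exact: measurable_funX.
  apply: measurableT_comp => //; apply: measurableT_comp => //.
  apply: measurable_funM; first by apply: measurable_funM => //; exact: measurable_funX.
  by apply: measurable_funD => //; apply: measurable_funM.
have mG2 : measurable_fun setT (EFin \o G2).
  apply/measurable_EFinP; apply: measurable_funM; first exact: measurable_indic.
  apply: measurable_funM => //; apply: measurable_funM.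
    exact: (measurableT_comp (@measurable_gauss R setT) m2).
  apply: measurableT_comp => //; apply: measurableT_comp => //.
  exact: measurable_funM.
have G10 z : (0 <= (EFin \o G1) z)%E.
  by rewrite lee_fin /G1 mulr_ge0// mulrA mulr_ge0// expR_ge0.
have G20 z : (0 <= (EFin \o G2) z)%E.
  by rewrite lee_fin /G2 !mulr_ge0// ?gauss_ge0 ?expR_ge0.
have E1 : (\int[mu]_(t in A) radial d (1 + kappa * sqnorm t) =
    \int[mu]_t \int[leb]_r (G1 (t, r))%:E)%E.
  rewrite integral_mkcond; apply: eq_integral => t _.
  rewrite patchE; have [tA|tA] := boolP (t \in A).
    rewrite /radial integral_mkcond; apply: eq_integral => r _.
    rewrite patchE /G1/= !indicE tA mul1r; case: ifPn => _; first by rewrite mul1r.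
    by rewrite mul0r.
  by rewrite integral0_eq// => r _; rewrite /G1/= indicE (negbTE tA) mul0r.
have E2 : (laplace kappa = \int[mu]_t \int[leb]_r (G2 (t, r))%:E)%E.
  apply: eq_integral => t _.
  rewrite EFinM -(integral_gauss_ge (tuple_gauge_ge0 tp0 tm0 t)).
  rewrite -ge0_integralZl//; last 2 first.
  - apply/measurable_EFinP; apply: measurable_funM; last exact: measurable_gauss.
    apply: measurable_funTS; apply: measurable_indic.
    exact: measurable_le_set.
  - by move=> r _; rewrite lee_fin mulr_ge0 ?gauss_ge0.
  rewrite integral_mkcond; apply: eq_integral => r _.
  rewrite patchE /G2/= !indicE; case: ifPn => _; last by rewrite mul0r mulr0.
  rewrite -EFinM mul1r; congr (_%:E).
  rewrite (_ : (t, r) \in B = (r \in [set r : mR | h t <= r])); first by ring.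
  by apply/idP/idP; rewrite !inE.
rewrite E1 E2.
rewrite (@fubini_tonelli _ _ _ _ _ (@tuple_leb R d) leb _ mG1 G10).
rewrite [RHS](@fubini_tonelli _ _ _ _ _ (@tuple_leb R d) leb _ mG2 G20).
apply: eq_integral => r _ /=.
have [r0|r0] := ltP 0 r; last first.
  have rn : \1_pos r = 0 :> R by rewrite indicE memNset//= in_itv/= andbT ltNge r0.
  by apply: eq_integral => t _; rewrite /G1 /G2/= rn !(mul0r, mulr0).
rewrite [RHS](@ge0_integral_tuple_scale _ _ r)//; last 2 first.
- by apply: (measurableT_comp mG2) => /=; exact: pair2_measurable.
- by move=> t; exact: G20.
rewrite -ge0_integralZl//; last 3 first.
- apply: (measurableT_comp (measurableT_comp mG2 (pair2_measurable r))).
  exact: measurable_tuple_scale.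
- by move=> t _; exact: G20.
- by rewrite lee_fin exprn_ge0// ltW.
apply: eq_integral => t _; rewrite -EFinM; congr (_%:E).
rewrite /G1 /G2/= sqnorm_scale !indicE [r \in pos]mem_set/= ?in_itv/= ?r0// !mul1r.
rewrite (_ : ((tuple_scale r t, r) \in B) = (t \in A)); last first.
  apply/idP/idP; rewrite !inE /A /B/= tuple_gauge_scale ?(ltW r0)//.
    by rewrite -[leRHS]mulr1 ler_pM2l.
  by move=> ht; rewrite -[leRHS]mulr1 ler_pM2l.
rewrite mulrCA; congr (_ * (_ * _)).
by rewrite /gauss -expRD; congr expR; field.
Qed.

Let preimage_klein kappa : (0 < d)%N ->
  row_of_tuple (d := d) @^-1` (crosspolytope tp tm `&` klein d kappa) =
  A `&` [set t | 0 < 1 + kappa * sqnorm t].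
Proof.
move=> d0; rewrite crosspolytopeE//.
have gE t : gauge_sum tp tm ((row_of_tuple t : 'rV[R]_d) 0) = h t.
  by apply: eq_bigr => j _; rewrite mxE.
have kE (t : d.-tuple mR) : klein d kappa (row_of_tuple t) <-> 0 < 1 + kappa * sqnorm t.
  rewrite /klein; case: ifPn => [k0|].
    by split=> // _; rewrite ltr_pwDl// mulr_ge0// sqnorm_ge0.
  rewrite -ltNge => k0; rewrite /= -enorm_row_of_tuple.
  have nk : 0 < - kappa by rewrite oppr_gt0.
  have r0 : 0 < Num.sqrt (- kappa) by rewrite sqrtr_gt0.
  have e0 : 0 <= enorm (row_of_tuple t) by rewrite sqrtr_ge0.
  have <- : (enorm (row_of_tuple t) * Num.sqrt (- kappa)) ^+ 2 < 1 <->
      enorm (row_of_tuple t) < 1 / Num.sqrt (- kappa).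
    by rewrite ltr_pdivlMr// expr_lt1// mulr_ge0// ltW.
  rewrite exprMn (@sqr_sqrtr _ (- kappa)) ?(ltW nk)// mulrN -subr_gt0 opprK mulrC.
  by [].
by apply/seteqP; split => t [] /=; rewrite gE => ht /kE.
Qed.

(** Outside the open ball the radial integral is infinite; when the Laplace
    integral is finite that part of the polytope is therefore null. *)
Lemma volume_laplace kappa (v : R) : (0 < d)%N -> laplace kappa = v%:E ->
  Vol kappa (crosspolytope tp tm) = (v / gauss_moment d)%:E.
Proof.
move=> d0 Lv.
pose a (t : d.-tuple mR) := 1 + kappa * sqnorm t.
have ma : measurable_fun setT a.
  by apply: measurable_funD => //; exact: measurable_funM.
pose S := A `&` [set t | 0 < a t]; pose N := A `&` [set t | a t <= 0].
have mN : measurable N by apply: measurableI => //; exact: measurable_le_set.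
have mS : measurable S.
  rewrite /S (_ : [set t | 0 < a t] = ~` [set t | a t <= 0]).
    by apply: measurableI => //; apply: measurableC; exact: measurable_le_set.
  by apply/seteqP; split => t /=; rewrite ltNge => /negP.
have SN : A = S `|` N.
  apply/seteqP; split => [t At|t [[]//|[]//]].
  by have [at0|at0] := ltP 0 (a t); [left|right].
have mphi : measurable_fun S (fun t => (1 / (a t `^ (d.+1%:R / 2)))%:E).
  apply/measurable_EFinP; apply: measurable_funM => //.
  apply: (measurableT_comp measurable_invr); apply: measurable_funTS.
  exact: (measurableT_comp (measurable_powR _) ma).
have rS : {in S, (fun t => radial d (a t)) =1
    (fun t => (gauss_moment d)%:E * (1 / (a t `^ (d.+1%:R / 2)))%:E)%E}.
  by move=> t; rewrite inE => -[_ at0]; rewrite radial_pos// EFinM.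
have rN : {in N, (fun t => radial d (a t)) =1 cst +oo%E}.
  by move=> t; rewrite inE => -[_ at0]; rewrite radial_npos.
have phi0 t : S t -> (0 <= (1 / (a t `^ (d.+1%:R / 2)))%:E)%E.
  by move=> _; rewrite lee_fin divr_ge0// powR_ge0.
have mr : measurable_fun (S `|` N) (fun t => radial d (a t)).
  apply/measurable_funU => //; split.
    apply: (eq_measurable_fun (fun t => ((gauss_moment d)%:E * (1 / (a t `^ (d.+1%:R / 2)))%:E)%E)).
      by move=> t /rS.
    by apply: measurable_funeM.
  by apply: (eq_measurable_fun (cst +oo%E)) => // t /rN.
have := radial_laplace kappa; rewrite Lv SN ge0_integral_setU//; last 2 first.
- by move=> t _; exact: radial_ge0.
- rewrite disj_set2E; apply/eqP/seteqP; split => // t [[_ /= a1] [_ /= a2]].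
  by move: a1; rewrite ltNge a2.
rewrite (eq_integral _ _ rS) (eq_integral _ _ rN) integral_cst//.
rewrite ge0_integralZl//; last by rewrite lee_fin ltW// gauss_moment_gt0.
set V := integral _ _ _ => E.
have V0 : (0 <= V)%E by exact: integral_ge0.
have K0 := @gauss_moment_gt0 R d.
have muN : mu N = 0%E.
  apply/eqP; apply/negPn/negP => muN.
  have muN0 : (0 < mu N)%E by rewrite lt0e muN measure_ge0.
  move: E; rewrite gt0_mulye// addey//.
  by rewrite -ltNye (lt_le_trans ltNy0)// mule_ge0// lee_fin ltW.
move: E; rewrite muN mule0 adde0 => E.
have -> : Vol kappa (crosspolytope tp tm) = V.
  rewrite /Vol (preimage_klein kappa d0); apply: eq_integral => t _.
  by rewrite enorm_row_of_tuple.
have Vfin : V \is a fin_num.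
  by rewrite ge0_fin_numE//; apply: (lt_pmul_pinfty K0); rewrite E ltry.
rewrite -(fineK Vfin) -EFinM in E; case: E => E.
rewrite -(fineK Vfin) -E; congr (_%:E); field.
by rewrite gt_eqF.
Qed.

End volume_laplace.

(** * Decay of the kernel in even dimension *)

Section complex_product.
Context {R : realType}.

(** Submultiplicative like the modulus, and expressed by the real and
    imaginary parts without a square root. *)
Definition norm1 (z : R[i]) : R := `|complex.Re z| + `|complex.Im z|.

Lemma norm1_ge0 z : 0 <= norm1 z. Proof. by rewrite addr_ge0. Qed.

Lemma norm1M z w : norm1 (z * w) <= norm1 z * norm1 w.
Proof.
case: z w => [a b] [c e]; rewrite /norm1/=.
apply: (le_trans (lerD (ler_normB _ _) (ler_normD _ _))); rewrite !normrM; lra.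
Qed.

Lemma normr_Im_mul z w :
  `|complex.Im (z * w)| <= `|complex.Im z| * norm1 w + norm1 z * `|complex.Im w|.
Proof.
case: z w => [a b] [c e]; rewrite /norm1/=.
apply: (le_trans (ler_normD _ _)); rewrite !normrM.
have := normr_ge0 a; have := normr_ge0 b; have := normr_ge0 c; have := normr_ge0 e.
nra.
Qed.

(** Every term in the expansion of the imaginary part contains the imaginary
    part of at least one factor. *)
Lemma normr_Im_prod (I : Type) (s : seq I) (w : I -> R[i]) (m M : R) :
  0 <= m -> 0 <= M -> (forall i, norm1 (w i) <= M) ->
  (forall i, `|complex.Im (w i)| <= m) ->
  `|complex.Im (\prod_(i <- s) w i)| <= (size s)%:R * m * M ^+ (size s).-1 /\
  norm1 (\prod_(i <- s) w i) <= M ^+ size s.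
Proof.
move=> m0 M0 wM wm; elim: s => [|i s [IH1 IH2]].
  by rewrite !big_nil /norm1/= normr0 normr1 !mul0r addr0.
rewrite !big_cons; split; last first.
  by rewrite (le_trans (norm1M _ _))//= exprS ler_pM// norm1_ge0.
rewrite (le_trans (normr_Im_mul _ _))//=.
have H1 : `|complex.Im (w i)| * norm1 (\prod_(j <- s) w j) <= m * M ^+ size s.
  by rewrite ler_pM// norm1_ge0.
have H2 : norm1 (w i) * `|complex.Im (\prod_(j <- s) w j)| <=
    M * ((size s)%:R * m * M ^+ (size s).-1).
  by rewrite ler_pM// norm1_ge0.
apply: (le_trans (lerD H1 H2)).
rewrite -natr1; case: (size s) => [|n /=]; first by rewrite expr0; lra.
by rewrite exprS; lra.
Qed.

Lemma measurable_prod_complex d (T : measurableType d) (D : set T) (I : Type) (s : seq I)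
    (w : I -> T -> R[i]) :
  (forall i, measurable_fun D (fun x => complex.Re (w i x))) ->
  (forall i, measurable_fun D (fun x => complex.Im (w i x))) ->
  measurable_fun D (fun x => complex.Re (\prod_(i <- s) w i x)) /\
  measurable_fun D (fun x => complex.Im (\prod_(i <- s) w i x)).
Proof.
move=> mR mI; elim: s => [|i s [IH1 IH2]].
  split.
    by rewrite (_ : (fun _ => _) = cst 1)//; apply/funext => x; rewrite big_nil.
  by rewrite (_ : (fun _ => _) = cst 0)//; apply/funext => x; rewrite big_nil.
split.
  rewrite (_ : (fun _ => _) = (fun x => complex.Re (w i x) * complex.Re (\prod_(j <- s) w j x) -
     complex.Im (w i x) * complex.Im (\prod_(j <- s) w j x))).
    by apply: measurable_funB; apply: measurable_funM.
  by apply/funext => x; rewrite big_cons; case: (w i x); case: (\prod_(j <- s) _).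
rewrite (_ : (fun _ => _) = (fun x => complex.Re (w i x) * complex.Im (\prod_(j <- s) w j x) +
   complex.Im (w i x) * complex.Re (\prod_(j <- s) w j x))).
  by apply: measurable_funD; apply: measurable_funM.
by apply/funext => x; rewrite big_cons; case: (w i x); case: (\prod_(j <- s) _).
Qed.

End complex_product.

Section kernel_bound.
Context {R : realType}.
Local Notation leb := (@lebesgue_measure R).
Local Notation pos := (`]0, +oo[%classic : set R).
Variables (d : nat) (tp tm : 'I_d -> R).
Hypotheses (tp0 : forall j, 0 < tp j) (tm0 : forall j, 0 < tm j).
Hypotheses (d2 : (2 <= d)%N) (d_even : ~~ odd d).

Let w j u := gauss_Phi (tp j * u) + gauss_Phi (tm j * u).

(* a single constant for all the bounds on the factors w j u *)
Let T : R := \sum_j (tp j + tm j + (tp j)^-1 + (tm j)^-1).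

Let T_ge j : tp j + tm j + (tp j)^-1 + (tm j)^-1 <= T.
Proof.
rewrite /T (bigD1 j)//= lerDl sumr_ge0// => i _.
by rewrite !addr_ge0// ?invr_ge0 ltW.
Qed.

Let T_ge0 : 0 <= T.
Proof. by apply: sumr_ge0 => j _; rewrite !addr_ge0// ?invr_ge0 ltW. Qed.

Let sqrt2pi_ge1 : (1 : R) <= sqrt2pi.
Proof.
rewrite -[leLHS]sqrtr1 ler_wsqrtr//.
by have := pi_ge2 R; lra.
Qed.

Let gauss_le_inv (x : R) : 0 < x -> gauss x <= x^-1.
Proof.
move=> x0; rewrite /gauss expRN lef_pV2 ?posrE ?expR_gt0//.
apply: le_trans (expR_ge1Dx _); have := sqr_ge0 (x - 1); nra.
Qed.

Let ReE j u : complex.Re (w j u) = (gauss (tp j * u) + gauss (tm j * u)) / 2.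
Proof. by rewrite /w /gauss_Phi/= -mulrDl. Qed.

Let ImE j u : complex.Im (w j u) = (dawson (tp j * u) + dawson (tm j * u)) / sqrt2pi.
Proof. by rewrite /w /gauss_Phi/= -mulrDl. Qed.

Let Re_ge0 j u : 0 <= complex.Re (w j u).
Proof. by rewrite ReE divr_ge0// addr_ge0// gauss_ge0. Qed.

Let Im_ge0 j u : 0 < u -> 0 <= complex.Im (w j u).
Proof.
by move=> u0; rewrite ImE divr_ge0// ?addr_ge0 ?dawson_ge0// ?mulr_ge0// ltW// sqrt2pi_gt0.
Qed.

Let div_sqrt2pi (x : R) : 0 <= x -> x / sqrt2pi <= x.
Proof. by move=> x0; rewrite ler_pdivrMr ?sqrt2pi_gt0// ler_peMr. Qed.

Let Im_le j u : 0 < u -> complex.Im (w j u) <= T * u.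
Proof.
move=> u0; have [a0 b0] := (tp0 j, tm0 j).
have [pu mu] : 0 <= tp j * u /\ 0 <= tm j * u by rewrite !mulr_ge0// ltW.
rewrite ImE (le_trans (div_sqrt2pi _))// ?addr_ge0 ?dawson_ge0//.
rewrite (le_trans (lerD (dawson_le pu) (dawson_le mu)))// -mulrDl ler_wpM2r ?(ltW u0)//.
by rewrite (le_trans _ (T_ge j))// -addrA lerDl addr_ge0// invr_ge0 ltW.
Qed.

Let Im_le_inv j u : 0 < u -> complex.Im (w j u) <= 2 * T / u.
Proof.
move=> u0; have [a0 b0] := (tp0 j, tm0 j).
have [pu mu] : 0 < tp j * u /\ 0 < tm j * u by rewrite !mulr_gt0.
rewrite ImE (le_trans (div_sqrt2pi _))// ?addr_ge0 ?dawson_ge0 ?(ltW pu) ?(ltW mu)//.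
rewrite (le_trans (lerD (dawson_le_inv pu) (dawson_le_inv mu)))//.
rewrite !invfM -mulrDr -mulrDl mulrA ler_wpM2r ?invr_ge0 ?(ltW u0)// ler_wpM2l//.
by rewrite (le_trans _ (T_ge j))// -addrA lerDr addr_ge0// ltW.
Qed.

Let Re_le_inv j u : 0 < u -> complex.Re (w j u) <= T / u.
Proof.
move=> u0; have [a0 b0] := (tp0 j, tm0 j).
have [pu mu] : 0 < tp j * u /\ 0 < tm j * u by rewrite !mulr_gt0.
rewrite ReE ler_pdivrMr//.
rewrite (le_trans (lerD (gauss_le_inv pu) (gauss_le_inv mu)))//.
rewrite !invfM -mulrDl.
have H : (tp j)^-1 + (tm j)^-1 <= T.
  by rewrite (le_trans _ (T_ge j))// -addrA lerDr addr_ge0// ltW.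
rewrite (@le_trans _ _ (T / u))//; first by rewrite ler_wpM2r// invr_ge0 ltW.
by rewrite ler_peMr// ?divr_ge0// ?(ltW u0)// ler1n.
Qed.

Let Re_le k j u : 0 <= k -> k <= tp j ^+ 2 -> k <= tm j ^+ 2 ->
  complex.Re (w j u) <= expR (- (k / 2 * u ^+ 2)).
Proof.
move=> k0 ka kb; rewrite ReE ler_pdivrMr//.
have key t : k <= t ^+ 2 -> gauss (t * u) <= expR (- (k / 2 * u ^+ 2)).
  move=> kt; rewrite ler_expR lerN2 exprMn mulrAC ler_wpM2r//.
  by rewrite ler_wpM2r// sqr_ge0.
by rewrite (le_trans (lerD (key _ ka) (key _ kb)))//; lra.
Qed.

Let Re_le1 j u : complex.Re (w j u) <= 1.
Proof.
have := @Re_le 0 j u (lexx 0) (sqr_ge0 _) (sqr_ge0 _).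
by rewrite !mul0r oppr0 expR0.
Qed.

Let size_index_ord : size (index_enum 'I_d) = d.
Proof. by rewrite -sum1_size sum_nat_const card_ord muln1. Qed.

(* the imaginary parts are O(u), which makes up for the division by u *)
Let small u : 0 < u -> u <= 1 ->
  `|Im_kernel tp tm u| <= d%:R * T * (1 + T) ^+ d.-1.
Proof.
move=> u0 u1; rewrite /Im_kernel normrM normfV [`|u|]gtr0_norm// ler_pdivrMr//.
have := @normr_Im_prod R _ (index_enum 'I_d) (w ^~ u) (T * u) (1 + T).
rewrite size_index_ord; case.
- by rewrite mulr_ge0// ltW.
- by rewrite addr_ge0.
- move=> j; rewrite /norm1 !ger0_norm ?Im_ge0//; apply: lerD; first exact: Re_le1.
  by rewrite (le_trans (Im_le _ _))// ler_piMr.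
- by move=> j; rewrite ger0_norm ?Im_ge0// Im_le.
by move=> H _; rewrite /gauss_Phi_prod (le_trans H)//; lra.
Qed.

Let large k u : 0 <= k -> (forall j, k <= tp j ^+ 2 /\ k <= tm j ^+ 2) -> 1 <= u ->
  `|Im_kernel tp tm u| <= d%:R * (3 * T) ^+ d.-1 * (expR (- (k / 2 * u ^+ 2)) / u ^+ 2).
Proof.
move=> k0 kt u1; have u0 : 0 < u by exact: lt_le_trans u1.
rewrite /Im_kernel normrM normfV [`|u|]gtr0_norm// ler_pdivrMr//.
(* Multiplying all d factors by i changes the product only by the sign
   (-1)^(d/2), and makes the Gaussian-small real parts imaginary. *)
pose v j : R[i] := 'i%C * w j u.
have vE : \prod_j v j = ((-1) ^+ d./2)%:C * gauss_Phi_prod tp tm u.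
  rewrite big_split/= prodr_const card_ord; congr (_ * _).
  rewrite -[in LHS](odd_double_half d) (negbTE d_even) add0n -mul2n exprM sqr_i.
  by rewrite rmorphXn rmorphN rmorph1.
have ImvE : `|complex.Im (\prod_j v j)| = `|complex.Im (gauss_Phi_prod tp tm u)|.
  by rewrite vE Im_scale normrM normrX normrN normr1 expr1n mul1r.
have vRe j : complex.Re (v j) = - complex.Im (w j u).
  by rewrite /v; case: (w j u) => a b /=; rewrite mul0r mul1r sub0r.
have vIm j : complex.Im (v j) = complex.Re (w j u).
  by rewrite /v; case: (w j u) => a b /=; rewrite mul0r mul1r add0r.
rewrite -ImvE.
have := @normr_Im_prod R _ (index_enum 'I_d) v (expR (- (k / 2 * u ^+ 2))) (3 * T / u).
rewrite size_index_ord; case.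
- exact: expR_ge0.
- by rewrite divr_ge0 ?mulr_ge0// ltW.
- move=> j; rewrite /norm1 vRe vIm normrN !ger0_norm ?Im_ge0//.
  by have := Im_le_inv j u0; have := Re_le_inv j u0; lra.
- by move=> j; rewrite vIm ger0_norm//; apply: Re_le; have [] := kt j.
move=> H _; apply: (le_trans H).
rewrite expr_div_n.
have -> : d%:R * (3 * T) ^+ d.-1 * (expR (- (k / 2 * u ^+ 2)) / u ^+ 2) * u =
  d%:R * expR (- (k / 2 * u ^+ 2)) * ((3 * T) ^+ d.-1 / u) by field; rewrite gt_eqF.
rewrite ler_wpM2l ?mulr_ge0 ?expR_ge0// ler_wpM2l ?exprn_ge0 ?mulr_ge0//.
rewrite lef_pV2 ?posrE ?exprn_gt0//.
rewrite -[leLHS]expr1 ler_weXn2l//.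
by case: d d2 => [|[|?]].
Qed.

(** For large u the real parts of the factors are of size exp(-k u^2/2), their
    imaginary parts only of size 1/u. As d is even, the product of all the
    terms i Im is real, so each term of the imaginary part of the product
    contains some real part and inherits its decay. The factor 1/(1 + u^2)
    keeps the integral convergent at kappa = -k, where the exponentials
    cancel. *)
Lemma Im_kernel_bound k : 0 <= k -> (forall j, k <= tp j ^+ 2 /\ k <= tm j ^+ 2) ->
  exists2 C : R, 0 <= C & forall u, 0 < u ->
    `|Im_kernel tp tm u| <= C * (expR (- (k / 2 * u ^+ 2)) / (1 + u ^+ 2)).
Proof.
move=> k0 kt.
pose C1 := d%:R * T * (1 + T) ^+ d.-1; pose C2 := d%:R * (3 * T) ^+ d.-1.
have C10 : 0 <= C1 by rewrite !mulr_ge0// exprn_ge0// addr_ge0.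
have C20 : 0 <= C2 by rewrite !mulr_ge0// exprn_ge0// mulr_ge0.
exists (2 * (C1 * expR (k / 2) + C2)).
  by rewrite mulr_ge0// addr_ge0// mulr_ge0// expR_ge0.
move=> u u0; have u20 : 0 < 1 + u ^+ 2 by rewrite addr_gt0// exprn_gt0.
have [u1|u1] := leP u 1.
  apply: (le_trans (small u0 u1)); rewrite -/C1.
  apply: (@le_trans _ _ (2 * (C1 * expR (k / 2)) * (expR (- (k / 2 * u ^+ 2)) / (1 + u ^+ 2)))).
    have -> : 2 * (C1 * expR (k / 2)) * (expR (- (k / 2 * u ^+ 2)) / (1 + u ^+ 2)) =
       C1 * ((2 / (1 + u ^+ 2)) * (expR (k / 2) * expR (- (k / 2 * u ^+ 2)))).
      by field; rewrite gt_eqF.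
    rewrite ler_peMr// -expRD mulr_ege1//.
      by rewrite ler_pdivlMr// mul1r; nra.
    rewrite -[leLHS]expR0 ler_expR subr_ge0 ler_piMr ?divr_ge0//.
    by rewrite expr_le1// ltW.
  rewrite ler_wpM2r ?divr_ge0 ?expR_ge0 ?(ltW u20)// ler_wpM2l// lerDl//.
apply: (le_trans (large k0 kt (ltW u1))); rewrite -/C2.
apply: (@le_trans _ _ (2 * C2 * (expR (- (k / 2 * u ^+ 2)) / (1 + u ^+ 2)))).
  have -> : 2 * C2 * (expR (- (k / 2 * u ^+ 2)) / (1 + u ^+ 2)) =
     C2 * (expR (- (k / 2 * u ^+ 2)) * (2 / (1 + u ^+ 2))) by field; rewrite gt_eqF.
  rewrite ler_wpM2l// ler_wpM2l ?expR_ge0// -div1r ler_pdivrMr ?exprn_gt0//.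
  by rewrite mulrAC ler_pdivlMr//; nra.
rewrite ler_wpM2r ?divr_ge0 ?expR_ge0 ?(ltW u20)// ler_wpM2l// lerDr//.
by rewrite mulr_ge0// expR_ge0.
Qed.

Lemma measurable_Im_kernel D : measurable_fun D (Im_kernel tp tm).
Proof.
apply: measurable_funTS; apply: measurable_funM; last exact: measurable_invr.
apply: (measurable_prod_complex _ (w := fun j u => w j u) _ _).2 => j.
  rewrite (_ : (fun _ => _) = (fun u => (gauss (tp j * u) + gauss (tm j * u)) / 2)); last first.
    by apply/funext => u; rewrite ReE.
  apply: measurable_funM => //; apply: measurable_funD.
    exact: (measurableT_comp (measurable_gauss (D := setT)) (mulrl_measurable _)).
  exact: (measurableT_comp (measurable_gauss (D := setT)) (mulrl_measurable _)).
rewrite (_ : (fun _ => _) = (fun u => (dawson (tp j * u) + dawson (tm j * u)) / sqrt2pi)); last first.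
  by apply/funext => u; rewrite ImE.
apply: measurable_funM => //; apply: measurable_funD.
  exact: (measurableT_comp (measurable_dawson (D := setT)) (mulrl_measurable _)).
exact: (measurableT_comp (measurable_dawson (D := setT)) (mulrl_measurable _)).
Qed.

End kernel_bound.

(** * Continuation in the curvature *)

Section continuation.
Context {R : realType}.
Local Notation mR := (measurableTypeR R).
Local Notation leb := (@lebesgue_measure R).
Local Notation pos := (`]0, +oo[%classic : set R).
Variables (d : nat) (tp tm : 'I_d -> R).
Hypotheses (tp0 : forall j, 0 < tp j) (tm0 : forall j, 0 < tm j).
Hypotheses (d2 : (2 <= d)%N) (d_even : ~~ odd d).
Local Notation mu := (@lebesgue_tuple R d).
Local Notation h := (tuple_gauge tp tm).

Definition kernel_integral (kappa : R) : R :=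
  \int[leb]_(u in pos) (expR (- (kappa * u ^+ 2 / 2)) * Im_kernel tp tm u).

Lemma integrable_inv_oneDsqr : leb.-integrable pos (fun u => (1 + u ^+ 2)^-1%:E).
Proof.
have m : measurable_fun pos (fun u : R => ((1 + u ^+ 2)^-1)%:E).
  apply/measurable_EFinP; apply: measurable_funTS.
  apply: (measurableT_comp measurable_invr).
  by apply: measurable_funD => //; exact: exprn_measurable.
apply/integrableP; split => //.
under eq_integral => u _.
  rewrite abse_EFin ger0_norm; last by rewrite invr_ge0 addr_ge0// sqr_ge0.
  over.
rewrite integral_itv_obnd_cbnd//.
by have := @integral0y_oneDsqr R; rewrite /oneDsqr => ->; rewrite ltry.
Qed.

Section bounded_below.
Variable k : R.
Hypotheses (k0 : 0 <= k) (kt : forall j, k <= tp j ^+ 2 /\ k <= tm j ^+ 2).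

Lemma kernel_dominated : exists2 C : R, 0 <= C & forall kappa u : R, - k <= kappa -> pos u ->
  `|expR (- (kappa * u ^+ 2 / 2)) * Im_kernel tp tm u| <= C * (1 + u ^+ 2)^-1.
Proof.
have [C C0 CH] := Im_kernel_bound tp0 tm0 d2 d_even k0 kt.
exists C => // kappa u kk; rewrite /= in_itv/= andbT => u0.
rewrite normrM ger0_norm ?expR_ge0// (le_trans (ler_wpM2l (expR_ge0 _) (CH _ u0)))//.
rewrite mulrCA ler_wpM2l// mulrA -expRD ler_piMl//.
  by rewrite invr_ge0 addr_ge0// sqr_ge0.
have kk0 : 0 <= kappa + k by rewrite -lerBlDr sub0r.
by rewrite -[leRHS]expR0 ler_expR; have := mulr_ge0 kk0 (sqr_ge0 u); lra.
Qed.

Let measurable_kernel (kappa : R) (D : set R) : measurable_fun D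
  (fun u : R => expR (- (kappa * u ^+ 2 / 2)) * Im_kernel tp tm u).
Proof.
apply: measurable_funM; last exact: measurable_Im_kernel.
apply: measurable_funTS; apply: measurableT_comp => //; apply: measurableT_comp => //.
apply: measurable_funM => //; apply: measurable_funM => //.
Qed.

Lemma integrable_kernel kappa : - k <= kappa ->
  leb.-integrable pos (fun u => (expR (- (kappa * u ^+ 2 / 2)) * Im_kernel tp tm u)%:E).
Proof.
move=> kk; have [C C0 CH] := kernel_dominated.
apply: (@le_Rintegrable _ _ _ leb pos _ (fun u => C * (1 + u ^+ 2)^-1)) => //.
- exact: measurable_kernel.
- by move=> u pu; exact: CH.
- by apply: integrable_mull => //; exact: integrable_inv_oneDsqr.
Qed.

Lemma cvg_kernel_integral (kn : nat -> R) (kappa : R) :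
  (forall n, - k <= kn n) -> kn @ \oo --> kappa ->
  (fun n => kernel_integral (kn n)) @ \oo --> kernel_integral kappa.
Proof.
move=> knk knc; have [C C0 CH] := kernel_dominated.
apply: (@Rdominated_cvg _ _ R leb pos
  (fun n u => expR (- (kn n * u ^+ 2 / 2)) * Im_kernel tp tm u)
  (fun u => expR (- (kappa * u ^+ 2 / 2)) * Im_kernel tp tm u)
  (fun u => C * (1 + u ^+ 2)^-1) _ _ _ _ _).2 => //.
- by move=> n; exact: measurable_kernel.
- move=> u _; apply: cvgM; last exact: cvg_cst.
  apply: continuous_cvg; first exact: continuous_expR.
  apply: cvgN; apply: cvgM; last exact: cvg_cst.
  by apply: cvgM; [exact: knc|exact: cvg_cst].
- by apply: integrable_mull => //; exact: integrable_inv_oneDsqr.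
- by move=> n u pu; exact: CH.
Qed.

(** In the variable t = 1 - kappa the integrand is exp(t u^2/2) times a fixed
    function. *)
Lemma kernel_power_series : power_series_on (1 + k) (fun t => kernel_integral (1 - t)).
Proof.
have E (t u : R) : expR (t * (u ^+ 2 / 2)) * (gauss u * Im_kernel tp tm u) =
    expR (- ((1 - t) * u ^+ 2 / 2)) * Im_kernel tp tm u.
  by rewrite mulrA /gauss -expRD; congr (expR _ * _); ring.
apply: (power_series_on_ext (F := fun t => \int[leb]_(u in pos)
    (expR (t * (u ^+ 2 / 2)) * (gauss u * Im_kernel tp tm u)))).
  by move=> t _; apply: eq_Rintegral => u _; rewrite E.
apply: laplace_power_series => //.
- by apply: measurable_funTS; apply: measurable_funM.
- by apply: measurable_funM; [exact: measurable_gauss|exact: measurable_Im_kernel].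
- by move=> u _; rewrite divr_ge0// sqr_ge0.
- move=> t /andP[_ t1].
  have := @integrable_kernel (1 - t) ltac:(lra).
  by apply: eq_integrable => // u _; rewrite E.
Qed.

End bounded_below.

Lemma gauss_tail_ge0 c : 0 <= gauss_tail c :> R.
Proof. by apply: Rintegral_ge0 => x _; exact: gauss_ge0. Qed.

Let measurable_gauss_tuple : measurable_fun setT (@gauss_tuple R d).
Proof. by have /measurable_int/measurable_EFinP := @integrable_gauss_tuple R d. Qed.

Let integrable_kernel_gauss w : 0 < w ->
  leb.-integrable pos (fun u => (gauss (w * u) * Im_kernel tp tm u)%:E).
Proof.
move=> w0; have := @integrable_kernel 0 (lexx 0) _ (w ^+ 2).
move=> H; have {}H := H (fun j => conj (sqr_ge0 _) (sqr_ge0 _)).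
have {}H : leb.-integrable pos _ := H _.
apply: eq_integrable (H _) => //.
  by move=> u _; rewrite /gauss exprMn.
by rewrite oppr0 sqr_ge0.
Qed.

(** Read off [gauss_tuple_tail] by division by the Gaussian weight. *)
Lemma measurable_gauss_tail_gauge : measurable_fun setT (fun t => gauss_tail (h t)).
Proof.
have [/measurable_int/measurable_EFinP m _] :=
  gauss_tuple_tail tp0 tm0 (@ltr01 R) (integrable_kernel_gauss ltr01).
have me : measurable_fun setT (fun t : d.-tuple mR => expR (sqnorm t / 2)).
  apply: measurableT_comp => //; apply: measurable_funM => //; exact: measurable_sqnorm.
have := measurable_funM me m; apply: eq_measurable_fun => t _ /=.
by rewrite divr1 gauss_tupleE mulrA -expRD subrr expR0 mul1r.
Qed.

Let measurable_laplace_integrand kappa : measurable_fun setT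
  (fun t => expR (- (kappa / 2 * sqnorm t)) * gauss_tail (h t)).
Proof.
apply: measurable_funM; last exact: measurable_gauss_tail_gauge.
apply: measurableT_comp => //; apply: measurableT_comp => //.
by apply: measurable_funM => //; exact: measurable_sqnorm.
Qed.

Let c0 : R := sqrt2pi ^+ d * (sqrt2pi / 2).
Let c1 : R := sqrt2pi ^+ d * (2 / sqrt2pi).

(** The dilation t -> t / sqrt kappa turns exp(-kappa |t|^2/2) into the
    standard Gaussian weight. *)
Lemma laplace_gt0 kappa : 0 < kappa ->
  laplace tp tm kappa = ((c0 - c1 * kernel_integral kappa) / kappa ^+ d./2)%:E.
Proof.
move=> kappa0; pose w := Num.sqrt kappa.
have w0 : 0 < w by rewrite sqrtr_gt0.
have w2 : w ^+ 2 = kappa by rewrite sqr_sqrtr// ltW.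
have [int E] := gauss_tuple_tail tp0 tm0 w0 (integrable_kernel_gauss w0).
have wi0 : 0 < w^-1 by rewrite invr_gt0.
rewrite /laplace (ge0_integral_tuple_scale wi0); last 2 first.
- exact/measurable_EFinP.
- by move=> t; rewrite lee_fin mulr_ge0 ?expR_ge0 ?gauss_tail_ge0.
rewrite (_ : integral _ _ _ = \int[mu]_t (gauss_tuple t * gauss_tail (h t / w))%:E)%E; last first.
  apply: eq_integral => t _; rewrite tuple_gauge_scale ?(ltW wi0)// [_ * h t]mulrC.
  congr (_ * _)%:E; rewrite gauss_tupleE sqnorm_scale; congr expR.
  by rewrite -w2; field; rewrite gt_eqF.
rewrite -(fineK (integrable_fin_num _ int))// -EFinM; congr (_%:E).
rewrite -[fine _]/(Rintegral _ _ _) E.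
have -> : \int[leb]_(u in pos) (gauss (w * u) * Im_kernel tp tm u) = kernel_integral kappa.
  by apply: eq_Rintegral => u _; rewrite /gauss exprMn w2.
have -> : kappa ^+ d./2 = w ^+ d.
  by rewrite -w2 -exprM mul2n -[in RHS](odd_double_half d) (negbTE d_even).
by rewrite exprVn /c0 /c1; field; rewrite !gt_eqF ?exprn_gt0 ?sqrt2pi_gt0.
Qed.

(** Write x^2 = (1 - eps) x^2 + eps x^2 and bound the first term at x = c: an
    arbitrarily small part of the exponent pays for the integral. *)
Lemma gauss_tail_le (eps c : R) : 0 < eps -> eps < 1 -> 0 <= c ->
  gauss_tail c <= expR (- ((1 - eps) / 2 * c ^+ 2)) * \int[leb]_x expR (- (eps / 2 * x ^+ 2)).
Proof.
move=> e0 e1 cge0.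
have ie (D : set R) : measurable D -> leb.-integrable D (fun x => (expR (- (eps / 2 * x ^+ 2)))%:E).
  by move=> mD; apply: integrable_expR_sqr => //; rewrite divr_gt0.
apply: (@le_trans _ _ (\int[leb]_(x in `[c, +oo[)
    (expR (- ((1 - eps) / 2 * c ^+ 2)) * expR (- (eps / 2 * x ^+ 2))))).
  apply: le_Rintegral => //; first exact: integrable_gauss.
    by apply: integrable_mull => //; exact: ie.
  move=> x /=; rewrite in_itv/= andbT => cx.
  rewrite -expRD ler_expR.
  have : c ^+ 2 <= x ^+ 2 by rewrite lerXn2r// nnegrE// (le_trans cge0).
  nra.
rewrite RintegralZl//; last exact: ie.
rewrite ler_wpM2l ?expR_ge0// /Rintegral fine_le//.
- by apply: integrable_fin_num => //; exact: ie.
- by apply: integrable_fin_num => //; exact: ie.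
apply: ge0_subset_integral => //.
by have /measurable_int := ie setT measurableT.
Qed.

Lemma integrable_expR_sqnorm (a : R) : 0 < a ->
  mu.-integrable setT (fun t => (expR (- (a * sqnorm t)))%:E).
Proof.
move=> a0.
have := @integrable_tuple_prod R d (fun _ x => expR (- (a * x ^+ 2))).
move=> H; have {}H : mu.-integrable setT _ := H _.
apply: eq_integrable (H _) => // [t _|j]; last exact: integrable_expR_sqr.
congr (_%:E); rewrite /sqnorm mulr_sumr -sumrN expR_sum; exact: eq_bigr.
Qed.

Section continuation_below.
Variable k : R.
Hypotheses (k0 : 0 <= k) (kt : forall j, k <= tp j ^+ 2 /\ k <= tm j ^+ 2).

Lemma sqnorm_le_gauge t : k * sqnorm t <= h t ^+ 2.
Proof.
have sumsq (I : Type) (s : seq I) (a : I -> R) : (forall i, 0 <= a i) ->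
    \sum_(i <- s) a i ^+ 2 <= (\sum_(i <- s) a i) ^+ 2.
  move=> a0; elim: s => [|i s IH]; first by rewrite !big_nil expr0n.
  rewrite !big_cons; have : 0 <= \sum_(j <- s) a j by exact: sumr_ge0.
  by have := a0 i; move: IH; nra.
apply: le_trans (sumsq _ _ _ (fun j => gauge_ge0 (tnth t j) (tp0 j) (tm0 j))).
rewrite /sqnorm mulr_sumr; apply: ler_sum => j _.
have [ka kb] := kt j; set x := tnth t j.
have [x0|x0] := leP 0 x.
  by rewrite gauge_pos// exprMn ler_wpM2r// sqr_ge0.
rewrite -[in leRHS](opprK x) gauge_neg ?oppr_ge0 ?(ltW x0)// exprMn sqrrN.
by rewrite ler_wpM2r// sqr_ge0.
Qed.

(** The tail at h is nearly of size exp(-h^2/2), and h^2 >= k |t|^2. With eps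
    so small that eps k < kappa + k, the integrand is at most a multiple of
    exp(-a |t|^2) with a > 0. *)
Lemma integrable_laplace kappa : - k < kappa ->
  mu.-integrable setT (fun t => (expR (- (kappa / 2 * sqnorm t)) * gauss_tail (h t))%:E).
Proof.
move=> kk.
have [s [sE s0]] : exists s : R, s = kappa + k /\ 0 < s by exists (kappa + k); split; lra.
have kge0 := k0.
have D0 : 0 < 2 * (k + s + 1) by rewrite mulr_gt0// addr_gt0// ltr_wpDl.
have [eps epsE] : exists eps : R, eps = s / (2 * (k + s + 1)) by eexists.
have e0 : 0 < eps by rewrite epsE divr_gt0.
have e1 : eps < 1 by rewrite epsE ltr_pdivrMr//; lra.
have ek : k * eps < s by rewrite epsE mulrA ltr_pdivrMr//; nra.
have [a aE] : exists a : R, a = (kappa + (1 - eps) * k) / 2 by eexists.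
have a0 : 0 < a by rewrite aE divr_gt0// mulrBl mul1r; rewrite sE in ek; lra.
pose C := \int[leb]_x expR (- (eps / 2 * x ^+ 2)).
have C0 : 0 <= C by apply: Rintegral_ge0 => x _; rewrite expR_ge0.
apply: (@le_Rintegrable _ _ _ mu setT _ (fun t => C * expR (- (a * sqnorm t)))) => //.
- move=> t _; rewrite ger0_norm ?mulr_ge0 ?expR_ge0 ?gauss_tail_ge0//.
  have := gauss_tail_le e0 e1 (tuple_gauge_ge0 tp0 tm0 t); rewrite -/C => H.
  rewrite (le_trans (ler_wpM2l (expR_ge0 _) H))// mulrA -expRD mulrC ler_wpM2l//.
  rewrite ler_expR aE; have := sqnorm_le_gauge t => G.
  have e2 : 0 <= 1 - eps by lra.
  by have := ler_wpM2l e2 G; lra.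
- by apply: integrable_mull => //; exact: integrable_expR_sqnorm.
Qed.

Let lap kappa := \int[mu]_t (expR (- (kappa / 2 * sqnorm t)) * gauss_tail (h t)).

Let laplaceE kappa : - k < kappa -> laplace tp tm kappa = (lap kappa)%:E.
Proof.
by move=> kk; rewrite /lap /Rintegral fineK//; exact: integrable_fin_num (integrable_laplace kk).
Qed.

Let lap_power_series : power_series_on (1 + k) (fun t => lap (1 - t)).
Proof.
have E (s : R) (t : d.-tuple mR) :
    expR (s * (sqnorm t / 2)) * (gauss_tuple t * gauss_tail (h t)) =
    expR (- ((1 - s) / 2 * sqnorm t)) * gauss_tail (h t).
  by rewrite gauss_tupleE mulrA -expRD; congr (expR _ * _); ring.
apply: (power_series_on_ext (F := fun s => \int[mu]_t
    (expR (s * (sqnorm t / 2)) * (gauss_tuple t * gauss_tail (h t))))).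
  by move=> s _; apply: eq_Rintegral => t _; rewrite E.
apply: laplace_power_series => //.
- by apply: measurable_funM => //; exact: measurable_sqnorm.
- by apply: measurable_funM => //; exact: measurable_gauss_tail_gauge.
- by move=> t _; rewrite divr_ge0// sqnorm_ge0.
- move=> s /andP[_ s1].
  have := @integrable_laplace (1 - s) ltac:(lra).
  by apply: eq_integrable => // t _; rewrite E.
Qed.

(** Multiplied by kappa^(d/2), a polynomial in t = 1 - kappa, both sides are
    power series in t on [0, 1 + k). They agree on ]0, 1[, where kappa is
    positive, hence everywhere. *)
Lemma laplace_continuation kappa : - k < kappa -> kappa < 0 ->
  laplace tp tm kappa = ((c0 - c1 * kernel_integral kappa) / kappa ^+ d./2)%:E.
Proof.
move=> kk kappa0.
have PS := power_series_onD (power_series_on_linX d./2 lap_power_series)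
  (power_series_onD (power_series_onZ c1 (kernel_power_series k0 kt))
    (power_series_on_cst (1 + k) (- c0))).
have Z (t : R) : 0 < t < 1 ->
    (1 - t) ^+ d./2 * lap (1 - t) + (c1 * kernel_integral (1 - t) + - c0) = 0.
  move=> /andP[t0 t1]; have t1' : 0 < 1 - t by lra.
  have := laplace_gt0 t1'; rewrite laplaceE; last by lra.
  move=> -[->]; field; rewrite expf_neq0// gt_eqF//.
have := power_series_on_eq0 PS (@ltr01 R) Z (t := 1 - kappa).
have tk : 0 <= 1 - kappa < 1 + k by apply/andP; split; lra.
move=> /(_ tk); rewrite subKr => H.
rewrite laplaceE//; congr (_%:E).
have n0 : kappa ^+ d./2 != 0 by rewrite expf_neq0// lt_eqF.
by apply: (mulIf n0); rewrite [RHS]divfK//; lra.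
Qed.

(** At the end kappa = -k of the half-line the Laplace integral is reached by monotone
    convergence and the kernel integral by dominated convergence. The
    inclusion of the polytope in the closed ball gives the value k = - kappa,
    so this boundary case covers every negative kappa. *)
Lemma laplace_endpoint : 0 < k ->
  laplace tp tm (- k) = ((c0 - c1 * kernel_integral (- k)) / (- k) ^+ d./2)%:E.
Proof.
move=> k_gt0.
pose kn n : R := - k + k / n.+2%:R.
have knk n : - k < kn n by rewrite ltrDl divr_gt0.
have kn0 n : kn n < 0.
  by rewrite /kn addrC subr_lt0 ltr_pdivrMr// ltr_pMr// ltr1n.
have knc : kn @ \oo --> - k.
  rewrite -[X in _ --> X]addr0; apply: cvgD; first exact: cvg_cst.
  rewrite -(mulr0 k); apply: cvgM; first exact: cvg_cst.
  have := @cvg_harmonic R; rewrite -cvg_shiftS; exact.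
have kn_dec m n : (m <= n)%N -> kn n <= kn m.
  by move=> mn; rewrite lerD2l ler_pM2l// lef_pV2 ?posrE// ler_nat !ltnS.
pose f n t := (expR (- (kn n / 2 * sqnorm t)) * gauss_tail (h t))%:E.
have f_cvg t : f ^~ t @ \oo --> (expR (- (- k / 2 * sqnorm t)) * gauss_tail (h t))%:E.
  apply: cvg_EFin; first exact: nearW.
  apply: cvgM; last exact: cvg_cst.
  apply: continuous_cvg; first exact: continuous_expR.
  apply: cvgN; apply: cvgM; last exact: cvg_cst.
  by apply: cvgM; [exact: knc|exact: cvg_cst].
have C1 : (fun n => laplace tp tm (kn n)) @ \oo --> laplace tp tm (- k).
  rewrite /laplace.
  rewrite (_ : (\int[mu]_t _)%E = (\int[mu]_t limn (f ^~ t))%E); last first.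
    by apply: eq_integral => t _; apply/esym/cvg_lim => //; exact: f_cvg.
  apply: cvg_monotone_convergence => //.
  - by move=> n; exact/measurable_EFinP.
  - by move=> n t _; rewrite lee_fin mulr_ge0 ?expR_ge0 ?gauss_tail_ge0.
  - move=> t _ m n mn; rewrite lee_fin ler_wpM2r ?gauss_tail_ge0// ler_expR lerN2.
    by rewrite ler_wpM2r ?sqnorm_ge0// ler_wpM2r// kn_dec.
have C2 : (fun n => laplace tp tm (kn n)) @ \oo -->
    ((c0 - c1 * kernel_integral (- k)) / (- k) ^+ d./2)%:E.
  rewrite (_ : (fun n => _) = (fun n => ((c0 - c1 * kernel_integral (kn n)) / kn n ^+ d./2)%:E)).
    apply: cvg_EFin; first exact: nearW.
    apply: cvgM.
      apply: cvgB; first exact: cvg_cst.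
      apply: cvgM; first exact: cvg_cst.
      by apply: (cvg_kernel_integral k0 kt) => // n; exact: ltW.
    apply: cvgV; first by rewrite expf_neq0// oppr_eq0 gt_eqF.
    apply: (@continuous_cvg _ _ _ _ _ kn (fun x : R => x ^+ d./2)); last exact: knc.
    exact: exprn_continuous.
  by apply/funext => n; rewrite laplace_continuation.
exact: (cvg_unique _ C1 C2).
Qed.

End continuation_below.

Lemma laplace_kernel kappa : kappa != 0 ->
  (kappa < 0 -> forall j, - kappa <= tp j ^+ 2 /\ - kappa <= tm j ^+ 2) ->
  laplace tp tm kappa = ((sqrt2pi ^+ d * (sqrt2pi / 2) -
    sqrt2pi ^+ d * (2 / sqrt2pi) * kernel_integral kappa) / kappa ^+ d./2)%:E.
Proof.
move=> kn0 kt; have [kappa0|kappa0|/eqP] := ltgtP kappa 0; last by rewrite (negbTE kn0).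
  have nk : 0 < - kappa by rewrite oppr_gt0.
  by rewrite -[in LHS](opprK kappa) (laplace_endpoint (ltW nk) (kt kappa0) nk) opprK.
exact: laplace_gt0.
Qed.

End continuation.

Section integrand.
Context {R : realType}.
Local Notation leb := (@lebesgue_measure R).
Local Notation pos := (`]0, +oo[%classic : set R).

(** Phi(- i y) is the conjugate of Phi(i y), so the difference of the two
    products is 2 i times the imaginary part of the first. *)
Lemma vol_integrandE d (kappa : R) (tp tm : 'I_d -> R) (y : R) :
  vol_integrand kappa tp tm y =
  0 +i* (2 * (expR (- (kappa * y ^+ 2 / 2)) * Im_kernel tp tm y)).
Proof.
have E (t : R) : (expR (- (t ^+ 2 * y ^+ 2 / 2)))%:C * Phi ('i%C * (t * y)%:C) = gauss_Phi (t * y).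
  by rewrite -gauss_PhiE exprMn.
have EN (t : R) : (expR (- (t ^+ 2 * y ^+ 2 / 2)))%:C * Phi (- 'i%C * (t * y)%:C) =
    (gauss_Phi (t * y))^*%C.
  rewrite -gauss_PhiN -gauss_PhiE sqrrN exprMn.
  by rewrite mulNr -mulrN -rmorphN.
rewrite /vol_integrand.
under eq_bigr do rewrite !E.
under [X in _ * (_ - X)]eq_bigr do rewrite !EN -rmorphD.
rewrite -rmorph_prod -/(gauss_Phi_prod tp tm y) /Im_kernel.
case: (gauss_Phi_prod tp tm y) => a b /=.
apply/eqP; rewrite eq_complex/=; apply/andP; split; apply/eqP; ring.
Qed.

End integrand.

(** * The volume formula *)

Section constants.
Context {R : realType}.

(** The constant term of the Laplace integral, divided by the radial constant,
    is the first term of the volume formula. *)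
Lemma omega_gauss_moment d : (0 < d)%N ->
  sqrt2pi ^+ d * (sqrt2pi / 2) / gauss_moment d = omega d.+1 / 2 :> R.
Proof.
move=> d0; have K0 := @gauss_moment_gt0 R d.
move: K0; rewrite gauss_moment_Gamma// /omega.
have [s sE] : exists s : R, s = d.+1%:R / 2 by eexists.
rewrite -sE => K0.
have -> : sqrt2pi ^+ d * (sqrt2pi / 2) = 2 `^ (s - 1) * pi `^ s :> R.
  rewrite mulrA -exprSr.
  have -> : sqrt2pi ^+ d.+1 = 2 `^ s * pi `^ s :> R.
    rewrite -powRM ?pi_ge0// sE [_ / 2]mulrC powRrM powR12_sqrt ?mulr_ge0 ?pi_ge0//.
    by rewrite powR_mulrn ?sqrtr_ge0.
  have -> : 2 `^ s = 2 `^ (s - 1) * 2 :> R.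
    by rewrite powRB ?pnatr_eq0 ?implybT// powRr1// divfK.
  by field.
have c0 : 2 `^ (s - 1) != 0 :> R by rewrite gt_eqF// powR_gt0.
have G0 : Gamma s != 0 by move: K0; rewrite pmulr_rgt0 ?powR_gt0// => /gt_eqF ->.
by field; rewrite G0 c0.
Qed.

End constants.

Theorem theorem8p2 (R : realType) (d : nat) (kappa : R)
    (taup taum : 'I_d -> R)
    (hd : (2 <= d)%N) (d_even : ~~ odd d)
    (hkappa : kappa != 0)
    (htaup : forall j, 0 < taup j) (htaum : forall j, 0 < taum j)
    (hP : crosspolytope taup taum `<=` klein_closed d kappa) :
  Cintegrable `]0, +oo[ (vol_integrand kappa taup taum) /\
  exists v : R,
    Vol kappa (crosspolytope taup taum) = v%:E /\
    v%:C = (omega d.+1 / kappa ^+ d./2)%:C *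
           (1 / 2 + 'i%C / (2 * pi)%:C *
              Cintegral `]0, +oo[ (vol_integrand kappa taup taum)).
Proof.
have d0 : (0 < d)%N by exact: leq_trans hd.
have kt (kappa0 : kappa < 0) := crosspolytope_klein d0 htaup htaum kappa0 hP.
(* integrability only needs some rate k >= - kappa of Gaussian decay *)
have [k [k0 kk kk2]] : exists k : R, [/\ 0 <= k, - k <= kappa &
    forall j, k <= taup j ^+ 2 /\ k <= taum j ^+ 2].
  have [kappa0|kappa0] := ltP kappa 0.
    by exists (- kappa); split; rewrite ?oppr_ge0 ?opprK ?(ltW kappa0)//; exact: kt.
  by exists 0; split; rewrite ?oppr0// => j; rewrite !sqr_ge0.
have iK := integrable_kernel htaup htaum hd d_even k0 kk2 kk.
split.
  split.
    apply: eq_integrable (integrable0 _ _) => // y _.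
    by rewrite vol_integrandE.
  apply: eq_integrable (integrable_mull 2 _ iK) => // y _.
  by rewrite vol_integrandE.
have L := laplace_kernel htaup htaum hd d_even hkappa kt.
have V := volume_laplace htaup htaum d0 L.
eexists; split; first exact: V.
have -> : Cintegral `]0, +oo[ (vol_integrand kappa taup taum) =
    0 +i* (2 * kernel_integral taup taum kappa).
  rewrite /Cintegral; congr (_ +i* _).
    under eq_Rintegral do rewrite vol_integrandE/=.
    by rewrite Rintegral_cst// mul0r.
  under eq_Rintegral do rewrite vol_integrandE/=.
  by rewrite RintegralZl//; exact: iK.
set J := kernel_integral _ _ _.
have pi0 : (pi : R) != 0 by rewrite gt_eqF// pi_gt0.
have s0 : (sqrt2pi : R) != 0 by rewrite gt_eqF// sqrt2pi_gt0.
have -> : 1 / 2 + 'i%C / (2 * pi)%:C * (0 +i* (2 * J)) = (1 / 2 - J / pi)%:C :> R[i].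
  have -> : (0 +i* (2 * J)) = 'i%C * (2 * J)%:C :> R[i].
    by apply/eqP; rewrite eq_complex/= !mul0r !mulr0 mul1r subrr add0r !eqxx.
  have -> : 1 / 2 = (1 / 2)%:C :> R[i] by rewrite rmorphM fmorphV rmorph1 rmorph_nat.
  rewrite mulrACA -expr2 sqr_i -fmorphV -rmorphM -(rmorphN1 (real_complex R)).
  rewrite -rmorphM -rmorphD; congr (_%:C).
  by move: (pi : R) pi0 => p p0; field.
rewrite -rmorphM; congr (_%:C).
have -> : sqrt2pi ^+ d * (2 / sqrt2pi) = sqrt2pi ^+ d * (sqrt2pi / 2) * (2 / pi) :> R.
  have -> : pi = sqrt2pi ^+ 2 / 2 :> R by rewrite sqr_sqrt2pi mulrC mulKf.
  by move: (sqrt2pi : R) s0 => q q0; field.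
have := omega_gauss_moment (R := R) d0.
set A := sqrt2pi ^+ d * _ => E.
have -> : omega d.+1 = 2 * (A / gauss_moment d) :> R by rewrite E; field.
have K0 : gauss_moment d != 0 :> R by rewrite gt_eqF// gauss_moment_gt0.
move: (pi : R) pi0 => p p0.
by field; rewrite K0 p0 expf_neq0.
Qed.
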